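(* Let $k$ be a field of characteristic zero and let $\nu$ be an Abhyankar valuation on $k[[x]]$ with value group $\Gamma$. Let $N:=\dim_{\mathbb{Q}}\Gamma\otimes_{\mathbb{Z}}\mathbb{Q}$. Let $\gamma_1,\dots,\gamma_N$ be homogeneous elements with respect to $\nu$ and let $P(Z)\in V_\nu^{\mathrm{fg}}[\langle\gamma_1,\dots,\gamma_N\rangle][Z]$ (resp. $P(Z)\in\widehat V_\nu[\langle\gamma_1,\dots,\gamma_N\rangle][Z]$) be a monic polynomial of degree $d$. Then there exist integral homogeneous elements $\gamma'_1,\dots,\gamma'_N$ with respect to $\nu$ such that the roots of $P(Z)$ are in $V_\nu^{\mathrm{fg}}[\langle\gamma'_1,\dots,\gamma'_N\rangle]$ (resp. in $\widehat V_\nu[\langle\gamma'_1,\dots,\gamma'_N\rangle]$).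
   Context: Valuations. $x=(x_1,\dots,x_n)$, $n\ge2$, $K_n=\mathrm{Frac}(k[[x]])$. A valuation $\nu$ on $k[[x]]$ takes values in $\Gamma\cap\mathbb{R}_{\ge0}=:\Gamma^+$ on nonzero series, $\Gamma$ a subgroup of $\mathbb{R}$, with $\nu(fg)=\nu(f)+\nu(g)$, $\nu(f+g)\ge\min\{\nu(f),\nu(g)\}$, $\nu(0)=\infty$, and $\nu(f)>0$ iff $f$ is in the maximal ideal; it extends to $K_n$ and $\nu:K_n^*\to\Gamma$ is assumed surjective. $V_\nu$ is its valuation ring, $k_\nu$ its residue field. $\nu$ is an Abhyankar valuation if $\mathrm{tr.deg}_k k_\nu+\dim_{\mathbb{Q}}\Gamma\otimes\mathbb{Q}=n$. $\widehat V_\nu$ is the completion of $V_\nu$ for the topology given by the ideals $\{\nu\ge\lambda\}$, and $\widehat K_\nu=\mathrm{Frac}(\widehat V_\nu)$. Fixed identification with the graded ring. Let $\mathfrak p_i=\{v\in V_\nu:\nu(v)\ge i\}$, $\mathfrak p_i^+=\{v\in V_\nu:\nu(v)>i\}$. The completed graded ring $\widehat{\mathrm{Gr}_\nu V_\nu}$ is the set of formal sums $\sum_{i\in\Lambda}a_i$, $a_i\in\mathfrak p_i/\mathfrak p_i^+$, with $\Lambda\subset\Gamma^+$ finite or countable without accumulation point. A $k$-isomorphism $\widehat V_\nu\simeq\widehat{\mathrm{Gr}_\nu V_\nu}$ is fixed, as follows. There are a regular local domain $(A,\mathfrak m_A)$, an injective morphism $k[x]\to A$ inducing an isomorphism of fraction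 fields, and a regular system of parameters $z_1,\dots,z_r$ of $A$ such that $\nu(z_1),\dots,\nu(z_r)$ freely generate $\Gamma$, $\widehat V_\nu$ is identified with the completed valuation ring of $\nu|_A$, $\widehat A\simeq L[[z_1,\dots,z_r]]$ with $L=A/\mathfrak m_A$ of transcendence degree $n-r$ over $k$, and $\nu$ extends to $\widehat A$ as the monomial valuation giving $z_j$ the weight $\nu(z_j)$. Then elements of $\widehat V_\nu$ are uniquely $\sum_{i\in\Lambda}w_i$ with $w_i\in G_i:=L\cdot z^{\beta(i)}$, where $\beta(i)\in\mathbb{Z}^r$ is defined by $\sum_j\beta(i)_j\nu(z_j)=i$, and $G_i$ is identified with $\mathfrak p_i/\mathfrak p_i^+$. (When $\nu=\nu_\alpha$ is the monomial valuation $\nu_\alpha(x_j)=\alpha_j>0$ on $k[[x]]$, one takes instead $G_i$ = the set of $0$ and all fractions $a/b$ of nonzero polynomials of $k[x]$ that are weighted homogeneous for the weights $\alpha_j$, with $\nu_\alpha(a)-\nu_\alpha(b)=i$.) The $\nu$-support of $\sum_i w_i$ is $\{i: w_i\ne0\}$. $V_\nu^{\mathrm{fg}}$ is the set (a valuation ring) of elements of $\widehat V_\nu$ whose $\nu$-support is contained in a finitely generated sub-semigroup of $\mathbb{R}_{\ge0}$. Homogeneous elements. Fix an algebraic closure $\Omega$ of $\widehat K_\nu$, with the unique extension of $\nu$. A homogeneous element of order $d\ge 0$ with respect to $\nu$ is $\gamma\in\Omega$ whose minimal polynomial is irreducible in $\widehat V_\nu[Z]$ and of the form $Z^q+g_1Z^{q-1}+\cdots+g_q$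 with $g_k\in G_{dk}$ for all $k$ ($g_k=0$ if $dk\notin\Gamma$). It is integral if each $g_k$ corresponds to the class in $\mathfrak p_{dk}/\mathfrak p_{dk}^+$ of an element of $k[[x]]\cap\mathfrak p_{dk}$. For $B=\widehat V_\nu$ or $V_\nu^{\mathrm{fg}}$ and homogeneous elements $\gamma_1,\dots,\gamma_s$, $B[\langle\gamma_1,\dots,\gamma_s\rangle]$ denotes the valuation ring associated to $B[\gamma_1,\dots,\gamma_s]$, i.e. the set of elements of $\mathrm{Frac}(B)[\gamma_1,\dots,\gamma_s]$ of nonnegative valuation; equivalently the finite sums of terms $b\gamma_1^{j_1}\cdots\gamma_s^{j_s}$ with $b\in\mathrm{Frac}(B)$ and $\nu(b)\ge-(j_1\nu(\gamma_1)+\cdots+j_s\nu(\gamma_s))$. *)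

(* Defs.v *)
From HB Require Import structures.
From mathcomp Require Import all_boot all_order all_algebra.
From mathcomp Require Import mpoly.
From mathcomp Require Import boolp classical_sets functions cardinality fsbigop
  reals constructive_ereal.

Set Implicit Arguments.
Unset Strict Implicit.
Unset Printing Implicit Defensive.

Import Order.TTheory GRing.Theory Num.Theory.
Local Open Scope classical_set_scope.
Local Open Scope ring_scope.
Local Open Scope quotient_scope.

Local Notation "x %:F" := (@FracField.tofrac _ x) : ring_scope.

Reserved Notation "{ 'mps' T [ n ] }"
  (at level 0, T, n at level 2, format "{ 'mps'  T [ n ] }").

Record mps (n : nat) (K : fieldType) := Mps { mps_coef : 'X_{1..n} -> K }.

Notation "{ 'mps' T [ n ] }" := (mps n T) : type_scope.

Section PowerSeries.
Variables (n : nat) (K : fieldType).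
Implicit Types (f g h : {mps K[n]}) (p q : {mpoly K[n]}) (m : 'X_{1..n}).

HB.instance Definition _ := gen_eqMixin {mps K[n]}.
HB.instance Definition _ := gen_choiceMixin {mps K[n]}.

Lemma mpsP f g : mps_coef f =1 mps_coef g -> f = g.
Proof. by case: f g => [f] [g] /= /funext ->. Qed.

Definition mps0 : {mps K[n]} := Mps (fun=> 0).
Definition mps_opp f : {mps K[n]} := Mps (fun m => - mps_coef f m).
Definition mps_add f g : {mps K[n]} :=
  Mps (fun m => mps_coef f m + mps_coef g m).
Definition mps_of_mpoly p : {mps K[n]} := Mps (fun m => p@_m).
Definition mps1 : {mps K[n]} := mps_of_mpoly 1.
(* The degree bounds only make the sum finite: they follow from
   m = k.1 + k.2. *)
Definition mps_mul f g : {mps K[n]} := Mps (fun m =>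
  \sum_(k : 'X_{1..n < (mdeg m).+1, (mdeg m).+1} | m == (k.1 + k.2)%MM)
    mps_coef f k.1 * mps_coef g k.2).

Fact mps_addA : associative mps_add.
Proof. by move=> f g h; apply/mpsP => m /=; rewrite addrA. Qed.
Fact mps_addC : commutative mps_add.
Proof. by move=> f g; apply/mpsP => m /=; rewrite addrC. Qed.
Fact mps_add0 : left_id mps0 mps_add.
Proof. by move=> f; apply/mpsP => m /=; rewrite add0r. Qed.
Fact mps_addN : left_inverse mps0 mps_opp mps_add.
Proof. by move=> f; apply/mpsP => m /=; rewrite addNr. Qed.

HB.instance Definition _ :=
  GRing.isZmodule.Build {mps K[n]} mps_addA mps_addC mps_add0 mps_addN.

Definition mps_trunc b f : {mpoly K[n]} :=
  \sum_(m : 'X_{1..n < b}) mps_coef f m *: 'X_[m].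

Lemma mps_truncE b f m : (mdeg m < b)%N -> (mps_trunc b f)@_m = mps_coef f m.
Proof. by move=> lt_mb; rewrite /mps_trunc (mcoeff_mpoly (mps_coef f)). Qed.

Lemma mps_mulE f g p q m :
  (forall m', (mdeg m' <= mdeg m)%N -> p@_m' = mps_coef f m') ->
  (forall m', (mdeg m' <= mdeg m)%N -> q@_m' = mps_coef g m') ->
  mps_coef (mps_mul f g) m = (p * q)@_m.
Proof.
move=> fp gq; rewrite mcoeffM /=; apply: eq_bigr => k _.
by rewrite fp ?gq // -ltnS bmdeg.
Qed.

Fact mps_mulA : associative mps_mul.
Proof.
move=> f g h; apply/mpsP => m.
pose t := mps_trunc (mdeg m).+1.
have tE u m' : (mdeg m' <= mdeg m)%N -> (t u)@_m' = mps_coef u m'.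
  by move=> le; rewrite mps_truncE.
have tM u v m' : (mdeg m' <= mdeg m)%N ->
    (t u * t v)@_m' = mps_coef (mps_mul u v) m'.
  by move=> le; rewrite (@mps_mulE u v (t u) (t v)) // => m'' le';
    rewrite tE // (leq_trans le').
rewrite (@mps_mulE f (mps_mul g h) (t f) (t g * t h));
  [|exact: tE|exact: tM].
rewrite (@mps_mulE (mps_mul f g) h (t f * t g) (t h));
  [|exact: tM|exact: tE].
by rewrite mulrA.
Qed.

Fact mps_mulC : commutative mps_mul.
Proof.
move=> f g; apply/mpsP => m; pose t := mps_trunc (mdeg m).+1.
have tE u m' : (mdeg m' <= mdeg m)%N -> (t u)@_m' = mps_coef u m'.
  by move=> le; rewrite mps_truncE.
rewrite (@mps_mulE f g (t f) (t g)); try exact: tE.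
by rewrite (@mps_mulE g f (t g) (t f)) 1?mulrC //; exact: tE.
Qed.

Fact mps_mul1 : left_id mps1 mps_mul.
Proof.
move=> f; apply/mpsP => m; pose t := mps_trunc (mdeg m).+1.
have tE u m' : (mdeg m' <= mdeg m)%N -> (t u)@_m' = mps_coef u m'.
  by move=> le; rewrite mps_truncE.
by rewrite (@mps_mulE mps1 f 1 (t f)) ?mul1r ?tE // => m' le; rewrite ?tE.
Qed.

Fact mps_mulDl : left_distributive mps_mul mps_add.
Proof.
move=> f g h; apply/mpsP => m /=.
by rewrite -big_split /=; apply: eq_bigr => k _; rewrite mulrDl.
Qed.

Fact mps_nonzero1 : mps1 != 0 :> {mps K[n]}.
Proof.
apply/eqP => /(congr1 (fun f => mps_coef f 0%MM)) /= /eqP.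
by rewrite mcoeff1 eqxx oner_eq0.
Qed.

HB.instance Definition _ := GRing.Zmodule_isComNzRing.Build {mps K[n]}
  mps_mulA mps_mulC mps_mul1 mps_mulDl mps_nonzero1.

Lemma mps_coefM f g m : mps_coef (f * g) m =
  \sum_(k : 'X_{1..n < (mdeg m).+1, (mdeg m).+1} | m == (k.1 + k.2)%MM)
    mps_coef f k.1 * mps_coef g k.2.
Proof. by []. Qed.

Fact mps_of_mpoly_zmod_morphism : zmod_morphism mps_of_mpoly.
Proof. by move=> p q; apply/mpsP => m /=; rewrite mcoeffB. Qed.
HB.instance Definition _ := GRing.isZmodMorphism.Build
  {mpoly K[n]} {mps K[n]} mps_of_mpoly mps_of_mpoly_zmod_morphism.

Fact mps_of_mpoly_monoid_morphism : monoid_morphism mps_of_mpoly.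
Proof.
by split=> // p q; apply/mpsP => m; rewrite (@mps_mulE _ _ p q).
Qed.
HB.instance Definition _ := GRing.isMonoidMorphism.Build
  {mpoly K[n]} {mps K[n]} mps_of_mpoly mps_of_mpoly_monoid_morphism.

Definition mps_unit : pred {mps K[n]} := fun f => `[< exists g, g * f = 1 >].
Definition mps_inv f : {mps K[n]} :=
  if pselect (exists g, g * f = 1) is left fP then sval (cid fP) else f.

Fact mps_mulV : {in mps_unit, left_inverse 1 mps_inv *%R}.
Proof.
move=> f fP; have {}fP : exists g, g * f = 1 by apply/asboolP.
by rewrite /mps_inv; case: pselect => [gP|//]; case: (cid gP).
Qed.
Fact mps_unitP f g : g * f = 1 -> mps_unit f.
Proof. by move=> gf; apply/asboolP; exists g. Qed.
Fact mps_inv_out : {in [predC mps_unit], mps_inv =1 id}.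
Proof.
move=> f /negP fN; rewrite /mps_inv; case: pselect => [fP|//].
by case: fN; apply/asboolP.
Qed.

HB.instance Definition _ := GRing.ComNzRing_hasMulInverse.Build {mps K[n]}
  mps_mulV mps_unitP mps_inv_out.

Lemma mps_lead f : f != 0 -> exists2 m, mps_coef f m != 0 &
  forall m', (m' < m)%O -> mps_coef f m' = 0.
Proof.
move=> nz_f; have [m]: exists m, mps_coef f m != 0.
  apply: contrapT => nf; case/eqP: nz_f; apply/mpsP => m /=.
  by apply/eqP; apply: contra_notT nf => fm; exists m.
move: m; apply: (@ltmwf n) => m ih fm.
have [[m' [lt fm']]|nm'] := pselect (exists m', (m' < m)%O /\
  mps_coef f m' != 0); first exact: ih fm'.
exists m => // m' lt; apply/eqP; apply: contra_notT nm' => fm'.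
by exists m'.
Qed.

Fact mps_integral f g : f * g = 0 -> (f == 0) || (g == 0).
Proof.
move=> fg0; apply: contraT; rewrite negb_or => /andP[].
move=> /mps_lead[a fa lta] /mps_lead[b gb ltb].
have /eqP : mps_coef (f * g) (a + b)%MM = 0 by rewrite fg0.
rewrite mps_coefM.
have la : (mdeg a < (mdeg (a + b)%MM).+1)%N by rewrite mdegD ltnS leq_addr.
have lb : (mdeg b < (mdeg (a + b)%MM).+1)%N by rewrite mdegD ltnS leq_addl.
rewrite (bigD1 (BMultinom la, BMultinom lb)) //= big1 ?addr0 ?mulf_eq0.
  by rewrite (negbTE fa) (negbTE gb).
move=> [[u lu] [v lv]] /= /andP[/eqP e ne].
case: (ltgtP u a) => [/lta ->|lt_au|eu]; rewrite ?mul0r //.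
- rewrite [X in _ * X]ltb ?mulr0 //.
  rewrite ltNge; apply/negP => le.
  by have := ltmc_le_add lt_au le; rewrite e ltxx.
- subst u; case/eqP: ne; congr pair; apply: val_inj => //=.
  by move/eqP: e; rewrite eqm_add2l => /eqP.
Qed.

HB.instance Definition _ :=
  GRing.ComUnitRing_isIntegral.Build {mps K[n]} mps_integral.
End PowerSeries.

Record valuation (R : realType) (D : idomainType) := Valuation {
  vfun :> D -> \bar R;
  vfun0 : vfun 0 = +oo%E;
  vfun_fin : forall x, x != 0 -> vfun x \is a fin_num;
  vfunM : forall x y, vfun (x * y) = (vfun x + vfun y)%E;
  vfunD : forall x y, (Order.min (vfun x) (vfun y) <= vfun (x + y)%R)%E }.

Section ValuationTheory.
Variables (R : realType) (D : idomainType) (v : valuation R D).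

Lemma vfun1 : v 1 = 0%E.
Proof.
have := vfunM v 1 1; rewrite mulr1 => e.
have /fineK fe : v 1 \is a fin_num by apply: vfun_fin; exact: oner_neq0.
by move: e; rewrite -fe -EFinD => -[] /eqP; rewrite -subr_eq0 opprD addNKr
  oppr_eq0 => /eqP ->.
Qed.

Lemma vfunN1 : v (-1) = 0%E.
Proof.
have := vfunM v (-1) (-1); rewrite mulrNN mulr1 vfun1.
have /fineK fe : v (-1) \is a fin_num.
  by apply: vfun_fin; rewrite oppr_eq0 oner_neq0.
rewrite -fe -EFinD => -[] /esym /eqP.
by rewrite -mulr2n mulrn_eq0 /= => /eqP ->.
Qed.

Lemma vfunN x : v (- x) = v x.
Proof. by rewrite -mulN1r vfunM vfunN1 add0e. Qed.

(* The value of a / b is v a - v b, for any representative a / b. *)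
Definition frac_val_fun (x : {fraction D}) : \bar R :=
  (v \n_(repr x) - v \d_(repr x))%E.

Lemma frac_repr (x : {fraction D}) : x = (\n_(repr x))%:F / (\d_(repr x))%:F.
Proof.
rewrite -{1}[x]reprK; move: (repr x) => {x} y.
have nz_d : \d_y != 0 := denom_ratioP y.
have fE a : a%:F = \pi_({fraction D}) (Ratio a 1).
  by unlock FracField.tofrac.
have -> : (\d_y)%:F^-1 = \pi_({fraction D}) (Ratio 1 \d_y).
  by rewrite fE -[LHS]FracField.pi_inv /FracField.invf !numden_Ratio ?oner_eq0.
rewrite fE -[RHS]FracField.pi_mul /FracField.mulf.
by rewrite !numden_Ratio ?oner_eq0 // mulr1 mul1r Ratio_numden.
Qed.

Lemma frac_val_div a b : b != 0 ->
  frac_val_fun (a%:F / b%:F) = (v a - v b)%E.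
Proof.
move=> nz_b; rewrite /frac_val_fun.
set x := a%:F / b%:F; have nz_d : \d_(repr x) != 0 := denom_ratioP _.
have : a * \d_(repr x) = \n_(repr x) * b.
  apply/eqP; rewrite -tofrac_eq !tofracM.
  have := frac_repr x; rewrite {1}/x => /eqP.
  by rewrite eqr_div ?tofrac_eq0 // => /eqP ->.
move/(congr1 v); rewrite !vfunM.
move: (vfun_fin v nz_b) (vfun_fin v nz_d).
case: (v b) => // vb _; case: (v (\d_ _)) => // vd _.
have [->|nz_a] := eqVneq a 0.
  rewrite vfun0; have [->|/(vfun_fin v)] := eqVneq \n_(repr x) 0.
    by rewrite vfun0.
  by case: (v \n_ _) => // vn _.
move: (vfun_fin v nz_a); case: (v a) => // va _.
case: (v \n_ _) => // vn [] e; congr (_%:E).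
by apply/eqP; rewrite subr_eq addrAC e addrK.
Qed.

Fact frac_val0 : frac_val_fun 0 = +oo%E.
Proof.
have -> : 0 = 0%:F / 1%:F :> {fraction D} by rewrite tofrac0 mul0r.
by rewrite frac_val_div ?oner_neq0 // vfun0 vfun1.
Qed.

Lemma fracP (x : {fraction D}) :
  exists a b, b != 0 /\ x = a%:F / b%:F.
Proof.
by exists \n_(repr x), \d_(repr x); split; [exact: denom_ratioP|exact: frac_repr].
Qed.

Fact frac_val_fin x : x != 0 -> frac_val_fun x \is a fin_num.
Proof.
have [a [b [nz_b ->]]] := fracP x => nz_x; rewrite frac_val_div //.
rewrite fin_numB !vfun_fin //.
by apply: contraNneq nz_x => ->; rewrite tofrac0 mul0r.
Qed.

Fact frac_valM x y :
  frac_val_fun (x * y) = (frac_val_fun x + frac_val_fun y)%E.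
Proof.
have [[a [b [nz_b ->]]] [c [d [nz_d ->]]]] := (fracP x, fracP y).
rewrite mulf_div -!tofracM !frac_val_div ?mulf_neq0 // !vfunM.
move: (vfun_fin v nz_b) (vfun_fin v nz_d).
case: (v b) => // vb _; case: (v d) => // vd _.
have [->|/(vfun_fin v)] := eqVneq a 0.
  rewrite vfun0; have [->|/(vfun_fin v)] := eqVneq c 0.
    by rewrite vfun0.
  by case: (v c).
case: (v a) => // va _; have [->|/(vfun_fin v)] := eqVneq c 0.
  by rewrite vfun0.
by case: (v c) => // vc _; congr (_%:E); rewrite opprD addrACA.
Qed.

Fact frac_valD x y :
  (Order.min (frac_val_fun x) (frac_val_fun y) <= frac_val_fun (x + y)%R)%E.
Proof.
have [[a [b [nz_b ->]]] [c [d [nz_d ->]]]] := (fracP x, fracP y).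
rewrite addf_div ?tofrac_eq0 // -!tofracM -tofracD.
rewrite !frac_val_div ?mulf_neq0 // vfunM.
have := vfunD v (a * d) (c * b); rewrite !vfunM.
move: (vfun_fin v nz_b) (vfun_fin v nz_d).
case: (v b) => // vb _; case: (v d) => // vd _ h.
rewrite leeBrDr //; apply: le_trans h.
have aE : (v a - vb%:E + (vb%:E + vd%:E) = v a + vd%:E)%E.
  by rewrite addeA subeK.
have cE : (v c - vd%:E + (vb%:E + vd%:E) = v c + vb%:E)%E.
  by rewrite [(vb%:E + _)%E]addeC addeA subeK.
by rewrite le_min -{1}aE -cE !leeD2rE // !ge_min !lexx orbT.
Qed.

Definition frac_val : valuation R {fraction D} :=
  Valuation frac_val0 frac_val_fin frac_valM frac_valD.

End ValuationTheory.

Section Comap.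
Variables (R : realType) (F F' : fieldType) (i : {rmorphism F -> F'}).
Variable v : valuation R F'.

Definition comap_fun (x : F) : \bar R := v (i x).

Fact comap0 : comap_fun 0 = +oo%E.
Proof. by rewrite /comap_fun rmorph0 vfun0. Qed.
Fact comap_fin x : x != 0 -> comap_fun x \is a fin_num.
Proof. by move=> nz_x; rewrite vfun_fin ?fmorph_eq0. Qed.
Fact comapM x y : comap_fun (x * y) = (comap_fun x + comap_fun y)%E.
Proof. by rewrite /comap_fun rmorphM vfunM. Qed.
Fact comapD x y :
  (Order.min (comap_fun x) (comap_fun y) <= comap_fun (x + y)%R)%E.
Proof. by rewrite /comap_fun rmorphD vfunD. Qed.

Definition comap : valuation R F := Valuation comap0 comap_fin comapM comapD.

End Comap.

Definition value_group (R : realType) (F : fieldType) (v : valuation R F) :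
  set R := [set g | exists2 x, x != 0 & v x = g%:E].

(* A (x) Q, for a subgroup A of the reals, seen inside the reals: since A is
   torsion-free, A (x) Q -> R is injective with image the divisible hull. *)
Definition tensorQ (R : realType) (A : set R) : set R :=
  [set x | exists2 m, (0 < m)%N & A (x *+ m)].

Definition dimQ (R : realType) (U : set R) (N : nat) : Prop :=
  exists b : 'I_N -> R, (forall j, U (b j)) /\
    forall x, U x -> exists! q : {ffun 'I_N -> rat}, x = \sum_j ratr (q j) * b j.

Definition vball (R : realType) (F : fieldType) (v : valuation R F) (l : R) :
  set F := [set x | (l%:E <= v x)%E].

Section ResidueField.
Variables (R : realType) (F : fieldType) (v : valuation R F).

Definition vring_pred : {pred F} := fun x => (0 <= v x)%E.

Fact vring_closed : subring_closed vring_pred.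
Proof.
split; first by rewrite unfold_in /= vfun1.
  move=> x y; rewrite !unfold_in => vx vy; apply: le_trans (vfunD v x (- y)).
  by rewrite vfunN le_min vx vy.
by move=> x y; rewrite !unfold_in vfunM => vx vy; rewrite adde_ge0.
Qed.
HB.instance Definition _ := GRing.isSubringClosed.Build F vring_pred
  vring_closed.

Record vring := VRing { vring_val : F; _ : vring_val \in vring_pred }.
HB.instance Definition _ := [isSub for vring_val].
HB.instance Definition _ := [Choice of vring by <:].
HB.instance Definition _ := [SubChoice_isSubComNzRing of vring by <:].

Definition vmax : {pred vring} := fun x => (0 < v (\val x))%E.

Fact vmax_ideal : idealr_closed vmax.
Proof.
split; first by rewrite unfold_in /= vfun0 ltry.
  by rewrite unfold_in /= vfun1 ltxx.
move=> a x y; rewrite !unfold_in /= => vx vy.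
apply: lt_le_trans (vfunD v _ _); rewrite lt_min vy andbT vfunM.
have va : (0 <= v (val a))%E := valP a.
by apply: (lt_le_trans vx); rewrite leeDr.
Qed.
HB.instance Definition _ := isIdealr.Build vring vmax vmax_ideal.

Definition residue_field : comNzRingType := {ideal_quot vmax}.

(* The residue class of x when v x >= 0 (and 0 otherwise). *)
Definition residue (x : F) : residue_field :=
  \pi_({ideal_quot vmax}) (insubd (0 : vring) x).

End ResidueField.

(* Transcendence degree of E over k, the largest number of algebraically
   independent elements, for a ring E made a k-algebra by f. *)
Definition alg_indep (k E : nzRingType) (f : k -> E) (d : nat)
  (t : 'I_d -> E) : Prop := forall p : {mpoly k[d]}, mmap f t p = 0 -> p = 0.

Definition trdeg (k E : nzRingType) (f : k -> E) (d : nat) : Prop :=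
  (exists t : 'I_d -> E, alg_indep f t) /\
  (forall t : 'I_d.+1 -> E, ~ alg_indep f t).

Section LocalRings.
Variable A : idomainType.
Implicit Types I : set A.

Definition ideal I : Prop :=
  [/\ I 0, forall a b, I a -> I b -> I (a + b) & forall c a, I a -> I (c * a)].

Definition span_ideal m (g : 'I_m -> A) : set A :=
  [set a | exists c : 'I_m -> A, a = \sum_i c i * g i].

Definition ideal_pow I (s : nat) : set A :=
  [set a | exists m (c : 'I_m -> A) (u : 'I_m -> 'I_s -> A),
    (forall i j, I (u i j)) /\ a = \sum_i c i * \prod_j u i j].

Definition prime_ideal (P : set A) : Prop :=
  [/\ ideal P, ~ P 1 & forall a b, P (a * b) -> P a \/ P b].

Definition noetherian : Prop :=
  forall I, ideal I -> exists m (g : 'I_m -> A), I = span_ideal g.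

Definition prime_chain (d : nat) (P : nat -> set A) : Prop :=
  (forall i, (i <= d)%N -> prime_ideal (P i)) /\
  (forall i, (i < d)%N -> P i `<` P i.+1).

Definition krull_dim (d : nat) : Prop :=
  (exists P, prime_chain d P) /\ (forall P, ~ prime_chain d.+1 P).

Definition max_ideal : set A := [set a | a \isn't a GRing.unit].

Definition local : Prop := ideal max_ideal.

Definition regular_params r (z : 'I_r -> A) : Prop :=
  krull_dim r /\ max_ideal = span_ideal z.

Definition regular_local : Prop :=
  [/\ noetherian, local & exists r (z : 'I_r -> A), regular_params z].

End LocalRings.
Arguments max_ideal A : clear implicits.

(* c exhibits B as the completion of the local ring A for its max_ideal A-adic
   topology, the topology of B being given by the powers of max_ideal B. *)
Definition local_completion (A B : idomainType) (c : {rmorphism A -> B}) :=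
  [/\ forall s a, ideal_pow (max_ideal A) s a <->
        ideal_pow (max_ideal B) s (c a),
      forall s b, exists a, ideal_pow (max_ideal B) s (b - c a),
      forall b, (forall s, ideal_pow (max_ideal B) s b) -> b = 0 &
      forall u : nat -> B,
        (forall s, exists N, forall p q, (N <= p)%N -> (N <= q)%N ->
          ideal_pow (max_ideal B) s (u p - u q)) ->
        exists b, forall s, exists N, forall p, (N <= p)%N ->
          ideal_pow (max_ideal B) s (b - u p)].

(* Completion of a valued field; the first axiom makes i a topological
   embedding, and the last two make the valuation ring of Fh the completion
   of the one of F for the topology given by the ideals {v >= l}. *)
Record vcompletion (R : realType) (F Fh : fieldType) (v : valuation R F)
    (vh : valuation R Fh) (i : {rmorphism F -> Fh}) : Prop := VCompletion {
  vcompl_ext : forall x, vh (i x) = v x;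
  vcompl_dense : forall y (l : R), vball vh 0 y ->
    exists2 x, vball v 0 x & vball vh l (y - i x);
  vcompl_complete : forall u : nat -> Fh, (forall p, vball vh 0 (u p)) ->
    (forall l : R, exists N, forall p q, (N <= p)%N -> (N <= q)%N ->
      vball vh l (u p - u q)) ->
    exists2 y, vball vh 0 y & forall l : R, exists N, forall p, (N <= p)%N ->
      vball vh l (y - u p) }.

(* nu is given on A = k[[x]], with nonnegative values, positive exactly on the
   maximal ideal; it extends to Frac A as frac_val nu. *)

Definition centered (R : realType) (A : idomainType) (nu : valuation R A) :=
  (forall f, (0 <= nu f)%E) /\ (forall f, (0 < nu f)%E <-> max_ideal A f).

Definition abhyankar (R : realType) (k : fieldType) (n : nat)
    (nu : valuation R {mps k[n]}) : Prop :=
  exists t N, [/\ trdeg (fun c : k =>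
      residue (frac_val nu) (mps_of_mpoly (c%:MP : {mpoly k[n]}))%:F) t,
    dimQ (tensorQ (value_group (frac_val nu))) N & (t + N)%N = n].

Section Monomial.
Variables (R : realType) (L : fieldType) (r : nat) (w : 'I_r -> R).

Definition weight (m : 'X_{1..r}) : R := \sum_j w j *+ m j.

(* e is the value at f of the monomial valuation of weights w. *)
Definition monomial_value (f : {mps L[r]}) (e : \bar R) : Prop :=
  (f = 0 /\ e = +oo%E) \/
  exists m, [/\ mps_coef f m != 0, e = (weight m)%:E &
    forall m', mps_coef f m' != 0 -> weight m <= weight m'].

Definition monomial_valuation (nu : valuation R {mps L[r]}) : Prop :=
  (forall j, 0 < w j) /\ (forall f, monomial_value f (nu f)).

Definition weighted_homogeneous (s : R) (a : {mpoly L[r]}) : Prop :=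
  forall m, m \in msupp a -> weight m = s.

End Monomial.

Section GradedPieces.
Variables (R : realType) (k : fieldType) (n : nat).
Variables (nu : valuation R {mps k[n]}) (Kh : fieldType).
Variables (vh : valuation R Kh) (iK : {rmorphism {fraction {mps k[n]}} -> Kh}).

(* The data (A, z, L) fixing the identification of the completed valuation
   ring with the completed graded ring. *)
Record uniformization := Uniformization {
  un_A : idomainType;
  un_r : nat;
  un_z : 'I_un_r -> un_A;
  un_regular : regular_local un_A;
  un_params : regular_params un_z;
  un_phi : {rmorphism {mpoly k[n]} -> un_A};
  un_phi_inj : injective un_phi;
  un_phi_frac : exists2 psi : {rmorphism {fraction {mpoly k[n]}} ->
      {fraction un_A}}, bijective psi & forall p, psi p%:F = (un_phi p)%:F;
  (* Frac A = k(x) as a subfield of K_n, whence the restriction of nu to A *)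
  un_incl : {rmorphism {fraction un_A} -> {fraction {mps k[n]}}};
  un_inclE : forall p, un_incl (un_phi p)%:F = (mps_of_mpoly p)%:F;
  un_compl : vcompletion (comap un_incl (frac_val nu)) vh (iK \o un_incl);
  un_w : 'I_un_r -> R;
  un_wE : forall j, frac_val nu (un_incl (un_z j)%:F) = (un_w j)%:E;
  un_w_gt0 : forall j, 0 < un_w j;
  un_w_free : forall g, value_group (frac_val nu) g ->
    exists! b : {ffun 'I_un_r -> int}, g = \sum_j un_w j *~ b j;
  un_L : fieldType;
  un_res : {rmorphism un_A -> un_L};
  un_res_surj : forall l, exists a, un_res a = l;
  un_res_ker : forall a, un_res a = 0 <-> max_ideal un_A a;
  un_trdeg : exists2 t, trdeg (fun c : k => un_res (un_phi c%:MP)) t &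
    (t + un_r)%N = n;
  (* the k-isomorphism of the completion of A with L[[z]] *)
  un_c : {rmorphism un_A -> {mps un_L[un_r]}};
  un_c_compl : local_completion un_c;
  un_c_z : forall j, un_c (un_z j) = mps_of_mpoly 'X_j;
  un_c_res : forall a, mps_coef (un_c a) 0%MM = un_res a;
  un_c_k : forall c : k,
    un_c (un_phi c%:MP) = mps_of_mpoly (un_res (un_phi c%:MP))%:MP;
  (* the extension of nu to L[[z]] is monomial, with values read in Kh *)
  un_e : {rmorphism {mps un_L[un_r]} -> Kh};
  un_eE : forall a, un_e (un_c a) = iK (un_incl a%:F);
  un_e_mono : forall s, monomial_value un_w s (vh (un_e s)) }.

(* The piece L z^beta(i); it is 0 when i is not in the value group. *)
Definition uniform_piece (U : uniformization) (i : R) : set Kh :=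
  [set y | y = 0 \/ exists (l : un_L U) (b : 'I_(un_r U) -> int),
    \sum_j @un_w U j *~ b j = i /\
    y = un_e U (mps_of_mpoly l%:MP) *
        \prod_j iK (un_incl U (@un_z U j)%:F) ^ b j].

Definition monomial_piece (alpha : 'I_n -> R) (i : R) : set Kh :=
  [set y | y = 0 \/ exists (a b : {mpoly k[n]}) (s t : R),
    [/\ a != 0 /\ b != 0, weighted_homogeneous alpha s a,
        weighted_homogeneous alpha t b, s - t = i &
        y = iK ((mps_of_mpoly a)%:F / (mps_of_mpoly b)%:F)]].

(* G i is the subgroup of Kh identified with the i-th graded piece.
   The identification through weighted homogeneous fractions is the one used
   when nu is monomial, the other one is used otherwise. *)
Definition grading (G : R -> set Kh) : Prop :=
  (exists2 alpha, monomial_valuation alpha nu & G = monomial_piece alpha) \/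
  (~ (exists alpha, monomial_valuation alpha nu) /\
   exists U : uniformization, G = uniform_piece U).

Variable G : R -> set Kh.

(* y = \sum_i w_i with w_i in G_i, the support of w being a set of
   nonnegative reals without accumulation point. *)
Definition expansion (w : R -> Kh) (y : Kh) : Prop :=
  [/\ forall i, G i (w i),
      forall i, w i != 0 -> 0 <= i,
      forall l : R, finite_set [set i | w i != 0 /\ i <= l] &
      forall l : R, (l%:E < vh (y - \sum_(i \in [set i | i <= l]) w i)%R)%E].

(* The semigroup generated by g together with 0; as 0 may be added to the
   generators, this does not affect Vfg. *)
Definition semigroup_span m (g : 'I_m -> R) : set R :=
  [set x | exists c : 'I_m -> nat, x = \sum_j g j *+ c j].

Definition Vhat : set Kh := vball vh 0.

(* Expansions being unique, the set of i with w i != 0 is the support of y. *)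
Definition Vfg : set Kh := [set y | Vhat y /\ exists2 w, expansion w y &
  exists m (g : 'I_m -> R), (forall j, 0 <= g j) /\
    [set i | w i != 0] `<=` semigroup_span g].

Variables (Omega : fieldType) (iO : {rmorphism Kh -> Omega}).
Variable vO : valuation R Omega.

Definition is_minpoly (p : {poly Kh}) (gamma : Omega) : Prop :=
  p \is monic /\ forall q : {poly Kh}, root (map_poly iO q) gamma = (p %| q).

Definition unit_in (T : comNzRingType) (S : set T) (a : T) : Prop :=
  S a /\ exists2 b, S b & a * b = 1.

Definition irreducible_in (T : comNzRingType) (S : set T) (p : T) : Prop :=
  [/\ S p, p != 0, ~ unit_in S p &
    forall a b, S a -> S b -> p = a * b -> unit_in S a \/ unit_in S b].

Definition Vhat_poly : set {poly Kh} := [set p | forall j, Vhat p`_j].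

(* p = Z^q + g_1 Z^(q-1) + ... + g_q, with g_j = p`_(q - j). *)
Definition homogeneous_poly (d : R) (p : {poly Kh}) (gamma : Omega) : Prop :=
  [/\ 0 <= d, is_minpoly p gamma, irreducible_in Vhat_poly p &
    forall j, (0 < j < size p)%N -> G (d *+ j) p`_((size p).-1 - j)].

Definition homogeneous (gamma : Omega) : Prop :=
  exists d p, homogeneous_poly d p gamma.

Definition integral_homogeneous (gamma : Omega) : Prop :=
  exists d p, homogeneous_poly d p gamma /\
    forall j, (0 < j < size p)%N -> exists2 f : {mps k[n]},
      ((d *+ j)%:E <= nu f)%E &
      ((d *+ j)%:E < vh (p`_((size p).-1 - j) - iK f%:F)%R)%E.

Definition frac_set (B : set Kh) : set Kh :=
  [set x | exists a b, [/\ B a, B b, b != 0 & x = a / b]].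

(* Elements of nonnegative value of Frac(B)[gamma_1, ..., gamma_s]. *)
Definition vadjoin (B : set Kh) s (gamma : 'I_s -> Omega) : set Omega :=
  [set y | (0 <= vO y)%E /\ exists2 p : {mpoly Kh[s]},
    (forall m, frac_set B p@_m) & y = mmap iO gamma p].

End GradedPieces.

(* Main.v *)
Require Import Defs.
From HB Require Import structures.
From mathcomp Require Import all_boot all_order all_algebra.
From mathcomp Require Import mpoly separable perm ring lra.
From mathcomp Require Import boolp classical_sets functions cardinality fsbigop
  reals constructive_ereal.

(** This is a Newton-Puiseux theorem, and its proof is valuation-theoretic. Write
[K] for the complete field, [F] for the field of fractions of [B] inside it, and
[L] for the field [G 0], a copy of the residue field in [K] (see [graded]).

First, [F] is henselian. If [B] is the whole valuation ring this is the
contraction principle ([cr_fixpoint]). For the elements with finitely generated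
support, the elements with support in a given finitely generated semigroup form a
closed subring ([hlim_closed_ring]), which is stable under the contractions that
it defines. Any element of [F] of nonnegative value lies in such a ring, because
dividing by a leading term shifts a finitely generated semigroup to another one
([ssg_shift], [frac_Vfg_ge0]).

Second, conjugates over a henselian field have the same value ([conjugate_val]).
If the conjugates [al i] did not, let [A0] be the set of those of smallest value.
The products of [#|A0|] of them are the inverse roots of a polynomial over [F], by
the theorem of symmetric functions, and the product over [A0] dominates the
others, so that it is in [F] ([dominant_product]). Applying this to the [al i - t]
for [t] in [F] and interpolating, the polynomial with roots the [al i] for [i] in
[A0] is over [F], which contradicts the irreducibility of the minimal polynomial.

Third, as the residue characteristic is 0, an element algebraic over [F] is in the
field spanned over [F] by the monomials [h] such that a power of [h] is the product
of a homogeneous element by an element algebraic over [L] ([rhom],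
[algover_rhom_span]): after subtraction of the mean of the conjugates and division
by a monomial, all conjugates would have the same nonzero residue, hence their sum
would not vanish. The coefficients of [P] are algebraic over [F], and so are its
roots, which thus involve finitely many monomials.

It remains to generate these monomials by [N] of them ([rhom_generators]). If the
[z_j] are homogeneous of degrees a rational basis of the value group, and [u_j] is
an [M]-th root of [z_j] for a suitable [M], the monomials are products of powers of
the [u_j] by elements algebraic over [L]. Some [t] algebraic over [L] generates the
latter already by its [M]-th power ([power_generator]), so that [t * u_0] and the
other [u_j] generate everything. Finally the minimal polynomial over [K] of a
monomial is homogeneous, since its conjugates are its products by elements
algebraic over [L] ([minpoly_homogeneous]), and multiplying the monomial by the
leading form of a common denominator makes it integral ([rhom_integral]). *)

Set Implicit Arguments.
Unset Strict Implicit.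
Unset Printing Implicit Defensive.

Import Order.TTheory GRing.Theory Num.Theory.
Local Open Scope classical_set_scope.
Local Open Scope ring_scope.

Local Notation "x %:F" := (@FracField.tofrac _ x) : ring_scope.

(** * Values in a valued field *)

Section Values.
Variables (R : realType) (F : fieldType) (v : valuation R F).
Implicit Types (x y : F) (a b : R).

Lemma val_ex x : x != 0 -> exists a, v x = a%:E.
Proof. by move=> /(vfun_fin v); case: (v x) => // a _; exists a. Qed.

Lemma val_fin_neq0 x a : v x = a%:E -> x != 0.
Proof. by move=> vx; apply/eqP => x0; rewrite x0 vfun0 in vx. Qed.

Lemma val_ltoo x y : (v x < v y)%E -> x != 0.
Proof. by move=> lt; apply/eqP => x0; move: lt; rewrite x0 vfun0 ltNge leey. Qed.

Lemma valM x y a b : v x = a%:E -> v y = b%:E -> v (x * y) = (a + b)%:E.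
Proof. by rewrite vfunM => -> ->. Qed.

Lemma valV x a : v x = a%:E -> v x^-1 = (- a)%:E.
Proof.
move=> vx; have nz := val_fin_neq0 vx.
have [b vb] : exists b, v x^-1 = b%:E by apply: val_ex; rewrite invr_eq0.
have := vfun1 v; rewrite -(mulfV nz) (valM vx vb) vb => -[] /eqP.
by rewrite addrC addr_eq0 => /eqP ->.
Qed.

Lemma valX x a n : v x = a%:E -> v (x ^+ n) = (a *+ n)%:E.
Proof.
move=> vx; elim: n => [|n ih]; first by rewrite expr0 mulr0n vfun1.
by rewrite exprS mulrS (valM vx ih).
Qed.

Lemma valB x y : v (x - y) = v (y - x).
Proof. by rewrite -opprB vfunN. Qed.

Lemma val_le_add (l : \bar R) x y :
  (l <= v x)%E -> (l <= v y)%E -> (l <= v (x + y)%R)%E.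
Proof. by move=> lx ly; apply: le_trans (vfunD v x y); rewrite le_min lx. Qed.

Lemma val_lt_add (l : \bar R) x y :
  (l < v x)%E -> (l < v y)%E -> (l < v (x + y)%R)%E.
Proof. by move=> lx ly; apply: lt_le_trans (vfunD v x y); rewrite lt_min lx. Qed.

Lemma val_le_sub (l : \bar R) x y :
  (l <= v x)%E -> (l <= v y)%E -> (l <= v (x - y)%R)%E.
Proof. by move=> lx ly; apply: val_le_add; rewrite ?vfunN. Qed.

Lemma val_lt_sub (l : \bar R) x y :
  (l < v x)%E -> (l < v y)%E -> (l < v (x - y)%R)%E.
Proof. by move=> lx ly; apply: val_lt_add; rewrite ?vfunN. Qed.

Lemma val_le_sum (l : \bar R) I (r : seq I) (P : pred I) (f : I -> F) :
  (forall i, P i -> (l <= v (f i))%E) -> (l <= v (\sum_(i <- r | P i) f i)%R)%E.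
Proof.
by move=> h; elim/big_ind: _ => //; [rewrite vfun0 leey | exact: val_le_add].
Qed.

Lemma val_lt_sum a I (r : seq I) (P : pred I) (f : I -> F) :
  (forall i, P i -> (a%:E < v (f i))%E) -> (a%:E < v (\sum_(i <- r | P i) f i)%R)%E.
Proof.
by move=> h; elim/big_ind: _ => //; [rewrite vfun0 ltry | exact: val_lt_add].
Qed.

Lemma val_dom x y : (v x < v y)%E -> v (x + y) = v x.
Proof.
move=> lt; apply/eqP; rewrite eq_le; apply/andP; split; last first.
  by apply: val_le_add => //; exact: ltW.
rewrite leNgt; apply/negP => lt2.
by have := val_lt_sub lt2 lt; rewrite addrK ltxx.
Qed.

Lemma val_close x y : (v x < v (y - x)%R)%E -> v y = v x.
Proof. by move=> lt; rewrite -(val_dom lt) addrC subrK. Qed.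

Lemma val_ge0M x y : (0 <= v x)%E -> (0 <= v y)%E -> (0 <= v (x * y)%R)%E.
Proof. by move=> x0 y0; rewrite vfunM adde_ge0. Qed.

Lemma val_gt0M x y : (0 <= v x)%E -> (0 < v y)%E -> (0 < v (x * y)%R)%E.
Proof.
by move=> x0 y0; rewrite vfunM; apply: (lt_le_trans y0); rewrite leeDr.
Qed.

Lemma val_ge0X x n : (0 <= v x)%E -> (0 <= v (x ^+ n)%R)%E.
Proof.
move=> x0; elim: n => [|n ih]; first by rewrite expr0 vfun1.
by rewrite exprS val_ge0M.
Qed.

Lemma val_prod I (r : seq I) (P : pred I) (f : I -> F) (a : I -> R) :
  (forall i, P i -> v (f i) = (a i)%:E) ->
  v (\prod_(i <- r | P i) f i) = (\sum_(i <- r | P i) a i)%:E.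
Proof.
move=> h; elim: r => [|i r ih]; first by rewrite !big_nil vfun1.
by rewrite !big_cons; case: ifP => // Pi; apply: valM; rewrite ?h.
Qed.

(** If [z] had negative value, its power of highest degree would have a smaller
value than the other terms of the equation. *)
Lemma val_root_ge0 (p : {poly F}) z : p \is monic ->
  (forall i, (0 <= v p`_i)%E) -> root p z -> (0 <= v z)%E.
Proof.
move=> pm p0 /rootP pz; rewrite leNgt; apply/negP => vz.
have nz : z != 0 by apply: (@val_ltoo _ 1); rewrite vfun1.
have [b vb] := val_ex nz; rewrite vb lte_fin in vz.
have [n sp] : exists n, size p = n.+1.
  by exists (size p).-1; rewrite prednK // size_poly_gt0 monic_neq0.
have lc : p`_n = 1 by have := monicP pm; rewrite lead_coefE sp.
move: pz; rewrite horner_coef sp big_ord_recr /= lc mul1r addrC => /eqP.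
rewrite addr_eq0 => /eqP e.
suff : (v (z ^+ n)%R < v (z ^+ n)%R)%E by rewrite ltxx.
rewrite {2}e vfunN (valX n vb); apply: val_lt_sum => i _.
rewrite vfunM (valX i vb); case: n e i {sp lc} => [|n] e [i lti] //.
apply: (@lt_le_trans _ _ (0 + (b *+ i)%:E)%E); last by rewrite leeD2r.
by rewrite add0e lte_fin -(subnK (ltnW lti)) mulrnDr gtrDr pmulrn_llt0 ?subn_gt0.
Qed.

End Values.

(** * Subfields and minimal polynomials *)

Definition subfield (E : fieldType) (S : set E) :=
  [/\ S 1, forall x y, S x -> S y -> S (x - y) &
    forall x y, S x -> S y -> S (x / y)].

Section Subfield.
Variables (E : fieldType) (S : set E) (hS : subfield S).

(** The proof of [subfield S] is an argument so that the instances below can be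
attached to the predicate. *)
Definition sfpred of subfield S : {pred E} := fun x => `[< S x >].

Lemma sfpredP x : x \in sfpred hS <-> S x.
Proof. by split=> /asboolP. Qed.

Fact sfpred_closed : divring_closed (sfpred hS).
Proof.
have [s1 sB sV] := hS; split; first exact/sfpredP.
  by move=> x y /sfpredP sx /sfpredP sy; apply/sfpredP/sB.
by move=> x y /sfpredP sx /sfpredP sy; apply/sfpredP/sV.
Qed.
HB.instance Definition _ := GRing.isDivringClosed.Build E (sfpred hS)
  sfpred_closed.

Record sfield := SField { sfval : E; _ : sfval \in sfpred hS }.
HB.instance Definition _ := [isSub for sfval].
HB.instance Definition _ := [Choice of sfield by <:].
HB.instance Definition _ := [SubChoice_isSubIntegralDomain of sfield by <:].
HB.instance Definition _ := [SubIntegralDomain_isSubField of sfield by <:].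

Definition sfincl : {rmorphism sfield -> E} := val.

Arguments sfincl : simpl never.

Lemma sfinclP x : S (sfincl x).
Proof. by apply/sfpredP; exact: (valP x). Qed.

Lemma sfinclE x : S x -> exists y, sfincl y = x.
Proof. by move=> /sfpredP sx; exists (SField sx). Qed.

Lemma sfpoly (p : {poly E}) : (forall i, S p`_i) ->
  exists q, map_poly sfincl q = p.
Proof.
move=> pS; exists (\poly_(i < size p) projT1 (cid (sfinclE (pS i)))).
apply/polyP => i; rewrite coef_map coef_poly.
case: ltnP => [lt|le]; first by case: cid.
by rewrite nth_default.
Qed.
End Subfield.

(** Coefficients in [S] and polynomials over the type of elements of [S] are
used interchangeably: the former are stable under operations of [E], while the
latter have a Euclidean division. *)
Definition polyS (E : fieldType) (S : set E) (p : {poly E}) :=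
  forall i, S p`_i.

Definition algover (E : fieldType) (S : set E) (x : E) :=
  exists p : {poly E}, [/\ p != 0, polyS S p & root p x].

Section SubfieldTheory.
Variables (E : fieldType) (S : set E) (hS : subfield S).

Lemma sf1 : S 1. Proof. by case: hS. Qed.
Lemma sfB x y : S x -> S y -> S (x - y). Proof. by case: hS => _ h _; exact: h. Qed.
Lemma sfdiv x y : S x -> S y -> S (x / y). Proof. by case: hS => _ _ h; exact: h. Qed.
Lemma sf0 : S 0. Proof. by rewrite -(subrr 1); apply: sfB sf1 sf1. Qed.
Lemma sfN x : S x -> S (- x). Proof. by move=> sx; rewrite -sub0r; apply: sfB sf0 sx. Qed.
Lemma sfD x y : S x -> S y -> S (x + y).
Proof. by move=> sx sy; rewrite -[y]opprK; apply: sfB sx (sfN sy). Qed.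
Lemma sfV x : S x -> S x^-1.
Proof. by move=> sx; rewrite -[x^-1]mul1r; apply: sfdiv sf1 sx. Qed.
Lemma sfM x y : S x -> S y -> S (x * y).
Proof. by move=> sx sy; rewrite -[y]invrK; apply: sfdiv sx (sfV sy). Qed.
Lemma sfX x n : S x -> S (x ^+ n).
Proof.
by move=> sx; elim: n => [|n ih]; [rewrite expr0; exact: sf1|rewrite exprS; exact: sfM].
Qed.
Lemma sf_nat n : S n%:R.
Proof. by elim: n => [|n ih]; [exact: sf0 | rewrite mulrS; apply: sfD sf1 ih]. Qed.
Lemma sf_sum I (r : seq I) (P : pred I) (f : I -> E) :
  (forall i, P i -> S (f i)) -> S (\sum_(i <- r | P i) f i).
Proof. by move=> h; elim/big_ind: _ => //; [exact: sf0 | exact: sfD]. Qed.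
Lemma sf_prod I (r : seq I) (P : pred I) (f : I -> E) :
  (forall i, P i -> S (f i)) -> S (\prod_(i <- r | P i) f i).
Proof. by move=> h; elim/big_ind: _ => //; [exact: sf1 | exact: sfM]. Qed.

Lemma polySP p : polyS S p <-> p \is a polyOver (sfpred hS).
Proof.
split=> [h|/polyOverP h i]; last by apply/(sfpredP hS).
by apply/polyOverP => i; apply/(sfpredP hS).
Qed.

Lemma polyS_map (q : {poly sfield hS}) : polyS S (map_poly (sfincl hS) q).
Proof. by move=> i; rewrite coef_map; exact: sfinclP. Qed.

Lemma polyS_horner p x : polyS S p -> S x -> S p.[x].
Proof.
by move=> hp sx; rewrite horner_coef; apply: sf_sum => i _; exact/sfM/sfX.
Qed.

Lemma algoverP x : algover S x <-> algebraicOver (sfincl hS) x.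
Proof.
split=> [[p [nz_p /(sfpoly hS)[q qE] px]]|[q nz_q qx]].
  by exists q; rewrite ?qE //; apply: contraNneq nz_p => q0; rewrite -qE q0 rmorph0.
by exists (map_poly (sfincl hS) q); split; rewrite ?map_poly_eq0 //; exact: polyS_map.
Qed.

Lemma algover_id x : S x -> algover S x.
Proof. by move=> /(sfinclE hS)[y <-]; apply/algoverP/algebraic_id. Qed.
Lemma algoverB x y : algover S x -> algover S y -> algover S (x - y).
Proof. by rewrite !algoverP; exact: algebraic_sub. Qed.
Lemma algoverD x y : algover S x -> algover S y -> algover S (x + y).
Proof. by rewrite !algoverP; exact: algebraic_add. Qed.
Lemma algoverM x y : algover S x -> algover S y -> algover S (x * y).
Proof. by rewrite !algoverP; exact: algebraic_mul. Qed.
Lemma algoverV x : algover S x -> algover S x^-1.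
Proof. by rewrite !algoverP; exact: algebraic_inv. Qed.
Lemma algover_root (p : {poly E}) x : p != 0 -> (forall i, algover S p`_i) -> root p x ->
  algover S x.
Proof.
move=> nz_p h px; apply/algoverP/integral_algebraic.
apply: (integral_root nz_p px) => y /(nthP 0)[i _ <-].
exact/integral_algebraic/algoverP.
Qed.
Lemma subfield_algover : subfield (algover S).
Proof.
split; first exact/algover_id/sf1.
  exact: algoverB.
by move=> x y hx hy; apply: algoverM hx (algoverV hy).
Qed.
End SubfieldTheory.

Lemma algoverS (E : fieldType) (S T : set E) x :
  S `<=` T -> algover S x -> algover T x.
Proof.
by move=> sub [p [nz h px]]; exists p; split=> // i; apply: sub; exact: h.
Qed.

(** A subring all of whose elements are algebraic over a subfield that it
contains is a field: the inverse of [y] is a polynomial in [y]. *)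
Lemma subfield_alg_ring (E : fieldType) (S T : set E) :
  subfield S -> S `<=` T -> (forall x y, T x -> T y -> T (x - y)) ->
  (forall x y, T x -> T y -> T (x * y)) -> (forall x, T x -> algover S x) ->
  subfield T.
Proof.
move=> hS ST TB TM Talg.
have T1 : T 1 by apply/ST/(sf1 hS).
have T0 : T 0 by rewrite -(subrr 1); apply: TB.
have TX x n : T x -> T (x ^+ n).
  by move=> tx; elim: n => [|n ih]; rewrite ?expr0 ?exprS //; apply: TM.
have TD x y : T x -> T y -> T (x + y).
  by move=> tx ty; rewrite -[y]opprK -(sub0r y); apply/TB/TB.
have TV x : T x -> T x^-1.
  move=> tx; have [->|nz_x] := eqVneq x 0; first by rewrite invr0.
  have [p [nz_p pS px]] := Talg _ tx.
  have [m [q nz_q pE]] := multiplicity_XsubC p 0; rewrite nz_p /= in nz_q.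
  have qS : polyS S q.
    move=> i; have -> : q`_i = p`_(i + m); last exact: pS.
    by rewrite pE polyC0 subr0 coefMXn ltnNge leq_addl /= addnK.
  have qx : root q x.
    move: px; rewrite pE rootM => /orP[//|].
    by rewrite polyC0 subr0 rootE hornerXn expf_eq0 (negbTE nz_x) andbF.
  have q0 : q`_0 != 0 by move: nz_q; rewrite rootE horner_coef0.
  have -> : x^-1 = - (q`_0)^-1 * (\poly_(i < size q) q`_i.+1).[x].
    apply: (mulIf nz_x); rewrite mulVf // -mulrA mulNr.
    move/rootP: qx; rewrite (horner_coef_wide _ (leqnSn _)) big_ord_recl /=.
    rewrite expr0 mulr1 => /eqP; rewrite addrC addr_eq0 => /eqP e.
    rewrite horner_poly mulr_suml.
    rewrite (eq_bigr (fun i : 'I_(size q) => q`_(lift ord0 i) * x ^+ (lift ord0 i))).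
      by rewrite e mulrN opprK mulVf.
    by move=> i _; rewrite /= /bump add1n exprSr mulrA.
  apply: (TM _ _).
    by apply/ST/(sfN hS)/(sfV hS).
  rewrite horner_poly; elim/big_ind: _ => // i _; apply: (TM _ _); last exact: TX.
  exact/ST/qS.
by split=> // x y tx ty; exact: (TM _ _ tx (TV _ ty)).
Qed.

Section MinimalPolynomial.
Variables (E : closedFieldType) (S : set E) (hS : subfield S).

(** The minimal polynomial is handled through its roots [rs], the conjugates of
[x]: it is minimal in degree, hence divides the other equations of [x] by
Euclidean division over [S]. *)
Lemma min_polynomial x : algover S x -> exists rs : seq E,
  [/\ x \in rs, polyS S (\prod_(r <- rs) ('X - r%:P)) &
    forall q, polyS S q -> root q x -> \prod_(r <- rs) ('X - r%:P) %| q].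
Proof.
move=> /(algoverP hS)[p0 nz_p0 p0x].
pose f := sfincl hS.
pose P n := `[< exists p : {poly sfield hS},
  [/\ p != 0, root (map_poly f p) x & size p = n] >].
have exP : exists n, P n by exists (size p0); apply/asboolP; exists p0.
case: (ex_minnP exP) => n /asboolP[p [nz_p px sp]] pmin.
have [rs prs] := closed_field_poly_normal (map_poly f p).
have nz_l : lead_coef (map_poly f p) != 0 by rewrite lead_coef_eq0 map_poly_eq0.
exists rs; split.
- by move: px; rewrite prs rootZ // root_prod_XsubC.
- set pi := \prod_(r <- rs) _ in prs *.
  have -> : pi = map_poly f ((lead_coef p)^-1 *: p).
    have mpi : pi \is monic by exact: monic_prod_XsubC.
    rewrite map_polyZ prs scalerA lead_coef_map fmorphV mulVf ?scale1r //.
    by rewrite -lead_coef_map.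
  exact: polyS_map.
move=> q /(sfpoly hS)[q' <-] qx.
have q'E : map_poly f q' = map_poly f (q' %/ p) * map_poly f p + map_poly f (q' %% p).
  by rewrite -rmorphM -rmorphD -divp_eq.
have modx : root (map_poly f (q' %% p)) x.
  by move: qx; rewrite !rootE q'E hornerD hornerM (rootP px) mulr0 add0r.
have [mod0|nz_mod] := eqVneq (q' %% p) 0.
  rewrite q'E mod0 rmorph0 addr0 prs dvdp_mull //.
  by rewrite -mul_polyC dvdp_mull.
have : (n <= size (q' %% p)%R)%N by apply: pmin; apply/asboolP; exists (q' %% p).
by rewrite leqNgt -sp ltn_modp nz_p.
Qed.

Lemma conjugates x : algover S x -> exists rs : seq E,
  [/\ x \in rs, polyS S (\prod_(r <- rs) ('X - r%:P)) &
    forall q, polyS S q -> root q x -> forall r, r \in rs -> root q r].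
Proof.
move=> /min_polynomial[rs [xrs rsS rsq]]; exists rs; split=> // q Sq qx r rrs.
by case/dvdpP: (rsq _ Sq qx) => q1 ->; rewrite rootM root_prod_XsubC rrs orbT.
Qed.

(** The sum of the conjugates is a coefficient of the minimal polynomial, and their
number is invertible in characteristic zero. *)
Lemma conjugates_mean x rs : [pchar E] =i pred0 ->
  x \in rs -> polyS S (\prod_(r <- rs) ('X - r%:P)) ->
  exists2 t, S t & \sum_(r <- rs) (r - t) = 0.
Proof.
move=> /pcharf0P c0 xrs h; exists ((\sum_(r <- rs) r) / (size rs)%:R).
  apply: (sfdiv hS); last exact: sf_nat.
  rewrite -[X in S X]opprK; apply: (sfN hS).
  have rs0 : size rs != 0 by case: (rs) xrs.
  by rewrite -(coefPn_prod_XsubC rs0).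
have nz : (size rs)%:R != 0 :> E by rewrite c0; case: (rs) xrs.
rewrite sumrB big_const_seq count_predT iter_addr_0.
by rewrite -[(_ / _) *+ _]mulr_natr divfK // subrr.
Qed.

(** An element that is its only conjugate is the mean of its conjugates. *)
Lemma fixed_in x : [pchar E] =i pred0 -> algover S x ->
  (forall y, (forall q, polyS S q -> root q x -> root q y) -> y = x) -> S x.
Proof.
move=> c0 /conjugates[rs [xrs rsS rsq]] hx.
have [t St] := conjugates_mean c0 xrs rsS.
rewrite (eq_big_seq (fun=> x - t)); last first.
  by move=> r rrs; rewrite (hx r) // => q qS qx; exact: rsq rrs.
rewrite big_const_seq count_predT iter_addr_0 -mulr_natr => /eqP.
rewrite mulf_eq0 subr_eq0 => /orP[/eqP->//|].
by move/pcharf0P: c0 => ->; case: (rs) xrs.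
Qed.
End MinimalPolynomial.

(** * Generating a finite extension by the power of an element *)

Definition adjoin (E : fieldType) (S : set E) (y : E) : set E :=
  [set z | exists2 p, polyS S p & z = p.[y]].

Section Adjoin.
Variables (E : fieldType) (S : set E) (hS : subfield S).

Lemma adjoinS y : S `<=` adjoin S y.
Proof.
move=> x Sx; exists x%:P; last by rewrite hornerC.
by apply/(polySP hS); rewrite polyOverC; exact/(sfpredP hS).
Qed.

Lemma adjoin_id y : adjoin S y y.
Proof.
by exists 'X; rewrite ?hornerX //; apply/(polySP hS); exact: polyOverX.
Qed.

Lemma adjoin_algover y z : algover S y -> adjoin S y z -> algover S z.
Proof.
move=> hy [p Sp ->]; apply: (polyS_horner (subfield_algover hS) _ hy) => i.
exact/algover_id.
Qed.

Lemma subfield_adjoin y : algover S y -> subfield (adjoin S y).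
Proof.
move=> hy; apply: (subfield_alg_ring hS); first exact: adjoinS.
- move=> _ _ [p /(polySP hS) Sp ->] [q /(polySP hS) Sq ->].
  by exists (p - q); [apply/(polySP hS); exact: rpredB | rewrite hornerD hornerN].
- move=> _ _ [p /(polySP hS) Sp ->] [q /(polySP hS) Sq ->].
  by exists (p * q); [apply/(polySP hS); exact: rpredM | rewrite hornerM].
- by move=> z; exact: adjoin_algover.
Qed.

Lemma adjoin_sub y z : algover S z -> adjoin S z y -> adjoin S y `<=` adjoin S z.
Proof.
move=> hz zy x [p Sp ->]; apply: (polyS_horner (subfield_adjoin hz) _ zy) => i.
exact/adjoinS.
Qed.

(** The primitive element theorem. *)
Lemma primitive (xs : seq E) : [pchar E] =i pred0 ->
  (forall x, x \in xs -> algover S x) ->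
  exists2 t, algover S t & forall x, x \in xs -> adjoin S t x.
Proof.
move=> c0; elim: xs => [|x xs ih] hxs.
  by exists 0 => //; exact/(algover_id hS)/(sf0 hS).
have [|t ht tE] := ih; first by move=> y yxs; apply: hxs; rewrite inE yxs orbT.
have /(algoverP hS)[p nz_p px] := hxs x (mem_head _ _).
have /(algoverP hS)[q nz_q qt] := ht.
have c0S : [pchar (sfield hS)] =i pred0.
  by move=> i; rewrite -(c0 i); exact/esym/(fmorph_pchar (sfincl hS)).
have [n /=] := pchar0_PET nz_p px nz_q qt c0S; set z := t *+ n - x.
move=> [[r1 r1x] [r2 r2t]].
have hz : algover S z.
  apply: (algoverB hS); last by apply: hxs; exact: mem_head.
  rewrite -mulr_natr; apply: (algoverM hS ht); apply: (algover_id hS).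
  exact: sf_nat.
exists z => // y; rewrite inE => /orP[/eqP->|yxs].
  by exists (map_poly (sfincl hS) r1); [exact: polyS_map | rewrite r1x].
apply: adjoin_sub hz _ _ (tE _ yxs).
by exists (map_poly (sfincl hS) r2); [exact: polyS_map | rewrite r2t].
Qed.
End Adjoin.

Lemma nat_nonroot (E : fieldType) (q : {poly E}) : [pchar E] =i pred0 ->
  q != 0 -> exists c : nat, q.[c%:R] != 0.
Proof.
move=> /pcharf0P c0 nz_q; apply: contrapT => h.
pose rs : seq E := [seq c%:R | c <- iota 0 (size q)].
have : (size rs < size q)%N.
  apply: max_poly_roots nz_q _ _.
    apply/allP => _ /mapP[c _ ->]; apply/negPn/negP => nr; apply: h; exists c.
    by rewrite -rootE.
  rewrite map_inj_uniq ?iota_uniq //.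
  have inj a b : (a <= b)%N -> a%:R = b%:R :> E -> a = b.
    move=> le /esym/eqP; rewrite -subr_eq0 -natrB // c0 subn_eq0 => le2.
    by apply/eqP; rewrite eqn_leq le.
  by move=> a b; case/orP: (leq_total a b) => le e; [|apply/esym]; apply: inj.
by rewrite size_map size_iota ltnn.
Qed.

(** For all but finitely many integers [c], the conjugates [r] of [x] other than
[x] satisfy [(r + c) ^ M != (x + c) ^ M], so that [x + c] is the only one of its
own conjugates with the same [M]-th power. *)
Lemma power_generator (E : closedFieldType) (S : set E) (xs : seq E) M :
  subfield S -> [pchar E] =i pred0 -> (0 < M)%N ->
  (forall x, x \in xs -> algover S x) ->
  exists t, [/\ algover S t, t != 0, adjoin S (t ^+ M) t &
    forall x, x \in xs -> adjoin S (t ^+ M) x].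
Proof.
move=> hS c0 M0 hxs; have [x hx xE] := primitive hS c0 hxs.
have [rs [xrs rsS rsq]] := conjugates hS hx.
pose q := ('X + x%:P) * \prod_(r <- rs | r != x) (('X + r%:P) ^+ M - ('X + x%:P) ^+ M).
have nz_q : q != 0.
  apply: mulf_neq0; first exact: (monic_neq0 (monicXaddC x)).
  rewrite prodf_seq_neq0; apply/allP => r _; apply/implyP => nrx.
  apply: contraNneq nrx => /(congr1 (horner^~ (- x))).
  rewrite horner0 hornerD hornerN !horner_exp !hornerE /= addNr expr0n.
  rewrite eqn0Ngt M0 subr0 => /eqP; rewrite expf_eq0 M0 /= addrC subr_eq0.
  by [].
have [c] := nat_nonroot c0 nz_q; rewrite hornerM mulf_eq0 negb_or.
rewrite !hornerE horner_prod prodf_seq_neq0 => /andP[nz_t /allP hc].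
set t := c%:R + x in nz_t.
have St : algover S t.
  by apply: (algoverD hS) => //; apply: (algover_id hS); exact: sf_nat.
have StM : algover S (t ^+ M).
  exact: (sfX (subfield_algover hS)).
have hT := subfield_adjoin hS StM; set T := adjoin S (t ^+ M) in hT.
have ST : S `<=` T by exact: adjoinS.
(* [t] is the only root common to its equation over [S] and to ['X^M - t ^+ M]. *)
have Tt : T t.
  apply: (fixed_in hT c0); first exact: algoverS ST St.
  move=> y hy.
  have yM : y ^+ M = t ^+ M.
    have : root ('X^M - (t ^+ M)%:P) y.
      apply: hy; last by rewrite rootE !hornerE subrr.
      apply/(polySP hT); rewrite rpredB ?rpredX ?polyOverX // polyOverC.
      exact/(sfpredP hT)/adjoin_id.
    by rewrite rootE !hornerE subr_eq0 => /eqP.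
  have : y - c%:R \in rs.
    rewrite -root_prod_XsubC -[root _ _]/(_ == 0).
    have -> : y - c%:R = ('X - (c%:R)%:P).[y] by rewrite !hornerE.
    rewrite -horner_comp -rootE; apply: hy.
      apply/(polySP hT)/polyOver_comp; apply/(polySP hT).
        by move=> i; apply/ST/rsS.
      apply/(polySP hT); rewrite rpredB ?polyOverX // polyOverC.
      by apply/(sfpredP hT); exact: sf_nat.
    rewrite rootE horner_comp !hornerE.
    by rewrite /t addrAC subrr add0r -rootE root_prod_XsubC.
  move=> /hc /implyP h; have [e|/h] := eqVneq (y - c%:R) x.
    by rewrite /t -e addrCA subrr addr0.
  by rewrite hornerD hornerN !horner_exp !hornerD !hornerX !hornerC addrCA subrr addr0 yM subrr eqxx.
exists t; split=> // z /xE; apply: adjoin_sub => //.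
suff : T (t - c%:R) by rewrite /t addrAC subrr add0r.
by apply: (sfB hT) => //; exact: sf_nat.
Qed.

(** * Symmetric functions of the roots *)

Section Symmetric.
Variables (E : fieldType) (S : set E) (hS : subfield S).
Variables (n : nat) (al : 'I_n -> E).
Hypothesis hal : polyS S (\prod_(i < n) ('X - (al i)%:P)).

Let ev : {mpoly int[n]} -> E := mmap intr al.

(** By the fundamental theorem, [q] is a polynomial in the elementary symmetric
polynomials, whose values are coefficients of the polynomial with roots [al]. *)
Lemma symmetric_eval (q : {mpoly int[n]}) : q \is symmetric -> S (ev q).
Proof.
move=> /sym_fundamental[t [<- _]].
have S_int (z : int) : S (z%:~R).
  by case: z => k; rewrite ?NegzE ?mulrNz; [|apply: (sfN hS)]; exact: (sf_nat hS).
have evS k : S (ev (mesym n int k)).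
  have [le_kn|lt_nk] := leqP k n; last first.
    by rewrite mesym_geqnE // /ev mmap0; exact: (sf0 hS).
  rewrite -ltnS in le_kn.
  have := mroots_coeff [tuple al i | i < n] (Ordinal le_kn).
  rewrite big_tuple /=; under eq_bigr do rewrite tnth_mktuple.
  move=> e; have := hal (n - k)%N; rewrite e => /(sfM hS (sfX hS k (sfN hS (sf1 hS)))).
  rewrite mulrA -exprMn mulN1r opprK expr1n mul1r.
  suff -> : (mesym n E k).@[tnth [tuple al i | i < n]] = ev (mesym n int k) by [].
  rewrite /mesym /ev !raddf_sum /=; apply/eq_bigr => i _.
  rewrite !rmorph_prod /=; apply/eq_bigr => j _.
  by rewrite mmapX mmap1U mevalXU tnth_mktuple.
rewrite comp_mpolyE /ev raddf_sum; apply: (sf_sum hS) => m _.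
rewrite /= mmapZ; apply: (sfM hS); first exact: S_int.
rewrite rmorph_prod; apply: (sf_prod hS) => i _.
by rewrite rmorphXn /= tnth_mktuple; apply: (sfX hS); exact: evS.
Qed.

Lemma symmetric_esum m : S (\sum_(A : {set 'I_n} | #|A| == m) \prod_(i in A) al i).
Proof.
have := symmetric_eval (mesym_sym n int m).
rewrite /ev /mesym raddf_sum /=; congr (S _); apply: eq_bigr => A _.
by rewrite rmorph_prod /=; apply: eq_bigr => i _; rewrite mmapX mmap1U.
Qed.

(** A permutation of the variables permutes the factors of [Q]. *)
Lemma symmetric_subset_prod m :
  polyS S (\prod_(A : {set 'I_n} | #|A| == m) (1 - (\prod_(i in A) al i)%:P * 'X)).
Proof.
pose b (A : {set 'I_n}) : {mpoly int[n]} := \prod_(i in A) 'X_i.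
pose Q : {poly {mpoly int[n]}} :=
  \prod_(A : {set 'I_n} | #|A| == m) (1 - (b A)%:P * 'X).
have -> : \prod_(A : {set 'I_n} | #|A| == m) (1 - (\prod_(i in A) al i)%:P * 'X) =
    map_poly ev Q.
  rewrite /Q rmorph_prod; apply: eq_bigr => A _.
  rewrite rmorphB rmorph1 rmorphM /= map_polyX map_polyC /=.
  congr (1 - _%:P * _); rewrite /ev /b rmorph_prod /=.
  by apply: eq_bigr => i _; rewrite mmapX mmap1U.
have bs (s : 'S_n) A : msym s (b A) = b (s @: A)%SET.
  rewrite /b rmorph_prod big_imset /=; last by move=> x y _ _; exact: perm_inj.
  apply: eq_bigr => i _; rewrite msymX; congr ('X_[_]).
  apply/mnmP => j; rewrite !mnmE; congr (nat_of_bool _).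
  by rewrite -(inj_eq (@perm_inj _ s)) permKV.
have Qs (s : 'S_n) : map_poly (msym s) Q = Q.
  rewrite /Q rmorph_prod /= [RHS](reindex_inj (imset_inj (@perm_inj _ s))) /=.
  rewrite [RHS](eq_bigl (fun A : {set 'I_n} => #|A| == m)); last first.
    by move=> A; rewrite card_imset //; exact: perm_inj.
  apply: eq_bigr => A _.
  by rewrite rmorphB rmorph1 rmorphM /= map_polyX map_polyC /= bs.
move=> j; rewrite coef_map; apply: symmetric_eval; apply/issymP => s.
by rewrite -{2}(Qs s) coef_map.
Qed.
End Symmetric.

(** * Henselian fields: conjugates have the same value *)

(** Hensel's lemma for the polynomials [1 + psi - 'X] congruent to [1 - 'X] modulo
the maximal ideal. This form is a fixed point equation, and it implies that
conjugates over [S] have the same value. *)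
Definition henselian (R : realType) (E : fieldType) (v : valuation R E)
    (S : set E) :=
  forall psi : {poly E}, polyS S psi -> (forall i, (0 < v psi`_i)%E) ->
  exists s, [/\ S s, (0 < v (s - 1)%R)%E & s = 1 + psi.[s]].

(** Newton interpolation: the divided difference of [q] at [t 0] has smaller degree
and takes values in [S] at the other points. *)
Lemma interpolation (E : fieldType) (S : set E) (q : {poly E}) (t : nat -> E) :
  subfield S -> injective t -> (forall j, S (t j)) -> (forall j, S q.[t j]) ->
  polyS S q.
Proof.
move=> hS; move sq: (size q) => n; have {sq} : (size q <= n)%N by rewrite sq.
elim: n q t => [|n ih] q t.
  by rewrite leqn0 size_poly_eq0 => /eqP -> *  i; rewrite coef0; exact: (sf0 hS).
move=> sq t_inj St Sq.
have : root (q - (q.[t 0%N])%:P) (t 0%N) by rewrite rootE !hornerE subrr.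
case/factor_theorem => q1 q1E.
have qE : q = q1 * ('X - (t 0%N)%:P) + (q.[t 0%N])%:P by rewrite -q1E subrK.
have Sq1 : polyS S q1.
  apply: (ih q1 (t \o succn)).
  - have [->|nz] := eqVneq q1 0; first by rewrite size_poly0.
    have : (size (q1 * ('X - (t 0%N)%:P))%R <= n.+1)%N.
      rewrite -q1E; apply: leq_trans (size_polyD _ _) _.
      by rewrite geq_max sq size_polyN (leq_trans (size_polyC_leq1 _)).
    by rewrite size_Mmonic ?monicXsubC // size_XsubC addn2.
  - by move=> i j /t_inj [].
  - by move=> j; exact: St.
  move=> j; have nz : t j.+1 - t 0%N != 0 by rewrite subr_eq0 (inj_eq t_inj).
  rewrite /= -(mulfK nz q1.[_]); apply: (sfdiv hS); last exact: (sfB hS).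
  have -> : q1.[t j.+1] * (t j.+1 - t 0%N) = q.[t j.+1] - q.[t 0%N].
    by rewrite {1}qE !hornerE addrK.
  exact: (sfB hS).
apply/(polySP hS); rewrite qE rpredD ?rpredM ?rpredB ?polyOverX ?polyOverC //.
- by apply/(polySP hS).
- by apply/(sfpredP hS).
by apply/(sfpredP hS).
Qed.

Section DominantProduct.
Variables (R : realType) (E : fieldType) (v : valuation R E).
Variables (S : set E) (hS : subfield S) (hens : henselian v S).

Let pos (p : {poly E}) := forall i, (0 < v p`_i)%E.

Let pos0 : pos 0. Proof. by move=> i; rewrite coef0 vfun0 ltry. Qed.
Let posD (p q : {poly E}) : pos p -> pos q -> pos (p + q).
Proof. by move=> hp hq i; rewrite coefD val_lt_add. Qed.
Let posM (p q : {poly E}) : (forall i, (0 <= v p`_i)%E) -> pos q -> pos (p * q).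
Proof. by move=> hp hq i; rewrite coefM val_lt_sum // => j _; exact: val_gt0M. Qed.
Let posW (p : {poly E}) : pos p -> forall i, (0 <= v p`_i)%E.
Proof. by move=> hp i; exact: ltW. Qed.
Let posC c : (0 < v c)%E -> pos c%:P.
Proof. by move=> hc i; rewrite coefC; case: ifP => // _; rewrite vfun0 ltry. Qed.
Let posX : forall i, (0 <= v ('X : {poly E})`_i)%E.
Proof. by move=> i; rewrite coefX; case: eqP; rewrite ?vfun1 // vfun0 leey. Qed.

Lemma val_prod_ge (n : nat) (al : 'I_n -> E) (mu : R) (A : {set 'I_n}) :
  (forall i, i \in A -> (mu%:E <= v (al i))%E) ->
  ((mu *+ #|A|)%:E <= v (\prod_(i in A) al i)%R)%E.
Proof.
rewrite -sumr_const => h.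
apply: (big_rec2 (fun x y => (x%:E <= v y)%E)); first by rewrite vfun1.
by move=> i x y iA le; rewrite vfunM EFinD leeD ?h.
Qed.

(** The product over [A0] has a strictly smaller value than the products over the
other sets with [#|A0|] elements. These products are the inverse roots of a
polynomial over [S], which becomes congruent to [1 - 'X] when they are divided by
their sum [e1]: the dominant one is then found in [S] by henselianity. *)
Lemma dominant_product (n : nat) (al : 'I_n -> E) (mu : R) (A0 : {set 'I_n}) :
  polyS S (\prod_(i < n) ('X - (al i)%:P)) ->
  (forall i, i \in A0 -> v (al i) = mu%:E) ->
  (forall i, i \notin A0 -> (mu%:E < v (al i))%E) ->
  S (\prod_(i in A0) al i).
Proof.
move=> Sal valA valN.
pose b (A : {set 'I_n}) := \prod_(i in A) al i.
have val_ge i : (mu%:E <= v (al i))%E.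
  by case: (boolP (i \in A0)) => [/valA->//|/valN/ltW].
have vb0 : v (b A0) = (mu *+ #|A0|)%:E.
  by rewrite (@val_prod _ _ v _ _ _ _ (fun=> mu)) // sumr_const.
have vb (A : {set 'I_n}) : #|A| == #|A0| -> A != A0 -> (v (b A0) < v (b A))%E.
  move=> /eqP cA neA; have /subsetPn[i iA niA] : ~~ (A \subset A0).
    by apply: contraNN neA => sub; rewrite eqEcard sub cA leqnn.
  rewrite vb0 -cA /b (cardsD1 i) iA mulrS (big_setD1 i) //= vfunM EFinD.
  apply: lte_leD => //; first exact: valN.
  by apply: val_prod_ge => j _.
pose e1 := \sum_(A : {set 'I_n} | #|A| == #|A0|) b A.
have Se1 : S e1 by exact: symmetric_esum.
pose e1' := \sum_(A : {set 'I_n} | (#|A| == #|A0|) && (A != A0)) b A.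
have e1E : e1 = b A0 + e1' by rewrite /e1 (bigD1 A0).
have ve1' : (v (b A0) < v e1')%E.
  by rewrite vb0; apply: val_lt_sum => A /andP[cA neA]; rewrite -vb0 vb.
have ve1 : v e1 = (mu *+ #|A0|)%:E by rewrite e1E val_dom.
have nz_e1 : e1 != 0 := val_fin_neq0 ve1.
pose rho (A : {set 'I_n}) := b A / e1.
have vrho0 : v (rho A0) = 0%E by rewrite /rho (valM vb0 (valV ve1)) subrr.
have vrho (A : {set 'I_n}) : #|A| == #|A0| -> A != A0 -> (0 < v (rho A))%E.
  move=> cA neA; have := vb A cA neA; rewrite /rho vfunM (valV ve1) vb0 EFinN.
  by move=> h; rewrite sube_gt0.
have vrho1 : (0 < v (1 - rho A0)%R)%E.
  have -> : 1 - rho A0 = e1' / e1.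
    by rewrite /rho -(mulfV nz_e1) -mulrBl {1}e1E addrAC subrr add0r.
  by move: ve1'; rewrite vfunM (valV ve1) vb0 EFinN sube_gt0.
pose T := \prod_(A : {set 'I_n} | (#|A| == #|A0|) && (A != A0))
  (1 - (rho A)%:P * 'X).
pose Q := \prod_(A : {set 'I_n} | #|A| == #|A0|) (1 - (rho A)%:P * 'X).
have QE : Q = (1 - (rho A0)%:P * 'X) * T by rewrite /Q (bigD1 A0).
have SQ : polyS S Q.
  have -> : Q = (\prod_(A : {set 'I_n} | #|A| == #|A0|) (1 - (b A)%:P * 'X))
      \Po (e1^-1 *: 'X).
    rewrite rmorph_prod; apply: eq_bigr => A _ /=.
    rewrite comp_polyB -polyC1 comp_polyM !comp_polyC comp_polyX polyC1 /rho polyCM.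
    by rewrite -mulrA (mul_polyC e1^-1).
  apply/(polySP hS)/polyOver_comp; apply/(polySP hS).
    exact: symmetric_subset_prod.
  by apply/(polySP hS); rewrite polyOverZ ?polyOverX //; apply/(sfpredP hS)/(sfV hS).
have posT : pos (T - 1).
  rewrite /T; elim/big_rec: _ => [|A p /andP[cA neA] hp]; first by rewrite subrr.
  have -> : (1 - (rho A)%:P * 'X) * p - 1 =
      (p - 1) + 'X * ((p - 1) * (- rho A)%:P + (- rho A)%:P).
    by rewrite polyCN; ring.
  apply: posD => //; apply: posM => //; apply: posD; last first.
    by apply: posC; rewrite vfunN vrho.
  by apply: posM; [exact: posW | apply: posC; rewrite vfunN vrho].
pose psi := Q - 1 + 'X.
have pospsi : pos psi.
  have -> : psi = (T - 1) + (- rho A0)%:P * ('X * (T - 1)) + 'X * (1 - rho A0)%:P.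
    by rewrite /psi QE polyCN polyCB; ring.
  apply: posD; last by apply: posM => //; exact: posC.
  apply: posD => //; apply: posM; last exact: posM.
  by move=> i; rewrite coefC; case: ifP; rewrite ?vfunN ?vrho0 // vfun0 leey.
have Spsi : polyS S psi.
  apply/(polySP hS); rewrite rpredD ?rpredB ?rpred1 ?polyOverX //.
  by apply/(polySP hS).
have [s [Ss vs sE]] := hens Spsi pospsi.
have psiE : psi.[s] = Q.[s] - 1 + s.
  by rewrite /psi hornerD hornerX hornerD hornerN hornerC.
have : Q.[s] = 0.
  by apply: (addIr s); rewrite add0r [RHS]sE psiE; ring.
have vs0 : v s = 0%E by rewrite -(vfun1 v); apply: val_close; rewrite vfun1.
move=> /eqP; rewrite /Q horner_prod => /prodf_eq0 [A cA].
rewrite !hornerE subr_eq0 => /eqP rs.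
have vr : v (rho A) = 0%E by have := vfunM v (rho A) s; rewrite -rs vfun1 vs0 adde0.
have eA : A = A0.
  by apply: contraTeq isT => /(vrho A cA); rewrite vr ltxx.
have -> : \prod_(i in A0) al i = s^-1 * e1.
  have nz_s : s != 0 by apply: (@val_fin_neq0 _ _ v _ 0).
  have e : e1 = rho A * s * e1 by rewrite -rs mul1r.
  by apply: (mulfI nz_s); rewrite mulVKf // [RHS]e eA /rho mulrAC divfK // mulrC.
by apply: (sfM hS) => //; exact: (sfV hS).
Qed.
End DominantProduct.

Section ConjugateValues.
Variables (R : realType) (E : closedFieldType) (v : valuation R E).
Variables (S : set E) (hS : subfield S) (hens : henselian v S).
Hypothesis v_nat : forall n, (0 < n)%N -> v n%:R = 0%E.
Variables (a : E) (ra : R).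
Hypotheses (Sa : S a) (va : v a = ra%:E) (ra_gt0 : 0 < ra).

Lemma val_nat_char : [pchar E] =i pred0.
Proof.
move=> p; apply/negbTE/negP => /andP[/prime_gt0 /v_nat vp /eqP p0].
by move: vp; rewrite p0 vfun0.
Qed.

Lemma lt_mulrn_arch (r x : R) : 0 < r -> exists n, (x < r *+ n) && (0 < n)%N.
Proof.
move=> r0; exists (Num.bound `|x / r|).+1; rewrite andbT.
rewrite mulrS -mulr_natr; apply: (@lt_trans _ _ (r * (Num.bound `|x / r|)%:R)).
  rewrite mulrC -ltr_pdivrMr //; apply: le_lt_trans (ler_norm _) _.
  exact: archi_boundP (normr_ge0 _).
by rewrite ltrDr.
Qed.

(** The factor of [p = \prod_i ('X - al i)] with the roots of smallest value. Its
values at the points [t] of [S] of large value are, up to sign, the products of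
the [al i - t] of smallest value. *)
Lemma dominant_factor (n : nat) (al : 'I_n -> E) (mu : R) (A : {set 'I_n}) :
  polyS S (\prod_(i < n) ('X - (al i)%:P)) ->
  (forall i, i \in A -> v (al i) = mu%:E) ->
  (forall i, i \notin A -> (mu%:E < v (al i))%E) ->
  polyS S (\prod_(i in A) ('X - (al i)%:P)).
Proof.
move=> Sal valA valN; have [k /andP[ltk k0]] := lt_mulrn_arch mu ra_gt0.
have c0 := (pcharf0P E).1 val_nat_char.
pose t j := a ^+ k *+ j.+1.
have vt j : v (t j) = (ra *+ k)%:E.
  by rewrite /t -mulr_natr vfunM v_nat // adde0 (valX k va).
have St j : S (t j).
  by rewrite /t -mulr_natr; apply: (sfM hS (sfX hS k Sa)); exact: sf_nat.
apply: (interpolation (t := t) hS) => //.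
  move=> i j /eqP; rewrite /t -!(mulr_natr (a ^+ k)) => /eqP /mulfI.
  have nz : a ^+ k != 0 by apply: (val_fin_neq0 (valX k va)).
  move=> /(_ nz) /eqP; rewrite -subr_eq0.
  case/orP: (leq_total i j) => le; [rewrite -oppr_eq0 opprB|];
    by rewrite -natrB ?ltnS // c0 subSS subn_eq0 => le2; apply/eqP;
      rewrite eqn_leq le le2.
move=> j; rewrite horner_prod.
have -> : \prod_(i in A) ('X - (al i)%:P).[t j] =
    (-1) ^+ #|A| * \prod_(i in A) (al i - t j).
  by rewrite -prodrN; apply: eq_bigr => i _; rewrite !hornerE opprB.
apply: (sfM hS); first by apply/(sfX hS)/(sfN hS)/(sf1 hS).
apply: (dominant_product hS hens (mu := mu)).
- have -> : \prod_(i < n) ('X - (al i - t j)%:P) =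
      (\prod_(i < n) ('X - (al i)%:P)) \Po ('X + (t j)%:P).
    rewrite rmorph_prod; apply: eq_bigr => i _ /=.
    by rewrite comp_polyB comp_polyC comp_polyX polyCB; ring.
  apply/(polySP hS)/polyOver_comp; apply/(polySP hS) => //.
  by apply/(polySP hS); rewrite rpredD ?polyOverX // polyOverC; apply/(sfpredP hS).
- by move=> i iA; rewrite val_dom ?valA // vfunN vt lte_fin.
by move=> i iA; apply: val_lt_sub; [exact: valN | rewrite vt lte_fin].
Qed.

(** Otherwise the minimal polynomial of [x] would have a proper factor over [S],
that of its roots of smallest value. *)
Lemma conjugate_val x y : algover S x ->
  (forall q, polyS S q -> root q x -> root q y) -> v y = v x.
Proof.
move=> Sx xy; have [rs [xrs rsS rsq]] := conjugates hS Sx.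
have yrs : y \in rs by rewrite -root_prod_XsubC; apply: xy => //; rewrite root_prod_XsubC.
have [x0|nz_x] := eqVneq x 0.
  have : root 'X y by apply: xy; rewrite ?x0 /root ?hornerX //; apply/(polySP hS)/polyOverX.
  by rewrite /root hornerX => /eqP ->; rewrite x0.
suff all_ge r r' : r \in rs -> r' \in rs -> (v r <= v r')%E.
  by apply/eqP; rewrite eq_le !all_ge.
move=> rrs r'rs; rewrite leNgt; apply/negP => lt.
(* [mu] is the smallest value of the conjugates, which is finite as [x] is not 0. *)
have [mu [[i0 vi0] mu_min]] : exists mu, (exists i0 : 'I_(size rs), v rs`_i0 = mu%:E) /\
    forall i : 'I_(size rs), (mu%:E <= v rs`_i)%E.
  have ix : (index x rs < size rs)%N by rewrite index_mem.
  case: (@Order.TotalTheory.arg_minP _ _ _ (Ordinal ix) xpredT (fun i => v rs`_i) isT).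
  move=> i _ imin; have := imin (Ordinal ix) isT; rewrite /= nth_index //.
  have [b ->] := val_ex v nz_x; case e: (v rs`_i) => [m| |] //; last first.
    by case: (eqVneq rs`_i 0) e => [->|/(vfun_fin v)]; rewrite ?vfun0 // => + e; rewrite e.
  by move=> _; exists m; split; [exists i | move=> j; rewrite -e; exact: imin].
pose A := [set i : 'I_(size rs) | v rs`_i == mu%:E]%SET.
pose p1 := \prod_(i in A) ('X - (rs`_i)%:P).
have rsE : \prod_(r <- rs) ('X - r%:P) = \prod_(i < size rs) ('X - (rs`_i)%:P).
  by rewrite (big_nth 0) big_mkord.
have Sp1 : polyS S p1.
  apply: (dominant_factor (mu := mu)); first by rewrite -rsE.
    by move=> i; rewrite inE => /eqP.
  by move=> i; rewrite inE lt_neqAle mu_min andbT eq_sym.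
have root_p1 z : root p1 z -> v z = mu%:E.
  rewrite /root /p1 horner_prod => /prodf_eq0[i]; rewrite inE => /eqP vi.
  by rewrite !hornerE subr_eq0 => /eqP ->.
have [p2 Sp2 pE] : exists2 p2, polyS S p2 & \prod_(r <- rs) ('X - r%:P) = p2 * p1.
  have [q1 q1E] := sfpoly hS Sp1; have [q qE] := sfpoly hS rsS.
  have : q1 %| q.
    rewrite -(dvdp_map (sfincl hS)) q1E qE rsE (bigID (mem A)) /=.
    exact: dvdp_mulr.
  case/dvdpP => q2 q2E; exists (map_poly (sfincl hS) q2); first exact: polyS_map.
  by rewrite -qE q2E rmorphM /= q1E.
have root_p2 z : root p2 z -> (mu%:E < v z)%E.
  have p1E : p2 = \prod_(i < size rs | i \notin A) ('X - (rs`_i)%:P).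
    have nz : p1 != 0 by rewrite prodf_seq_neq0; apply/allP => i _; rewrite polyXsubC_eq0 implybT.
    by apply: (mulIf nz); rewrite -pE rsE (bigID (mem A)) /= mulrC.
  rewrite /root p1E horner_prod => /prodf_eq0[i]; rewrite inE => vi.
  by rewrite !hornerE subr_eq0 => /eqP ->; rewrite lt_neqAle mu_min andbT eq_sym.
have : root (p2 * p1) x by rewrite -pE root_prod_XsubC.
rewrite rootM => /orP[/(rsq _ Sp2) h|/(rsq _ Sp1) h].
  by have := root_p2 _ (h _ (mem_nth 0 (ltn_ord i0))); rewrite vi0 ltxx.
by move: lt; rewrite !(root_p1 _ (h _ _)) // ltxx.
Qed.
End ConjugateValues.

(** * Closed subrings of a complete valuation ring *)

Definition vcomplete (R : realType) (K : fieldType) (v : valuation R K) :=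
  forall u : nat -> K, (forall p, vball v 0 (u p)) ->
  (forall l : R, exists N, forall p q, (N <= p)%N -> (N <= q)%N ->
    vball v l (u p - u q)) ->
  exists2 y, vball v 0 y & forall l : R, exists N, forall p, (N <= p)%N ->
    vball v l (y - u p).

Definition closed_ring (R : realType) (K : fieldType) (v : valuation R K)
    (V : set K) :=
  [/\ V 1, forall x y, V x -> V y -> V (x - y),
    forall x y, V x -> V y -> V (x * y), V `<=` vball v 0 &
    forall y, (forall l, exists2 x, V x & vball v l (y - x)) -> V y].

Section ClosedRing.
Variables (R : realType) (K : fieldType) (v : valuation R K).
Implicit Types V : set K.

Lemma val_infty x : (forall l : R, (l%:E <= v x)%E) -> x = 0.
Proof.
move=> h; apply/eqP; apply: contraT => /(val_ex v)[a va].
by have := h (a + 1); rewrite va lee_fin gerDl ler10.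
Qed.

Lemma closed_ring_vball : closed_ring v (vball v 0).
Proof.
split=> //; rewrite /vball /=; first by rewrite vfun1.
- by move=> x y; exact: val_le_sub.
- by move=> x y; exact: val_ge0M.
move=> y /(_ 0)[x Vx yx]; rewrite -(subrK x y); exact: val_le_add.
Qed.

Section Ring.
Variables (V : set K) (hV : closed_ring v V).

Lemma cr1 : V 1. Proof. by case: hV. Qed.
Lemma crB x y : V x -> V y -> V (x - y). Proof. by case: hV => _ h _ _ _; apply: h. Qed.
Lemma crM x y : V x -> V y -> V (x * y). Proof. by case: hV => _ _ h _ _; exact: h. Qed.
Lemma cr_ge0 x : V x -> (0 <= v x)%E. Proof. by case: hV => _ _ _ h _ /h. Qed.
Lemma cr_lim y : (forall l, exists2 x, V x & vball v l (y - x)) -> V y.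
Proof. by case: hV => _ _ _ _ h; apply: h. Qed.
Lemma cr0 : V 0. Proof. by rewrite -(subrr 1); apply: crB cr1 cr1. Qed.
Lemma crD x y : V x -> V y -> V (x + y).
Proof. by move=> vx vy; rewrite -[y]opprK -(sub0r y); apply: crB => //; exact: (crB cr0 vy). Qed.
Lemma crX x n : V x -> V (x ^+ n).
Proof.
by move=> vx; elim: n => [|n ih]; rewrite ?expr0 ?exprS; [exact: cr1 | exact: crM].
Qed.
Lemma cr_sum I (r : seq I) (P : pred I) (f : I -> K) :
  (forall i, P i -> V (f i)) -> V (\sum_(i <- r | P i) f i).
Proof. by move=> h; elim/big_ind: _ => //; [exact: cr0 | exact: crD]. Qed.
Lemma cr_horner p x : polyS V p -> V x -> V p.[x].
Proof.
by move=> hp vx; rewrite horner_coef; apply: cr_sum => i _; exact: (crM (hp i) (crX i vx)).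
Qed.

(** The inverse of [x] is the sum of the geometric series of ratio [1 - x]. *)
Lemma cr_inv1 x : V x -> (0 < v (x - 1)%R)%E -> V x^-1.
Proof.
move=> Vx vx1; have vx : v x = 0%E by rewrite -(vfun1 v); apply: val_close; rewrite vfun1.
have nz_x : x != 0 := val_fin_neq0 vx.
have V1x : V (1 - x) by apply: crB cr1 Vx.
apply: cr_lim => l; have [->|nz] := eqVneq x 1.
  by exists 1; [exact: cr1 | rewrite /vball /= invr1 subrr vfun0 leey].
have nz1 : 1 - x != 0 by rewrite subr_eq0 eq_sym.
have [r vr] := val_ex v nz1.
have r0 : 0 < r by move: vx1; rewrite valB vr lte_fin.
have [m /andP[/ltW lm _]] := lt_mulrn_arch l r0.
exists (\sum_(i < m) (1 - x) ^+ i).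
  by apply: cr_sum => i _; exact: crX.
have -> : x^-1 - \sum_(i < m) (1 - x) ^+ i = (1 - x) ^+ m / x.
  apply: (mulIf nz_x); rewrite divfK // mulrBl mulVf //.
  have := subrX1 (1 - x) m; rewrite addrAC subrr add0r => e.
  by rewrite -[RHS](subrK 1) e mulNr mulrC addrC.
by rewrite /vball /= (valM (valX m vr) (valV vx)) oppr0 addr0 lee_fin.
Qed.

(** [x |-> 1 + psi(x)] is a contraction of [V]: it increases the value of differences
by the smallest value [e] of the coefficients of [psi]. *)
Lemma cr_fixpoint (psi : {poly K}) : vcomplete v -> polyS V psi ->
  (forall i, (0 < v psi`_i)%E) ->
  exists s, [/\ V s, (0 < v (s - 1)%R)%E & s = 1 + psi.[s]].
Proof.
move=> vc Vpsi pos.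
have [e e0 epsi] : exists2 e : R, 0 < e & forall i, (e%:E <= v psi`_i)%E.
  have h (m : nat) : exists2 e : R, 0 < e &
      forall i, (i < m)%N -> (e%:E <= v psi`_i)%E.
    elim: m => [|m [e e0 he]]; first by exists 1.
    have [e' e'0 he'] : exists2 e' : R, 0 < e' & (e'%:E <= v psi`_m)%E.
      have [->|/(val_ex v)[c vm]] := eqVneq psi`_m 0.
        by exists 1; rewrite // vfun0 leey.
      by exists c; [rewrite -lte_fin -vm | rewrite vm].
    exists (Num.min e e'); first by rewrite lt_min e0.
    move=> i; rewrite ltnS leq_eqVlt => /orP[/eqP->|/he h].
      by apply: le_trans he'; rewrite lee_fin ge_min lexx orbT.
    by apply: le_trans h; rewrite lee_fin ge_min lexx.
  have [e e0 he] := h (size psi); exists e => // i.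
  by have [/he//|le] := ltnP i (size psi); rewrite nth_default // vfun0 leey.
have contr x y : V x -> V y -> (e%:E + v (x - y)%R <= v (psi.[x] - psi.[y])%R)%E.
  move=> Vx Vy; rewrite !horner_coef -sumrB; apply: val_le_sum => i _.
  rewrite -mulrBr subrXX vfunM leeD // vfunM leeDl //.
  by apply: cr_ge0; apply: cr_sum => j _; exact: (crM (crX _ Vx) (crX _ Vy)).
pose u := fix u n := if n is n'.+1 then 1 + psi.[u n'] else 1.
have Vu n : V (u n).
  by elim: n => [|n ih] /=; [exact: cr1 | exact: (crD cr1 (cr_horner Vpsi ih))].
have step n : ((e *+ n.+1)%:E <= v (u n.+1 - u n)%R)%E.
  elim: n => [|n ih].
    rewrite /= addrC addKr horner_coef; apply: val_le_sum => i _.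
    by rewrite expr1n mulr1 epsi.
  have -> : u n.+2 - u n.+1 = psi.[u n.+1] - psi.[u n] by rewrite /=; ring.
  apply: le_trans (contr _ _ (Vu _) (Vu _)).
  by rewrite mulrS EFinD leeD.
have far p q : (p <= q)%N -> ((e *+ p.+1)%:E <= v (u q - u p)%R)%E.
  move=> /subnK <-; elim: (q - p)%N => [|m ih].
    by rewrite add0n subrr vfun0 leey.
  rewrite addSn -(subrK (u (m + p)%N) (u (m + p).+1)) -addrA.
  apply: val_le_add => //; apply: le_trans (step _).
  by rewrite lee_fin ler_wpMn2l ?ltW // ltnS leq_addl.
have [|l|y _ ylim] := vc u; first by move=> p; apply: cr_ge0.
  have [m /andP[/ltW lm _]] := lt_mulrn_arch l e0.
  have lm' p : (m <= p)%N -> (l%:E <= (e *+ p.+1)%:E)%E.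
    by move=> le; rewrite lee_fin (le_trans lm) // ler_wpMn2l ?ltW // ltnW.
  exists m => p q mp mq; rewrite /vball /=.
  case/orP: (leq_total p q) => le; [rewrite valB|]; apply: le_trans (far _ _ le);
    exact: lm'.
have Vy : V y.
  apply: cr_lim => l; have [m hm] := ylim l.
  by exists (u m); [exact: Vu | exact: hm].
have yE : y = 1 + psi.[y].
  apply/eqP; rewrite -subr_eq0; apply/eqP/val_infty => l.
  have [m hm] := ylim l.
  have -> : y - (1 + psi.[y]) = (y - u m.+1) + (psi.[u m] - psi.[y]).
    by rewrite /=; ring.
  apply: val_le_add; first exact: hm.
  apply: le_trans (contr _ _ (Vu _) Vy); rewrite valB.
  apply: le_trans (hm m (leqnn m)) _; rewrite leeDr // lee_fin ltW //.
exists y; split=> //; rewrite {1}yE addrC addKr horner_coef.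
apply: val_lt_sum => i _; rewrite mulrC; apply: val_gt0M => //.
exact/cr_ge0/crX.
Qed.
End Ring.
End ClosedRing.

(** The fixed point equation only involves the coefficients of [psi], so that it can
be solved in a ring [V] containing them: [F] itself need not be complete. *)
Lemma henselian_closed_rings (R : realType) (K : fieldType)
    (v : valuation R K) (F : set K) : vcomplete v ->
  (forall p : {poly K}, polyS F p -> (forall i, (0 <= v p`_i)%E) ->
    exists V, [/\ closed_ring v V, V `<=` F & polyS V p]) ->
  henselian v F.
Proof.
move=> vc hF psi Fpsi pos.
have [|V [hV VF Vpsi]] := hF _ Fpsi; first by move=> i; exact: ltW.
by have [s [/VF Fs vs sE]] := cr_fixpoint hV vc Vpsi pos; exists s.
Qed.

Lemma polyS_image (K E : fieldType) (f : {rmorphism K -> E}) (F : set K)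
    (p : {poly E}) : polyS (f @` F) p -> F 0 ->
  exists2 q, polyS F q & map_poly f q = p.
Proof.
move=> Fp F0; pose c i := let: exist2 x _ _ := cid2 (Fp i) in x.
have cF i : F (c i) by rewrite /c; case: cid2.
have cE i : f (c i) = p`_i by rewrite /c; case: cid2.
exists (\poly_(i < size p) c i).
  by move=> i; rewrite coef_poly; case: ltnP => // _.
apply/polyP => i; rewrite coef_map coef_poly; case: ltnP => [_|le]; first exact: cE.
by rewrite raddf0 nth_default.
Qed.

Lemma henselian_image (R : realType) (K E : fieldType) (f : {rmorphism K -> E})
    (v : valuation R K) (w : valuation R E) (F : set K) : F 0 ->
  (forall x, w (f x) = v x) -> henselian v F -> henselian w (f @` F).
Proof.
move=> F0 wf hF psi Fpsi pos.
have [q qF qE] := polyS_image Fpsi F0.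
have [|s [Fs vs sE]] := hF _ qF; first by move=> i; rewrite -wf -coef_map qE.
exists (f s); split; first by exists s.
  by rewrite -(rmorph1 f) -rmorphB wf.
by rewrite {1}sE rmorphD rmorph1 -horner_map qE.
Qed.

Lemma subfield_image (K E : fieldType) (f : {rmorphism K -> E}) (F : set K) :
  subfield F -> subfield (f @` F).
Proof.
move=> hF; split; first by exists 1; [exact: sf1 | exact: rmorph1].
  by move=> _ _ [x Fx <-] [y Fy <-]; exists (x - y); [exact: sfB | exact: rmorphB].
by move=> _ _ [x Fx <-] [y Fy <-]; exists (x / y); [exact: sfdiv | rewrite fmorph_div].
Qed.

(** * Sums of homogeneous elements *)

(** [G] is a family of one-dimensional spaces over the field [G 0], lifting the
graded pieces of the valuation. *)
Record graded (R : realType) (K : fieldType) (v : valuation R K)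
    (G : R -> set K) : Prop := Graded {
  gr0 : forall i, G i 0;
  gr1 : G 0 1;
  grB : forall i x y, G i x -> G i y -> G i (x - y);
  grM : forall i j x y, G i x -> G j y -> G (i + j) (x * y);
  grV : forall i x, G i x -> G (- i) x^-1;
  gr_val : forall i x, G i x -> x != 0 -> v x = i%:E;
  gr_lead : forall y, y != 0 ->
    exists i g, [/\ G i g, v y = i%:E & (i%:E < v (y - g)%R)%E] }.

Section GradedSums.
Variables (R : realType) (K : fieldType) (v : valuation R K).
Variables (G : R -> set K) (hG : graded v G).
Implicit Types (T : set R) (i j l : R) (x y : K).

Lemma grN i x : G i x -> G i (- x).
Proof. by move=> gx; rewrite -sub0r; apply: (grB hG) => //; exact: (gr0 hG). Qed.

Lemma grD i x y : G i x -> G i y -> G i (x + y).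
Proof. by move=> gx gy; rewrite -[y]opprK; apply: (grB hG gx); exact: grN. Qed.

Lemma grX i x n : G i x -> G (i *+ n) (x ^+ n).
Proof.
move=> gx; elim: n => [|n ih]; first exact: (gr1 hG).
by rewrite exprS mulrS; exact: (grM hG).
Qed.

Lemma gr_ge i x : G i x -> (i%:E <= v x)%E.
Proof.
move=> gx; have [->|nz] := eqVneq x 0; first by rewrite vfun0 leey.
by rewrite (gr_val hG gx nz).
Qed.

Lemma gr_lead_neq0 y i g : v y = i%:E -> (i%:E < v (y - g)%R)%E ->
  v g = i%:E /\ g != 0.
Proof.
move=> vy lt; have vg : v g = i%:E by rewrite -vy; apply: val_close; rewrite valB vy.
by split=> //; exact: val_fin_neq0 vg.
Qed.

(** Finite sums of homogeneous elements of degrees in [T], in a normal form by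
increasing degrees, so that [c] is the leading term of [c + y]. *)
Inductive hsum : set R -> K -> Prop :=
| Hsum0 T : hsum T 0
| HsumS T i c y : T i -> G i c -> c != 0 -> hsum (T `&` [set j | i < j]) y ->
    hsum T (c + y).

Lemma hsumW T T' y : T `<=` T' -> hsum T y -> hsum T' y.
Proof.
move=> sub h; elim: h T' sub => {T y} [T|T i c y Ti Gc nz _ ih] T' sub.
  exact: Hsum0.
by apply: HsumS Gc nz _; [exact: sub | apply: ih => j [/sub]].
Qed.

Lemma hsum_insert T j x y : hsum T y -> T j -> G j x -> hsum T (x + y).
Proof.
move=> h Tj Gx; have [->|nz_x] := eqVneq x 0; first by rewrite add0r.
elim: h j x nz_x Tj Gx => {T y} [T|T i c y Ti Gc nz hy ih] j x nz_x Tj Gx.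
  by apply: HsumS Gx nz_x _ => //; exact: Hsum0.
case: (ltgtP j i) => [lt|lt|e].
- apply: HsumS Gx nz_x _ => //; apply: HsumS Gc nz _; first by split.
  by apply: hsumW hy => l [Tl il]; split=> //; split=> //; exact: lt_trans il.
- rewrite addrCA; apply: HsumS Gc nz _ => //.
  by apply: ih Gx => //; split.
rewrite addrA; have [xc0|nz_xc] := eqVneq (x + c) 0.
  by rewrite xc0 add0r; apply: hsumW hy => l [].
apply: HsumS nz_xc _; first exact: Ti.
  by apply: grD => //; rewrite -e.
exact: hy.
Qed.

Lemma hsum_hom T i x : T i -> G i x -> hsum T x.
Proof. by move=> Ti Gx; rewrite -[x]addr0; apply: hsum_insert Gx => //; exact: Hsum0. Qed.

Lemma hsumD T x y : hsum T x -> hsum T y -> hsum T (x + y).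
Proof.
move=> hx hy; have [T0 hx0 sub] : exists2 T0, hsum T0 x & T0 `<=` T by exists T.
elim: hx0 sub => {hx x T0} [T0|T0 i c x Ti Gc nz _ ih] sub; first by rewrite add0r.
rewrite -addrA; apply: (@hsum_insert _ i) => //; last exact: sub.
by apply: ih => l [/sub].
Qed.

Lemma hsumMl T T' j x y : hsum T y -> G j x -> (forall i, T i -> T' (j + i)) ->
  hsum T' (x * y).
Proof.
move=> h Gx; elim: h => {T y} [T|T i c y Ti Gc nz _ ih] sub.
  by rewrite mulr0; exact: Hsum0.
rewrite mulrDr; apply: hsumD.
  by apply: (@hsum_hom _ (j + i)); [exact: sub | exact: (grM hG)].
by apply: ih => l [/sub].
Qed.

Lemma hsumN T y : hsum T y -> hsum T (- y).
Proof.
move=> h; rewrite -mulN1r; apply: (@hsumMl T T 0 (-1) y) => //.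
  by apply: grN; exact: (gr1 hG).
by move=> i; rewrite add0r.
Qed.

Lemma hsumB T x y : hsum T x -> hsum T y -> hsum T (x - y).
Proof. by move=> hx hy; apply: hsumD => //; exact: hsumN. Qed.

Lemma hsum_sum T I (r : seq I) (P : pred I) (f : I -> K) :
  (forall a, P a -> hsum T (f a)) -> hsum T (\sum_(a <- r | P a) f a).
Proof. by move=> h; elim/big_ind: _ => //; [exact: Hsum0 | exact: hsumD]. Qed.

Lemma hsumM T x y : (forall i j, T i -> T j -> T (i + j)) ->
  hsum T x -> hsum T y -> hsum T (x * y).
Proof.
move=> TD hx hy; have [T0 hx0 sub] : exists2 T0, hsum T0 x & T0 `<=` T by exists T.
elim: hx0 sub => {hx x T0} [T0|T0 i c x Ti Gc nz _ ih] sub.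
  by rewrite mul0r; exact: Hsum0.
rewrite mulrDl; apply: hsumD; last by apply: ih => // l [/sub].
by apply: hsumMl hy Gc _ => l Tl; apply: TD => //; exact: sub.
Qed.

(** The first term of the normal form dominates the others. *)
Lemma hsum_lead T y : hsum T y -> y = 0 \/
  exists i c, [/\ T i, G i c, v y = i%:E, hsum (T `&` [set j | i < j]) (y - c) &
    (i%:E < v (y - c)%R)%E].
Proof.
move=> h; elim: h => {T y} [T|T i c y Ti Gc nz hy ih]; first by left.
have lt : (i%:E < v y)%E.
  by case: ih => [->|[j [d [[_ ij] _ -> _ _]]]]; rewrite ?vfun0 ?ltry ?lte_fin.
right; exists i, c; rewrite addrAC subrr add0r; split=> //.
by rewrite val_dom (gr_val hG Gc nz).
Qed.

Lemma hsum_val T y : hsum T y -> y = 0 \/ exists2 i, T i & v y = i%:E.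
Proof.
by case/hsum_lead => [->|[i [c [Ti _ vy _ _]]]]; [left | right; exists i].
Qed.

Lemma hsum_ge T l y : (forall i, T i -> l <= i) -> hsum T y -> (l%:E <= v y)%E.
Proof.
by move=> Tl /hsum_val[->|[i /Tl li ->]]; rewrite ?vfun0 ?leey ?lee_fin.
Qed.

Lemma hsum_cut T l y : hsum T y -> exists y1 c y2, [/\ y = y1 + c + y2,
  hsum (T `&` [set j | j < l]) y1, G l c, c != 0 -> T l &
  hsum (T `&` [set j | l < j]) y2].
Proof.
move=> h; elim: h => {T y} [T|T i c y Ti Gc nz hy [y1 [d [y2 [yE h1 Gd Td h2]]]]].
  exists 0, 0, 0; rewrite !addr0; split; rewrite ?eqxx //; try exact: Hsum0.
  exact: (gr0 hG).
case: (ltgtP i l) => [lt|lt|e].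
- exists (c + y1), d, y2; rewrite yE !addrA; split=> //.
  + apply: (@hsum_insert _ i) => //; by apply: hsumW h1 => j [[Tj ij] jl]; split.
  + by move/Td => [].
  by apply: hsumW h2 => j [[Tj ij] jl]; split.
- exists 0, 0, (c + y); rewrite !add0r; split; rewrite ?eqxx //; try exact: Hsum0.
    exact: (gr0 hG).
  apply: (@hsum_insert _ i) => //; apply: hsumW hy => j [Tj ij].
  by split=> //; exact: lt_trans ij.
exists 0, c, y; rewrite add0r -e; split=> //; exact: Hsum0.
Qed.

Lemma hsum_cut_ge T l y : hsum T y -> (l%:E <= v y)%E ->
  hsum (T `&` [set j | l <= j]) y.
Proof.
move=> /(hsum_cut l)[y1 [c [y2 [yE h1 Gc Tc h2]]]] ly.
suff y10 : y1 = 0.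
  rewrite yE y10 add0r; apply: hsumD.
    have [->|nz] := eqVneq c 0; first exact: Hsum0.
    by apply: hsum_hom Gc; split; [exact: Tc | exact: lexx].
  by apply: hsumW h2 => j [Tj /ltW].
case: (hsum_val h1) => // [[i [_ il] vy1]].
have : (l%:E <= v y1)%E.
  have -> : y1 = y - c - y2 by rewrite yE addrAC addrK addrK.
  apply: val_le_sub; first by apply: val_le_sub => //; exact: gr_ge.
  by apply: hsum_ge h2 => j [_ /ltW].
by rewrite vy1 lee_fin leNgt il.
Qed.

(** * Limits of sums of homogeneous elements *)

(** The elements whose expansion has its support in [T], described as limits, so
that they clearly form a ring when [T] is a semigroup. *)
Definition hlim T y := forall l, exists2 x, hsum T x & vball v l (y - x).

Lemma hlimW T T' y : T `<=` T' -> hlim T y -> hlim T' y.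
Proof. by move=> sub h l; have [x hx] := h l; exists x => //; exact: hsumW hx. Qed.

Lemma hlim_hom T i x : T i -> G i x -> hlim T x.
Proof.
move=> Ti Gx l; exists x; first exact: hsum_hom Gx.
by rewrite /vball /= subrr vfun0 leey.
Qed.

Lemma hlim_ge T l y : (forall i, T i -> l <= i) -> hlim T y -> (l%:E <= v y)%E.
Proof.
move=> Tl /(_ l)[x hx yx]; rewrite -(subrK x y); apply: val_le_add => //.
exact: hsum_ge hx.
Qed.

Lemma hlim_closed_ring T : T 0 -> (forall i j, T i -> T j -> T (i + j)) ->
  (forall i, T i -> 0 <= i) -> closed_ring v (hlim T).
Proof.
move=> T0 TD Tge; split.
- by apply: (@hlim_hom _ 0) => //; exact: (gr1 hG).
- move=> x y hx hy l; have [[x' hx' xx'] [y' hy' yy']] := (hx l, hy l).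
  exists (x' - y'); first exact: hsumB.
  have -> : x - y - (x' - y') = (x - x') - (y - y') by ring.
  exact: val_le_sub.
- move=> x y hx hy l; have x0 := hlim_ge Tge hx.
  have [[x' hx' xx'] [y' hy' yy']] := (hx (Num.max 0 l), hy (Num.max 0 l)).
  have le (z : K) : vball v (Num.max 0 l) z -> (l%:E <= v z)%E.
    by apply: le_trans; rewrite lee_fin le_max lexx orbT.
  have y'0 := hsum_ge Tge hy'.
  exists (x' * y'); first exact: hsumM.
  have -> : x * y - x' * y' = x * (y - y') + (x - x') * y' by ring.
  apply: val_le_add; rewrite vfunM.
    by rewrite -[X in (X <= _)%E]add0e leeD //; exact: le.
  by rewrite -[X in (X <= _)%E]adde0 leeD //; exact: le.
- by move=> y /(hlim_ge Tge).
move=> y h l; have [x hx yx] := h l; have [x' hx' xx'] := hx l.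
exists x' => //; rewrite -(subrK x y) -addrA; exact: val_le_add.
Qed.

(** As [y] has value at least [l], the terms of degree less than [l] of its
approximations vanish, and dividing by [g] shifts the other degrees. *)
Lemma hlim_shift T T' l g y : hlim T y -> (l%:E <= v y)%E -> G l g ->
  (forall i, T i -> l <= i -> T' (i - l)) -> hlim T' (y / g).
Proof.
move=> hy ly Gg sub; have [->|nz] := eqVneq g 0.
  by rewrite invr0 mulr0 => m; exists 0; [exact: Hsum0 | rewrite /vball /= subr0 vfun0 leey].
have vg := gr_val hG Gg nz; move=> m.
have [x hx yx] := hy (Num.max l (m + l)).
have lx : (l%:E <= v x)%E.
  rewrite -[x](subKr y); apply: val_le_sub => //.
  by apply: le_trans yx; rewrite lee_fin le_max lexx.
exists (x / g); last first.
  rewrite /vball /= -mulrBl vfunM (valV vg).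
  apply: (@le_trans _ _ ((m + l)%:E + (- l)%:E)%E).
    by rewrite -EFinD addrK.
  by rewrite leeD2r //; apply: le_trans yx; rewrite lee_fin le_max lexx orbT.
rewrite mulrC; apply: hsumMl (hsum_cut_ge hx lx) (grV hG Gg) _ => i [Ti li].
by rewrite addrC; exact: sub.
Qed.
End GradedSums.

(** * Expansions and finitely generated semigroups *)

Section Expansions.
Variables (R : realType) (K : fieldType) (v : valuation R K).
Variables (G : R -> set K) (hG : graded v G).
Implicit Types (T : set R) (i j l : R) (x y : K).

Lemma expansion_hlim T w y : expansion v G w y ->
  [set i | w i != 0] `<=` T -> hlim v G T y.
Proof.
move=> [Gw _ _ close] sub l.
exists (\sum_(i \in [set i | i <= l]) w i); last exact: ltW.
apply: (hsum_sum hG) => i _; have [->|nz] := eqVneq (w i) 0; first exact: Hsum0.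
by apply: (hsum_hom (i := i) hG) => //; exact: sub.
Qed.

(** The term of degree [i] of a limit [y] is the only [c] in [G i] such that
[y - y1 - c] has value greater than [i] for some sum [y1] of terms of degree
less than [i]. *)
Lemma hlim_expansion T y : (forall i, T i -> 0 <= i) ->
  (forall l, finite_set [set i | T i /\ i <= l]) ->
  hlim v G T y -> exists2 w, expansion v G w y & [set i | w i != 0] `<=` T.
Proof.
move=> Tge Tfin hy.
have term i : exists c, [/\ G i c, c != 0 -> T i & exists2 y1,
    hsum G (T `&` [set j | j < i]) y1 & (i%:E < v (y - y1 - c)%R)%E].
  have [x hx yx] := hy (i + 1).
  have [y1 [c [y2 [xE h1 Gc Tc h2]]]] := hsum_cut hG i hx.
  exists c; split=> //; exists y1 => //.
  have -> : y - y1 - c = (y - x) + y2 by rewrite xE; ring.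
  apply: val_lt_add.
    by apply: (lt_le_trans _ yx); rewrite lte_fin ltrDl.
  by case: (hsum_val hG h2) => [->|[j [_ ij] ->]]; rewrite ?vfun0 ?ltry ?lte_fin.
pose w i := projT1 (cid (term i)).
have wP i : [/\ G i (w i), w i != 0 -> T i & exists2 y1,
    hsum G (T `&` [set j | j < i]) y1 & (i%:E < v (y - y1 - w i)%R)%E].
  by rewrite /w; case: cid.
have Gw i : G i (w i) by have [] := wP i.
have Tw i : w i != 0 -> T i by have [] := wP i.
exists w => //; split=> //.
- by move=> i /Tw /Tge.
- by move=> l; apply: sub_finite_set (Tfin l) => i [/Tw].
move=> l; have fin : finite_set ([set i | i <= l] `&` w @^-1` [set~ 0]).
  by apply: sub_finite_set (Tfin l) => i [/= il /eqP/Tw].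
have [z hz yz] := hy (l + 1).
have [z1 [c [z2 [zE h1 Gc Tc h2]]]] := hsum_cut hG l hz.
set s := \sum_(i \in _) w i.
have hs : hsum G (T `&` [set j | j <= l]) s.
  rewrite /s big_seq; apply: (hsum_sum hG) => i.
  rewrite in_finite_support // => /set_mem[/= il /eqP nz].
  by apply: (hsum_hom (i := i) hG) => //; split=> //; exact: Tw.
pose z' := z1 + c.
have hz' : hsum G (T `&` [set j | j <= l]) z'.
  apply: (hsumD hG); first by apply: hsumW h1 => j [Tj /ltW].
  have [->|nz] := eqVneq c 0; first exact: Hsum0.
  by apply: (hsum_hom (i := l) hG) => //; split=> /=; [exact: Tc | exact: lexx].
have yz' : (l%:E < v (y - z')%R)%E.
  have -> : y - z' = (y - z) + z2 by rewrite zE /z'; ring.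
  apply: val_lt_add; first by apply: (lt_le_trans _ yz); rewrite lte_fin ltrDl.
  by case: (hsum_val hG h2) => [->|[j [_ ij] ->]]; rewrite ?vfun0 ?ltry ?lte_fin.
suff -> : s = z' by [].
apply/eqP; rewrite -subr_eq0; apply/eqP.
have [//|[i [Ti il] vsz]] := hsum_val hG (hsumB hG hs hz').
exfalso; have [_ _ [y1 hy1 yy1]] := wP i.
pose r := finite_support 0 [set i | i <= l] w.
(* The partial sum [s] has the term [w i] of degree [i], while [z'] agrees with
[y1 + w i] up to degree [i]: if the difference [s - z'] had value [i], so would
[s1 - y1], whose degrees are less than [i]. *)
have [s1 [s2 [sE hs1 vs2]]] : exists s1 s2, [/\ s = s1 + w i + s2,
    hsum G (T `&` [set j | j < i]) s1 & (i%:E < v s2)%E].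
  exists (\sum_(j <- r | j < i) w j), (\sum_(j <- r | i < j) w j); split.
  - rewrite /s -/r (bigID (fun j => j < i)) /= -addrA; congr (_ + _).
    rewrite (bigID (fun j => j == i)) /=; congr (_ + _); last first.
      by apply: eq_bigl => j; rewrite -leNgt lt_neqAle andbC eq_sym.
    rewrite (eq_bigl (fun j => j == i)); last first.
      by move=> j; case: eqP => [->|]; rewrite ?ltxx ?andbF.
    have [ir|nir] := boolP (i \in r).
      by rewrite -big_filter filter_pred1_uniq ?big_seq1 // finite_support_uniq.
    rewrite big1_seq; last by move=> j /andP[/eqP-> ir]; rewrite ir in nir.
    apply/eqP; apply: contraNT nir => nz; rewrite /r in_finite_support //.
    by apply: mem_set; split=> //; apply/eqP; rewrite eq_sym.
  - apply: (hsum_sum hG) => j ji; have [->|nz] := eqVneq (w j) 0; first exact: Hsum0.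
    by apply: (hsum_hom (i := j) hG) => //; split=> //; exact: Tw.
  apply: val_lt_sum => j ij; have [->|nz] := eqVneq (w j) 0.
    by rewrite vfun0 ltry.
  by rewrite (gr_val hG (Gw j) nz) lte_fin.
pose d := s1 - y1.
have vd : v d = i%:E.
  rewrite -vsz; apply: val_close; rewrite vsz.
  have -> : d - (s - z') = (y - y1 - w i) - (y - z') - s2 by rewrite /d sE; ring.
  do 2!apply: val_lt_sub => //.
  by apply: le_lt_trans yz'; rewrite lee_fin.
have [d0|[j [_ ji] vd']] := hsum_val hG (hsumB hG hs1 hy1).
  by rewrite -/d in d0; rewrite d0 vfun0 in vd.
by move: vd'; rewrite -/d vd => -[e]; move: ji; rewrite /= e ltxx.
Qed.
End Expansions.

Section Semigroups.
Variable R : realType.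
Implicit Types (gs : seq R) (x y l : R).

Inductive ssg gs : set R :=
| Ssg0 : ssg gs 0
| SsgS g x : g \in gs -> ssg gs x -> ssg gs (g + x).

Lemma ssg_gen gs g : g \in gs -> ssg gs g.
Proof. by move=> ggs; rewrite -[g]addr0; apply: SsgS => //; exact: Ssg0. Qed.

Lemma ssgD gs x y : ssg gs x -> ssg gs y -> ssg gs (x + y).
Proof.
move=> hx hy; elim: hx => [|g {}x ggs _ ih]; first by rewrite add0r.
by rewrite -addrA; exact: SsgS.
Qed.

Lemma ssg_sub gs gs' : {subset gs <= gs'} -> ssg gs `<=` ssg gs'.
Proof.
move=> sub x; elim=> [|g {}x /sub ggs _ ih]; [exact: Ssg0 | exact: SsgS].
Qed.

Lemma ssg_ge0 gs x : {in gs, forall g, 0 <= g} -> ssg gs x -> 0 <= x.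
Proof. by move=> h; elim=> [//|g {}x /h g0 _ ih]; exact: addr_ge0. Qed.

Lemma ssg_span gs :
  ssg gs = semigroup_span (fun j : 'I_(size gs) => gs`_j).
Proof.
apply/seteqP; split=> x.
  elim=> [|g {}x ggs _ [c ->]].
    by exists (fun=> 0%N); rewrite big1.
  have ig : (index g gs < size gs)%N by rewrite index_mem.
  exists (fun j => (c j + (j == Ordinal ig))%N).
  under [RHS]eq_bigr do rewrite mulrnDr.
  rewrite big_split /= addrC; congr (_ + _).
  rewrite (bigD1 (Ordinal ig)) //= eqxx nth_index // big1 ?addr0 //.
  by move=> j /negbTE ->.
case=> c ->; elim/big_ind: _ => [||j _]; [exact: Ssg0 | exact: ssgD |].
elim: (c j) => [|m ih]; first exact: Ssg0.
by rewrite mulrS; apply: SsgS => //; exact: mem_nth.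
Qed.

Lemma span_ssg m (g : 'I_m -> R) : semigroup_span g `<=` ssg (codom g).
Proof.
move=> _ [c ->]; elim/big_ind: _ => [||j _]; [exact: Ssg0 | exact: ssgD |].
elim: (c j) => [|n ih]; first exact: Ssg0.
by rewrite mulrS; apply: SsgS => //; exact: codom_f.
Qed.

Lemma ssg_finite gs l : {in gs, forall g, 0 <= g} ->
  exists r : seq R, forall x, ssg gs x -> x <= l -> x \in r.
Proof.
move=> gs0; pose ps := [seq g <- gs | 0 < g].
have sp x : ssg gs x -> ssg ps x.
  elim=> [|g {}x ggs _ ih]; first exact: Ssg0.
  have := gs0 _ ggs; rewrite le_eqVlt => /orP[/eqP<-|g0]; first by rewrite add0r.
  by apply: SsgS => //; rewrite mem_filter g0.
have [e e0 he] : exists2 e, 0 < e & {in ps, forall g, e <= g}.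
  have : {in ps, forall g, 0 < g} by move=> g; rewrite mem_filter => /andP[].
  elim: ps {sp} => [|g ps ih] h; first by exists 1.
  have [|e e0 he] := ih; first by move=> g' g'ps; apply: h; rewrite inE g'ps orbT.
  exists (Num.min e g); first by rewrite lt_min e0 h ?mem_head.
  by move=> g'; rewrite inE => /orP[/eqP->|/he]; rewrite ge_min ?lexx ?orbT // => ->.
(* [sums m] lists the sums of at most [m] positive generators, and such a sum is at
least [e] times its number of terms. *)
pose sums := fix s m : seq R := if m is m'.+1 then
  s m' ++ [seq g + x | g <- ps, x <- s m'] else [:: 0].
have sumsP m x : ssg ps x -> x < e *+ m -> x \in sums m.
  move=> hx; elim: hx m => [|g {}x gps hx ih] m lt.
    case: m lt => [|m] _; first by rewrite inE.
    by elim: m.+1 => [|k ihk] /=; rewrite ?inE // mem_cat ihk.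
  have x0 : 0 <= x by apply: ssg_ge0 hx => g' /he; apply: le_trans; exact: ltW.
  case: m lt => [|m]; rewrite ?mulr0n ?mulrS => lt.
    by have := addr_ge0 (le_trans (ltW e0) (he _ gps)) x0; rewrite leNgt lt.
  rewrite /= mem_cat; apply/orP; right; apply: allpairs_f => //; apply: ih.
  by rewrite -(ltrD2l e); apply: le_lt_trans lt; rewrite lerD2r he.
have [m /andP[lm _]] := lt_mulrn_arch l e0.
by exists (sums m) => x /sp hx xl; apply: sumsP => //; exact: le_lt_trans lm.
Qed.

(** Shifting a finitely generated semigroup: a sum that exceeds [l] by more than
any generator still exceeds [l] once one of its terms is removed. *)
Lemma ssg_shift gs l : {in gs, forall g, 0 <= g} ->
  exists2 gs', {in gs', forall g, 0 <= g} &
    forall x, ssg gs x -> l <= x -> ssg gs' (x - l).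
Proof.
move=> gs0.
have [M hM] : exists M, {in gs, forall g, g <= M}.
  elim: (gs) => [|g s [M hM]]; first by exists 0.
  exists (Num.max M g) => h; rewrite inE => /orP[/eqP->|/hM]; rewrite le_max ?lexx ?orbT //.
  by move=> ->.
have [r hr] := ssg_finite (Num.max 0 (l + M)) gs0.
exists (gs ++ [seq x - l | x <- r & l <= x]).
  move=> g; rewrite mem_cat => /orP[/gs0//|/mapP[x]].
  by rewrite mem_filter => /andP[lx _] ->; rewrite subr_ge0.
have gen x : x \in r -> l <= x -> ssg (gs ++ [seq x - l | x <- r & l <= x]) (x - l).
  move=> xr lx; apply: ssg_gen; rewrite mem_cat; apply/orP; right.
  by apply: map_f; rewrite mem_filter lx.
move=> x hx; elim: hx => [|g {}x ggs hx ih] lx.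
  by apply: gen => //; apply: hr; [exact: Ssg0 | rewrite le_max lexx].
have [lx'|xl] := leP l x.
  by rewrite -addrA; apply: SsgS; [rewrite mem_cat ggs | exact: ih].
apply: gen => //; apply: hr; first exact: SsgS.
by rewrite le_max; apply/orP; right; rewrite addrC lerD ?hM // ltW.
Qed.
End Semigroups.

(** * The fields of fractions of the two valuation rings *)

Lemma subfield_frac (K : fieldType) (B : set K) : B 1 ->
  (forall x y, B x -> B y -> B (x - y)) ->
  (forall x y, B x -> B y -> B (x * y)) -> subfield (frac_set B).
Proof.
move=> B1 BB BM; split; first by exists 1, 1; rewrite oner_neq0 divr1.
  move=> _ _ [a [b [Ba Bb nb ->]]] [c [d [Bc Bd nd ->]]].
  exists (a * d - c * b), (b * d); rewrite mulf_neq0 //; split=> //.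
  - by apply: BB; apply: BM.
  - exact: BM.
  by rewrite -mulNr addf_div // mulNr.
move=> _ _ [a [b [Ba Bb nb ->]]] [c [d [Bc Bd nd ->]]].
have [->|nc] := eqVneq c 0.
  exists 0, 1; rewrite mul0r invr0 mulr0 mul0r oner_neq0; split=> //.
  by rewrite -(subrr 1); exact: BB.
exists (a * d), (b * c); rewrite mulf_neq0 //; split=> //; try exact: BM.
by rewrite invf_div mulf_div.
Qed.

Lemma frac_setS (K : fieldType) (B : set K) x : B 1 -> B x -> frac_set B x.
Proof. by move=> B1 Bx; exists x, 1; rewrite oner_neq0 divr1. Qed.

Section FractionFields.
Variables (R : realType) (K : fieldType) (v : valuation R K).
Variables (G : R -> set K) (hG : graded v G) (vc : vcomplete v).
Implicit Types (gs : seq R) (i j l : R) (x y : K).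

Lemma hlim_ssg_closed gs : {in gs, forall g, 0 <= g} ->
  closed_ring v (hlim v G (ssg gs)).
Proof.
move=> gs0; apply: hlim_closed_ring => //; first exact: Ssg0.
  exact: ssgD.
by move=> i; exact: ssg_ge0.
Qed.

Lemma VfgP y : Vfg v G y <->
  exists2 gs, {in gs, forall g, 0 <= g} & hlim v G (ssg gs) y.
Proof.
split=> [[_ [w wy [m [g [g0 sub]]]]]|[gs gs0 hy]].
  exists (codom g); first by move=> _ /codomP[j ->].
  by apply: expansion_hlim wy _ => // i /sub /span_ssg.
have [] := @hlim_expansion _ _ v G hG (ssg gs) y _ _ hy.
- by move=> i; exact: ssg_ge0.
- move=> l; have [r hr] := ssg_finite l gs0.
  apply: (@sub_finite_set _ _ [set` r]); last exact: finite_seq.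
  by move=> i [si il]; exact: hr.
move=> w wy sub; split; first exact: (cr_ge0 (hlim_ssg_closed gs0) hy).
exists w => //; exists (size gs), (fun j : 'I_(size gs) => gs`_j); split.
  by move=> j; apply: gs0; exact: mem_nth.
by rewrite -ssg_span.
Qed.

Lemma hlim_common gs gs' :
  {in gs, forall g, 0 <= g} -> {in gs', forall g, 0 <= g} ->
  [/\ {in gs ++ gs', forall g, 0 <= g},
    hlim v G (ssg gs) `<=` hlim v G (ssg (gs ++ gs')) &
    hlim v G (ssg gs') `<=` hlim v G (ssg (gs ++ gs'))].
Proof.
move=> h h'; split.
- by move=> g; rewrite mem_cat => /orP[/h|/h'].
- by move=> x; apply: hlimW; apply: ssg_sub => g gg; rewrite mem_cat gg.
by move=> x; apply: hlimW; apply: ssg_sub => g gg; rewrite mem_cat gg orbT.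
Qed.

Lemma Vfg1 : Vfg v G 1.
Proof. by apply/VfgP; exists [::] => //; exact: cr1 (hlim_ssg_closed _). Qed.

Lemma VfgB x y : Vfg v G x -> Vfg v G y -> Vfg v G (x - y).
Proof.
move=> /VfgP[gs h hx] /VfgP[gs' h' hy]; apply/VfgP; exists (gs ++ gs').
  by have [] := hlim_common h h'.
have [h'' s s'] := hlim_common h h'.
by apply: (crB (hlim_ssg_closed h'')); [exact: s | exact: s'].
Qed.

Lemma VfgM x y : Vfg v G x -> Vfg v G y -> Vfg v G (x * y).
Proof.
move=> /VfgP[gs h hx] /VfgP[gs' h' hy]; apply/VfgP; exists (gs ++ gs').
  by have [] := hlim_common h h'.
have [h'' s s'] := hlim_common h h'.
by apply: (crM (hlim_ssg_closed h'')); [exact: s | exact: s'].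
Qed.

(** [Vfg] is the valuation ring of its fraction field: [a / b] is
[(a / g) / (b / g)] for the leading term [g] of [b], where both [a / g] and
[b / g] have supports in a shifted semigroup and the latter is a unit. *)
Lemma frac_Vfg_ge0 y : frac_set (Vfg v G) y -> (0 <= v y)%E -> Vfg v G y.
Proof.
move=> [a [b [/VfgP[gs h ha] /VfgP[gs' h' hb] nb ->]]] y0.
have [h'' sa sb] := hlim_common h h'; move/sa: ha => {sa} ha; move/sb: hb => {sb} hb.
have [l [g [Gg vb lt]]] := gr_lead hG nb.
have [vg ng] := gr_lead_neq0 vb lt.
have [gs1 gs10 shift] := ssg_shift l h''.
have hag : hlim v G (ssg gs1) (a / g).
  apply: (hlim_shift hG ha _ Gg shift).
  by rewrite -(divfK nb a) vfunM vb -[X in (X <= _)%E]add0e leeD2r.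
have hbg : hlim v G (ssg gs1) (b / g).
  by apply: (hlim_shift hG hb _ Gg shift); rewrite vb.
apply/VfgP; exists gs1 => //.
have -> : a / b = (a / g) * (b / g)^-1 by rewrite invf_div mulrA divfK.
apply: (crM (hlim_ssg_closed gs10)) => //.
apply: (cr_inv1 (hlim_ssg_closed gs10)) => //.
rewrite -(mulfV ng) -mulrBl vfunM (valV vg) EFinN; move: lt.
by rewrite sube_gt0.
Qed.

Lemma hom_frac_Vfg i x : G i x -> frac_set (Vfg v G) x.
Proof.
have pos j y : 0 <= j -> G j y -> frac_set (Vfg v G) y.
  move=> j0 Gy; apply: frac_setS; first exact: Vfg1.
  apply/VfgP; exists [:: j]; first by move=> g; rewrite inE => /eqP ->.
  by apply: (hlim_hom hG _ Gy); apply: ssg_gen; rewrite inE.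
have [i0|i0] := leP 0 i; first exact: pos.
move=> /(grV hG)/pos h; rewrite -[x]invrK; apply: sfV.
  by apply: subfield_frac; [exact: Vfg1 | exact: VfgB | exact: VfgM].
by apply: h; rewrite oppr_ge0 ltW.
Qed.

Lemma henselian_frac_Vfg : henselian v (frac_set (Vfg v G)).
Proof.
apply: henselian_closed_rings => // p Fp p0.
have VfgF : Vfg v G `<=` frac_set (Vfg v G).
  by move=> x; apply: frac_setS; exact: Vfg1.
suff [gs gs0 hp] : exists2 gs, {in gs, forall g, 0 <= g} &
    forall m, (m < size p)%N -> hlim v G (ssg gs) p`_m.
  exists (hlim v G (ssg gs)); split; first exact: hlim_ssg_closed.
    by move=> x hx; apply: VfgF; apply/VfgP; exists gs.
  move=> i; have [/hp//|le] := ltnP i (size p).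
  by rewrite nth_default //; exact: cr0 (hlim_ssg_closed gs0).
elim: (size p) => [|m [gs gs0 ih]]; first by exists [::].
have [gs' gs'0 hm] := (VfgP _).1 (frac_Vfg_ge0 (Fp m) (p0 m)).
have [h s s'] := hlim_common gs0 gs'0.
exists (gs ++ gs') => // i; rewrite ltnS leq_eqVlt => /orP[/eqP->|/ih].
  exact: s'.
exact: s.
Qed.

Lemma frac_Vhat x : frac_set (Vhat v) x.
Proof.
have V1 : Vhat v 1 by rewrite /Vhat /vball /= vfun1.
have [->|nz] := eqVneq x 0.
  by exists 0, 1; rewrite mul0r oner_neq0; split=> //; rewrite /Vhat /vball /= vfun0 leey.
have [a va] := val_ex v nz; have [a0|a0] := leP 0 a.
  by apply: frac_setS => //; rewrite /Vhat /vball /= va lee_fin.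
exists 1, x^-1; rewrite invr_neq0 // invrK mul1r; split=> //.
by rewrite /Vhat /vball /= (valV va) lee_fin oppr_ge0 ltW.
Qed.

Lemma base_field B : B = Vfg v G \/ B = Vhat v ->
  [/\ subfield (frac_set B), forall i x, G i x -> frac_set B x &
    henselian v (frac_set B)].
Proof.
case=> ->; split.
- by apply: subfield_frac; [exact: Vfg1 | exact: VfgB | exact: VfgM].
- exact: hom_frac_Vfg.
- exact: henselian_frac_Vfg.
- by split=> *; exact: frac_Vhat.
- by move=> *; exact: frac_Vhat.
apply: henselian_closed_rings => // p _ p0; exists (vball v 0); split=> //.
  exact: closed_ring_vball.
by move=> x _; exact: frac_Vhat.
Qed.
End FractionFields.

(** * Algebraic elements are sums of generalized homogeneous elements *)

Lemma algover_monic (E : fieldType) (S : set E) x : subfield S -> algover S x ->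
  exists2 p : {poly E}, p \is monic & polyS S p /\ root p x.
Proof.
move=> hS /(algoverP hS)/integral_algebraic[p pm px].
by exists (map_poly (sfincl hS) p); [rewrite monic_map | split=> //; exact: polyS_map].
Qed.

Lemma ex_root (E : closedFieldType) (a : E) m : (0 < m)%N -> exists h, h ^+ m = a.
Proof.
move=> m0; have /closed_rootP[h] : size ('X^m - a%:P : {poly E}) != 1%N.
  by rewrite size_XnsubC // eqSS -lt0n.
by rewrite rootE !hornerE subr_eq0 => /eqP; exists h.
Qed.

Section Algebraic.
Variables (R : realType) (K : fieldType) (v : valuation R K).
Variables (G : R -> set K) (hG : graded v G).
Variables (E : closedFieldType) (f : {rmorphism K -> E}) (w : valuation R E).
Hypothesis wf : forall x, w (f x) = v x.
Implicit Types (x y : E).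

(** The copy in [E] of the residue field of [K]. *)
Definition coef_field : set E := f @` G 0.
Local Notation L := coef_field.

Lemma subfield_G0 : subfield (G 0).
Proof.
split; [exact: (gr1 hG) | by move=> *; exact: (grB hG)|].
move=> a b Ga Gb; rewrite -(addr0 (0 : R)) -{2}oppr0.
by apply: (grM hG) => //; exact: (grV hG).
Qed.

Lemma subfield_L : subfield L.
Proof. exact: subfield_image subfield_G0. Qed.

(** The valuation is trivial on [L], hence on its algebraic closure. *)
Lemma algL_val x : algover L x -> x != 0 -> w x = 0%E.
Proof.
have ge0 y : algover L y -> (0 <= w y)%E.
  move=> /(algover_monic subfield_L)[p pm [Lp py]].
  apply: (val_root_ge0 pm _ py) => i; have [c Gc <-] := Lp i.
  by rewrite wf; exact: gr_ge Gc.
move=> Lx nz; have [a wa] := val_ex w nz.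
have := ge0 _ Lx; have := ge0 _ (algoverV subfield_L Lx).
rewrite (valV wa) wa !lee_fin oppr_ge0 => a0 a0'.
by congr EFin; apply/eqP; rewrite eq_le a0.
Qed.

Lemma algL_eq x y : algover L x -> algover L y -> (0 < w (x - y)%R)%E -> x = y.
Proof.
move=> Lx Ly lt; apply/eqP; rewrite -subr_eq0; apply: contraTT lt => nz.
by rewrite algL_val ?ltxx //; exact: (algoverB subfield_L).
Qed.

(** Normalize an equation of [x] so that its coefficients have smallest value 0,
and replace them by their residues in [G 0]: the resulting polynomial [q] over [L]
takes a value of positive valuation at [x], so that [x] is close to a root. *)
Lemma alg_residue x : algover (range f) x -> w x = 0%E ->
  exists2 c, algover L c & (0 < w (x - c)%R)%E.
Proof.
move=> [p0 [nz_p0 Kp0 p0x]] wx.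
have [p pE] : exists p, map_poly f p = p0.
  have [|p _ pE] := @polyS_image _ _ f setT p0 _ Logic.I; last by exists p.
  by move=> i; have [a _ <-] := Kp0 i; exists a.
have nz_p : p != 0 by rewrite -(map_poly_eq0 f) pE.
have [b [nb bge b1]] : exists b : K, [/\ b != 0, forall m, (0 <= v (b * p`_m)%R)%E &
    exists m, v (b * p`_m) = 0%E].
  have i1 : ((size p).-1 < size p)%N by rewrite prednK // size_poly_gt0.
  pose i0 := [arg min_(i < Ordinal i1) v p`_i]%O.
  have mini (i : 'I_(size p)) : (v p`_i0 <= v p`_i)%E.
    by rewrite /i0; case: Order.TotalTheory.arg_minP => // j _ h; exact: h.
  have nz : p`_i0 != 0.
    apply/eqP => e; have := mini (Ordinal i1); rewrite e vfun0 leye_eq /= => /eqP.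
    by have [a ->] : exists a, v p`_(size p).-1 = a%:E by apply: val_ex; rewrite lead_coef_eq0.
  have [a va] := val_ex v nz.
  exists (p`_i0)^-1; rewrite invr_neq0 //; split=> //; last first.
    by exists i0; rewrite mulVf // vfun1.
  move=> i; have [lt|le] := ltnP i (size p); last first.
    by rewrite (nth_default 0 le) mulr0 vfun0 leey.
  have := mini (Ordinal lt); rewrite /= va vfunM (valV va) => h.
  by rewrite addeC EFinN sube_ge0.
have lead (i : nat) : exists2 c, G 0 c & (0 < v (b * p`_i - c)%R)%E.
  have := bge i; rewrite le_eqVlt => /orP[/eqP e|lt]; last first.
    by exists 0; [exact: (gr0 hG) | rewrite subr0].
  have nz : b * p`_i != 0 by apply: (@val_fin_neq0 _ _ v _ 0).
  have [j [g [Gg vj lt]]] := gr_lead hG nz.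
  by move: Gg lt; rewrite -e in vj; case: vj => <- Gg lt; exists g.
pose c (i : nat) := s2val (cid2 (lead i)).
have Gc i : G 0 (c i) by rewrite /c; case: cid2.
have cP i : (0 < v (b * p`_i - c i)%R)%E by rewrite /c; case: cid2.
pose q := \poly_(m < size p) c m.
have Lq : polyS L (map_poly f q).
  move=> i; rewrite coef_map; exists q`_i => //; rewrite coef_poly.
  by case: ifP => // _; exact: (gr0 hG).
have nz_q : map_poly f q != 0.
  rewrite map_poly_eq0; apply/eqP => q0; have [i vi] := b1.
  have ci : c i = 0.
    have := congr1 (fun s : {poly K} => s`_i) q0; rewrite coef_poly coef0.
    case: ltnP => // le _; move: vi.
    by rewrite (nth_default 0 le) mulr0 vfun0.
  by have := cP i; rewrite ci subr0 vi ltxx.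
have qx : (0 < w (map_poly f q).[x])%E.
  have -> : (map_poly f q).[x] = - (map_poly f (b *: p - q)).[x].
    rewrite rmorphB /= map_polyZ hornerD hornerN hornerZ pE.
    by move/rootP: p0x => ->; rewrite mulr0 sub0r opprK.
  rewrite vfunN horner_coef; apply: val_lt_sum => i _.
  rewrite mulrC; apply: val_gt0M; first by apply: val_ge0X; rewrite wx.
  rewrite coef_map wf coefB coefZ coef_poly; case: ltnP => // le.
  by rewrite (nth_default 0 le) mulr0 subr0 vfun0 ltry.
have [rs rsE] := closed_field_poly_normal (map_poly f q).
have nz_l : lead_coef (map_poly f q) != 0 by rewrite lead_coef_eq0.
have Lrs r : r \in rs -> algover L r.
  move=> rrs; exists (map_poly f q); split=> //.
  by rewrite rsE rootZ // root_prod_XsubC.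
have [/hasP[r rrs lt]|/hasPn h] := boolP (has (fun r => 0 < w (x - r)%R)%E rs).
  by exists r => //; exact: Lrs.
have w0 r : r \in rs -> w (x - r) = 0%E.
  move=> rrs; apply/eqP; rewrite eq_le leNgt h //=.
  apply: val_le_sub; rewrite ?wx //.
  by have [->|nz] := eqVneq r 0; [rewrite vfun0 leey | rewrite algL_val //; exact: Lrs].
suff : w (map_poly f q).[x] = 0%E by move=> e; rewrite e ltxx in qx.
rewrite rsE hornerZ vfunM algL_val //; last first.
  by apply: (algover_id subfield_L); exact: Lq.
rewrite add0e horner_prod big_seq (@val_prod _ _ w _ _ _ _ (fun=> 0)) ?big1 //.
by move=> r rrs; rewrite !hornerE w0.
Qed.

(** Two terms of an equation of [x] have the same smallest value. *)
Lemma alg_value x : algover (range f) x -> x != 0 ->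
  exists m i g e, [/\ (0 < m)%N, G i g, g != 0, w x = e%:E & e *+ m = i].
Proof.
move=> [p [nz_p Kp /rootP px]] nz_x; have [e we] := val_ex w nz_x.
pose t (i : nat) := p`_i * x ^+ i.
have i1 : ((size p).-1 < size p)%N by rewrite prednK // size_poly_gt0.
pose i0 := [arg min_(i < Ordinal i1) w (t i)]%O.
have mini (i : 'I_(size p)) : (w (t i0) <= w (t i))%E.
  by rewrite /i0; case: Order.TotalTheory.arg_minP => // j _ h; exact: h.
have nz_t : t i0 != 0.
  apply/eqP => t0; have := mini (Ordinal i1); rewrite t0 vfun0 leye_eq /= => /eqP.
  have [|a -> //] := @val_ex _ _ w (t (size p).-1).
  by rewrite mulf_neq0 ?expf_neq0 // lead_coef_eq0.
have [a wa] := val_ex w nz_t.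
have [j nji wj] : exists2 j : 'I_(size p), j != i0 & w (t j) = a%:E.
  apply: contrapT => h.
  have : (a%:E < w (\sum_(j < size p | j != i0) t j)%R)%E.
    apply: val_lt_sum => j nj; rewrite lt_neqAle -wa mini andbT.
    by apply/eqP => wj; apply: h; exists j; rewrite // -wa.
  have -> : \sum_(j < size p | j != i0) t j = - t i0.
    move: px; rewrite horner_coef (bigD1 i0) //= addrC => /eqP.
    by rewrite addr_eq0 => /eqP.
  by rewrite vfunN wa ltxx.
have nz_tj : t j != 0 by apply: val_fin_neq0 wj.
have val (i i' : 'I_(size p)) : (i < i')%N -> w (t i) = a%:E -> w (t i') = a%:E ->
  exists m i g e, [/\ (0 < m)%N, G i g, g != 0, w x = e%:E & e *+ m = i].
  move=> lt wi wi'.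
  have nz_p1 : p`_i != 0.
    by have := val_fin_neq0 wi; rewrite /t mulf_eq0 negb_or => /andP[].
  have nz_p2 : p`_i' != 0.
    by have := val_fin_neq0 wi'; rewrite /t mulf_eq0 negb_or => /andP[].
  have [c1 _ c1E] := Kp i; have [c2 _ c2E] := Kp i'.
  have [a1 w1] := val_ex w nz_p1; have [a2 w2] := val_ex w nz_p2.
  have nz_c : c1 / c2 != 0.
    by rewrite -(fmorph_eq0 f) fmorph_div c1E c2E mulf_neq0 ?invr_neq0.
  have [l [g [Gg vl lt']]] := gr_lead hG nz_c.
  have [_ ng] := gr_lead_neq0 vl lt'.
  exists (i' - i)%N, l, g, e; rewrite subn_gt0; split=> //.
  move: wi wi'; rewrite /t (valM w1 (valX i we)) (valM w2 (valX i' we)) => -[e1] [e2].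
  move: vl; rewrite -wf fmorph_div c1E c2E (valM w1 (valV w2)) => -[<-].
  rewrite mulrnBr ?(ltnW lt) //.
  by rewrite -[e *+ i'](addKr a2) e2 -[e *+ i](addKr a1) e1; ring.
have ne : (i0 : nat) != j by rewrite eq_sym.
by case: (ltngtP i0 j) ne => // lt _; [exact: val lt wa wj | exact: val lt wj wa].
Qed.
End Algebraic.

Section Puiseux.
Variables (R : realType) (K : fieldType) (v : valuation R K).
Variables (G : R -> set K) (hG : graded v G).
Variables (E : closedFieldType) (f : {rmorphism K -> E}) (w : valuation R E).
Hypothesis wf : forall x, w (f x) = v x.
Hypothesis w_nat : forall n, (0 < n)%N -> w n%:R = 0%E.
Hypothesis Gpos : exists i g, [/\ 0 < i, G i g & g != 0].
Variables (F : set E) (hF : subfield F) (hens : henselian w F).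
Hypothesis GF : forall i g, G i g -> F (f g).
Hypothesis FK : F `<=` range f.
Local Notation L := (coef_field G f).

Let hL := subfield_L hG f.

Lemma coef_field_sub : L `<=` F.
Proof. by move=> _ [g Gg <-]; exact: GF Gg. Qed.

(** These elements are the monomials of Puiseux expansions: products of an element
algebraic over the residue field by a monomial with rational exponents. *)
Definition rhom (h : E) :=
  exists m i g l, [/\ (0 < m)%N, G i g, g != 0, (algover L l /\ l != 0) &
    h ^+ m = l * f g].

Lemma rhom_neq0 h : rhom h -> h != 0.
Proof.
move=> [m [i [g [l [m0 _ ng [_ nl] e]]]]]; apply: contraTneq isT => h0.
move: e; rewrite h0 expr0n eqn0Ngt m0 => /esym/eqP.
by rewrite mulf_eq0 fmorph_eq0 (negbTE nl) (negbTE ng).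
Qed.

Lemma rhomM h h' : rhom h -> rhom h' -> rhom (h * h').
Proof.
move=> [m [i [g [l [m0 Gg ng [Ll nl] e]]]]] [m' [i' [g' [l' [m'0 Gg' ng' [Ll' nl'] e']]]]].
exists (m * m')%N, (i *+ m' + i' *+ m), (g ^+ m' * g' ^+ m), (l ^+ m' * l' ^+ m).
split.
- by rewrite muln_gt0 m0.
- by apply: (grM hG); exact: (grX hG).
- by rewrite mulf_neq0 ?expf_neq0.
- split; last by rewrite mulf_neq0 ?expf_neq0.
  by apply: (algoverM hL); exact: (sfX (subfield_algover hL)).
by rewrite exprMn exprM e mulnC exprM e' rmorphM !rmorphXn !exprMn; ring.
Qed.

Lemma rhom_alg l : algover L l -> l != 0 -> rhom l.
Proof.
move=> Ll nl; exists 1%N, 0, 1, l; rewrite oner_neq0 rmorph1 mulr1.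
by split=> //; exact: (gr1 hG).
Qed.

Lemma rhom_hom i g : G i g -> g != 0 -> rhom (f g).
Proof.
move=> Gg ng; exists 1%N, i, g, 1; rewrite mul1r oner_neq0; split=> //.
by split=> //; exact: (algover_id hL (sf1 hL)).
Qed.

Lemma rhom_algover h : rhom h -> algover F h.
Proof.
move=> [m [i [g [l [m0 Gg ng [Ll nl] e]]]]].
have Fc : algover F (l * f g).
  apply: (algoverM hF); first exact: algoverS coef_field_sub Ll.
  by apply: (algover_id hF); exact: GF Gg.
apply: (algover_root hF (p := 'X^m - (l * f g)%:P)).
- by rewrite -size_poly_eq0 size_XnsubC.
- move=> j; rewrite coefB coefXn coefC; apply: (algoverB hF).
    by apply: (algover_id hF); exact: sf_nat.
  by case: ifP => // _; apply: (algover_id hF); exact: sf0.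
by rewrite rootE !hornerE e subrr.
Qed.

Inductive rhom_span : set E :=
| Rspan0 : rhom_span 0
| RspanD a h y : F a -> rhom h -> rhom_span y -> rhom_span (a * h + y).

Lemma rhom_spanD x y : rhom_span x -> rhom_span y -> rhom_span (x + y).
Proof.
move=> hx hy; elim: hx => [|a h {}x Fa hh _ ih]; first by rewrite add0r.
by rewrite -addrA; exact: RspanD.
Qed.

Lemma rhom_spanZ a h y : F a -> rhom h -> rhom_span y -> rhom_span (a * h * y).
Proof.
move=> Fa hh; elim=> [|b h' {}y Fb hh' _ ih]; first by rewrite mulr0; exact: Rspan0.
rewrite mulrDr mulrACA; apply: RspanD => //; first exact: (sfM hF).
exact: rhomM.
Qed.

Lemma rhom_spanM x y : rhom_span x -> rhom_span y -> rhom_span (x * y).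
Proof.
move=> hx hy; elim: hx => [|a h {}x Fa hh _ ih]; first by rewrite mul0r; exact: Rspan0.
by rewrite mulrDl; apply: rhom_spanD => //; exact: rhom_spanZ.
Qed.

Lemma rhom_span1 h : rhom h -> rhom_span h.
Proof.
move=> hh; rewrite -[h]mul1r -[_ * h]addr0; apply: RspanD => //.
  exact: sf1.
exact: Rspan0.
Qed.

Lemma rhom_spanF a : F a -> rhom_span a.
Proof.
move=> Fa; rewrite -[a]mulr1 -[_ * _]addr0; apply: RspanD => //; last exact: Rspan0.
by apply: rhom_alg; [exact: (algover_id hL (sf1 hL)) | exact: oner_neq0].
Qed.

Lemma rhom_span_algover x : rhom_span x -> algover F x.
Proof.
elim=> [|a h y Fa hh _ ih]; first by apply: (algover_id hF); exact: sf0.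
apply: (algoverD hF) => //; apply: (algoverM hF); first exact: algover_id.
exact: rhom_algover.
Qed.

Lemma subfield_rhom_span : subfield rhom_span.
Proof.
apply: (subfield_alg_ring hF).
- exact: rhom_spanF.
- move=> x y hx hy; apply: rhom_spanD => //; rewrite -mulN1r.
  apply: rhom_spanM => //; apply: rhom_spanF; apply: (sfN hF); exact: sf1.
- exact: rhom_spanM.
exact: rhom_span_algover.
Qed.

Lemma rhom_value x : algover F x -> x != 0 -> exists2 h, rhom h & w h = w x.
Proof.
move=> Fx nz; have [m [i [g [e [m0 Gg ng we em]]]]] :=
  alg_value hG wf (algoverS FK Fx) nz.
have [h hE] := ex_root (f g) m0.
have rh : rhom h.
  exists m, i, g, 1; rewrite mul1r oner_neq0; split=> //; split=> //.
  exact: (algover_id hL (sf1 hL)).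
exists h => //; have [e' we'] := val_ex w (rhom_neq0 rh).
rewrite we we'; congr EFin.
have := valX m we'; rewrite hE wf (gr_val hG Gg ng) -em => -[/esym/eqP].
by rewrite -subr_eq0 -mulrnBl mulrn_eq0 eqn0Ngt m0 subr_eq0 => /eqP.
Qed.

(** Puiseux's theorem. Otherwise one could subtract from [x] the mean [t] of its
conjugates over the span and divide by some [h], to get an element of value 0 whose
conjugates have sum 0. By henselianity all of them have the same residue [c], so
that their sum is congruent to a nonzero multiple of [c]. *)
Lemma algover_rhom_span x : algover F x -> rhom_span x.
Proof.
move=> Fx; have hS := subfield_rhom_span; set S := rhom_span in hS *.
have FS : F `<=` S by exact: rhom_spanF.
have [rs [xrs rsS rsq]] := conjugates hS (algoverS FS Fx).
have [t St sum0] := conjugates_mean hS (val_nat_char w_nat) xrs rsS.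
have [e|nz] := eqVneq (x - t) 0.
  by have /eqP := e; rewrite subr_eq0 => /eqP ->.
have Fxt : algover F (x - t).
  by apply: (algoverB hF) => //; exact: rhom_span_algover.
have [h rh wh] := rhom_value Fxt nz.
have nh := rhom_neq0 rh.
have [e we] := val_ex w nz.
have Fxth : algover F ((x - t) / h).
  by apply: (algoverM hF) => //; apply: (algoverV hF); exact: rhom_algover.
have w0 : w ((x - t) / h) = 0%E.
  by rewrite we in wh; rewrite (valM we (valV wh)) subrr.
have [c Lc wc] := alg_residue hG wf (algoverS FK Fxth) w0.
have wc0 : w c = 0%E by rewrite -w0; apply: val_close; rewrite valB w0.
have nc := val_fin_neq0 wc0.
have Sc : S c by apply/rhom_span1/rhom_alg.
have Fc : algover F c by exact: algoverS coef_field_sub Lc.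
have [i [g [i0 Gg ng]]] := Gpos.
have wg : w (f g) = i%:E by rewrite wf (gr_val hG Gg ng).
have conj r : r \in rs -> w ((r - t) / h - c) = w ((x - t) / h - c).
  move=> rrs; apply: (conjugate_val hF hens w_nat (GF Gg) wg i0).
    exact: (algoverB hF).
  move=> q Fq qx.
  have qE y : q.[(y - t) / h - c] = (q \Po (h^-1 *: ('X - t%:P) - c%:P)).[y].
    by rewrite horner_comp !hornerE mulrC.
  rewrite rootE qE; apply: rsq rrs; last by rewrite rootE -qE.
  apply/(polySP hS)/polyOver_comp; apply/(polySP hS); first by move=> j; exact: FS.
  apply/(polySP hS); rewrite rpredB ?polyOverZ ?rpredB ?polyOverX ?polyOverC //.
  - by apply/(sfpredP hS)/(sfV hS)/rhom_span1.
  - by apply/(sfpredP hS).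
  by apply/(sfpredP hS).
have rs0 : (0 < size rs)%N by case: (rs) xrs.
have : \sum_(r <- rs) ((r - t) / h - c) = - (c * (size rs)%:R).
  rewrite sumrB -mulr_suml sum0 mul0r sub0r big_const_seq count_predT.
  by rewrite iter_addr_0 -[c *+ _]mulr_natr.
move=> sE; have : (0%:E < w (- (c * (size rs)%:R))%R)%E.
  by rewrite -sE big_seq; apply: val_lt_sum => r rrs; rewrite conj.
by rewrite vfunN vfunM wc0 w_nat // adde0 ltxx.
Qed.
End Puiseux.

(** * Minimal polynomials of generalized homogeneous elements *)

Lemma coef_comp_scale (K : fieldType) (a : K) (p : {poly K}) k :
  (p \Po (a *: 'X))`_k = a ^+ k * p`_k.
Proof.
rewrite comp_polyE coef_sum; have [lt|le] := ltnP k (size p).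
  rewrite (bigD1 (Ordinal lt)) //= big1 ?addr0.
    by rewrite exprZn !coefZ coefXn eqxx mulr1 mulrC.
  by move=> i ne; rewrite exprZn !coefZ coefXn (negbTE (_ : k != i)) ?mulr0 // eq_sym.
rewrite [p`_k]nth_default // mulr0 big1 // => i _.
by rewrite exprZn !coefZ coefXn gtn_eqF ?mulr0 // (leq_trans (ltn_ord i)).
Qed.

Section Homogeneous.
Variables (R : realType) (K : fieldType) (v : valuation R K).
Variables (G : R -> set K) (hG : graded v G).
Variables (E : closedFieldType) (f : {rmorphism K -> E}) (w : valuation R E).
Hypothesis wf : forall x, w (f x) = v x.
Local Notation L := (coef_field G f).

Let hL := subfield_L hG f.

Lemma algL_root m y : (0 < m)%N -> algover L (y ^+ m) -> algover L y.
Proof.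
move=> m0 h; apply: (algover_root hL (p := 'X^m - (y ^+ m)%:P)).
- by rewrite -size_poly_eq0 size_XnsubC.
- move=> j; rewrite coefB coefXn coefC; apply: (algoverB hL).
    by apply: (algover_id hL); exact: sf_nat.
  by case: ifP => // _; apply: (algover_id hL); exact: sf0.
by rewrite rootE !hornerE subrr.
Qed.

Lemma algL_hom x : G 0 x -> algover L (f x).
Proof. by move=> Gx; apply: (algover_id hL); exists x. Qed.

Section Element.
Variables (gam : E) (d : R) (p : {poly K}).
Hypotheses (rgam : rhom G f gam) (wgam : w gam = d%:E).
Hypothesis hp : is_minpoly f p gam.

Let nz_gam : gam != 0 := val_fin_neq0 wgam.

Lemma minpoly_monic : p \is monic. Proof. by case: hp. Qed.

Lemma minpoly_root : root (map_poly f p) gam.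
Proof. by case: hp => _ ->. Qed.

(** A power [gam ^+ m] is [l * f g] with [l] algebraic over [L]: substituting
['X^m / f g] in an equation of [l] gives an equation of [gam] over [K], hence
of [r]. *)
Lemma conj_ratio r : root (map_poly f p) r -> algover L (r / gam).
Proof.
move=> pr; have [m [i [g [l [m0 Gg ng [Ll nl] e]]]]] := rgam.
have nfg : f g != 0 by rewrite fmorph_eq0.
have [A [nA LA Al]] := Ll.
have [q Gq qA] := polyS_image LA (gr0 hG 0).
have Aconj : root A (r ^+ m / f g).
  have qE y : (map_poly f (q \Po (g^-1 *: 'X^m))).[y] = A.[y ^+ m / f g].
    rewrite map_comp_poly horner_comp qA linearZ /= map_polyXn.
    by rewrite hornerZ hornerXn fmorphV mulrC.
  have : p %| q \Po (g^-1 *: 'X^m).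
    by rewrite -hp.2 rootE qE e mulfK.
  by case/dvdpP => q1 q1E; rewrite rootE -qE q1E rmorphM hornerM (rootP pr) mulr0.
apply: (algL_root m0); rewrite expr_div_n e invfM mulrCA.
apply: (algoverM hL); first exact: (algoverV hL).
by exists A.
Qed.

Lemma minpoly_coef j : (0 < j < size p)%N ->
  exists2 c, algover L c & f p`_((size p).-1 - j) = gam ^+ j * c.
Proof.
move=> /andP[j0 jp]; have [rs rsE] := closed_field_poly_normal (map_poly f p).
have fpm : map_poly f p \is monic by rewrite monic_map // minpoly_monic.
move: rsE; rewrite (monicP fpm) scale1r => rsE.
have sp : (size p).-1 = size rs.
  by rewrite -(size_map_poly f) rsE size_prod_XsubC.
pose q := \prod_(r <- rs) ('X - (r / gam)%:P).
have Lq k : algover L q`_k.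
  have hA := subfield_algover hL.
  suff /polyOverP/(_ k)/(sfpredP hA) : q \is a polyOver (sfpred hA) by [].
  rewrite /q big_seq; apply: rpred_prod => r rrs.
  rewrite rpredB ?polyOverX // polyOverC; apply/(sfpredP hA)/conj_ratio.
  by rewrite rsE root_prod_XsubC.
have pE : map_poly f p = gam ^+ size rs *: (q \Po (gam^-1 *: 'X)).
  rewrite rsE /q; elim: (rs) => [|r s ih].
    by rewrite !big_nil expr0 scale1r -polyC1 comp_polyC.
  rewrite !big_cons ih comp_polyM comp_polyB comp_polyX comp_polyC exprSr -scalerA.
  rewrite -scalerAr; congr (_ *: _); rewrite scalerAl; congr (_ * _).
  by rewrite scalerBr scalerA mulfV // scale1r -mul_polyC -polyCM mulrC divfK.
exists q`_((size p).-1 - j); first exact: Lq.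
rewrite -coef_map pE coefZ coef_comp_scale mulrA; congr (_ * _).
have le : (j <= size rs)%N by rewrite -sp -ltnS prednK // (leq_trans _ jp).
by rewrite sp exprVn -{1}(subnK le) exprD mulrAC mulfV ?mul1r // expf_neq0.
Qed.

(** The coefficient [y] is [gam ^+ j * c] with [c] algebraic over [L]. As a power of
[gam] is homogeneous up to a factor algebraic over [L], the quotient of [y] by its
leading term [g] is algebraic over [L]; being congruent to 1, it is 1. *)
Lemma minpoly_homogeneous j : (0 < j < size p)%N ->
  G (d *+ j) p`_((size p).-1 - j).
Proof.
move=> hj; have [c Lc] := minpoly_coef hj; set y := p`_ _ => yE.
have [->|nz] := eqVneq y 0; first exact: (gr0 hG).
have nc : c != 0.
  by apply: contraNneq nz => c0; rewrite -(fmorph_eq0 f) yE c0 mulr0.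
have vy : v y = (d *+ j)%:E.
  by rewrite -wf yE vfunM (valX j wgam) (algL_val hG wf Lc nc) adde0.
have [i [g [Gg vi lt]]] := gr_lead hG nz.
have [vg ng] := gr_lead_neq0 vi lt.
move: vy; rewrite vi => -[<-]; suff -> : y = g by [].
have [m [i' [g' [l [m0 Gg' ng' [Ll nl] e]]]]] := rgam.
have i'E : i' = d *+ m.
  apply/eqP; rewrite eq_sym -(inj_eq (@EFin_inj _)) -(valX m wgam) e vfunM wf.
  by rewrite (algL_val hG wf Ll nl) (gr_val hG Gg' ng') add0e.
have iE : i = d *+ j by move: vi; rewrite -wf yE vfunM (valX j wgam) (algL_val hG wf Lc nc) adde0 => -[].
have Lyg : algover L (f (y / g)).
  apply: (algL_root m0); rewrite fmorph_div expr_div_n yE exprMn exprAC e exprMn.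
  have -> : l ^+ j * f g' ^+ j * c ^+ m / f g ^+ m =
      (l ^+ j * c ^+ m) * f (g' ^+ j / g ^+ m).
    by rewrite fmorph_div !rmorphXn; ring.
  apply: (algoverM hL).
    by apply: (algoverM hL); exact: (sfX (subfield_algover hL)).
  apply: algL_hom; have -> : 0 = i' *+ j + - (i *+ m).
    by rewrite i'E iE -!mulrnA mulnC subrr.
  by apply: (grM hG); [exact: (grX hG) | apply: (grV hG); exact: (grX hG)].
have L1 : algover L 1 by exact: (algover_id hL (sf1 hL)).
have : f (y / g) = 1.
  apply: (algL_eq hG wf Lyg L1); rewrite -(rmorph1 f) -rmorphB wf.
  rewrite -(mulfV ng) -mulrBl vfunM (valV vg) EFinN sube_gt0 //.
by rewrite -(rmorph1 f) => /fmorph_inj e1; rewrite -[y](divfK ng) e1 mul1r.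
Qed.

Hypothesis d0 : 0 <= d.

Lemma minpoly_integral : Vhat_poly v p.
Proof.
move=> k; rewrite /Vhat /vball /=; have [lt|le] := ltnP k (size p); last first.
  by rewrite nth_default // vfun0 leey.
have sp0 : (0 < size p)%N by apply: leq_ltn_trans lt.
have [->|ne] := eqVneq k (size p).-1.
  by have := monicP minpoly_monic; rewrite lead_coefE => ->; rewrite vfun1.
have lt' : (k < (size p).-1)%N by rewrite ltn_neqAle ne -ltnS prednK.
have kE : k = ((size p).-1 - ((size p).-1 - k))%N by rewrite subKn // ltnW.
rewrite kE; have /gr_ge : G (d *+ ((size p).-1 - k)) p`_((size p).-1 - ((size p).-1 - k)).
  by apply: minpoly_homogeneous; rewrite subn_gt0 lt' /= (leq_ltn_trans (leq_subr _ _)) // prednK.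
by move=> /(_ v hG); apply: le_trans; rewrite lee_fin mulrn_wge0.
Qed.

Lemma minpoly_irreducible : irreducible_in (Vhat_poly v) p.
Proof.
have nz_p := monic_neq0 minpoly_monic.
have Vlead a : Vhat_poly v a -> Vhat_poly v (lead_coef a)%:P.
  move=> Va k; rewrite coefC; case: ifP => _; first exact: Va.
  by rewrite /Vhat /vball /= vfun0 leey.
have fac a b : Vhat_poly v a -> Vhat_poly v b -> p = a * b ->
    root (map_poly f a) gam -> unit_in (Vhat_poly v) b.
  move=> Va Vb pE; rewrite hp.2 => /dvdpP[c ac].
  have cb1 : c * b = 1.
    by apply: (mulfI nz_p); rewrite mulr1 [RHS]pE ac; ring.
  have nb : b != 0 by apply: contraTneq isT => b0; move: nz_p; rewrite pE b0 mulr0 eqxx.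
  have nc : c != 0 by apply: contraTneq isT => c0; have /eqP := cb1; rewrite c0 mul0r eq_sym oner_eq0.
  have sb : (size b <= 1)%N.
    have := congr1 (fun q : {poly K} => size q) cb1; rewrite size_mul // size_poly1.
    by move: nc; rewrite -size_poly_gt0; case: (size c) => // s _; rewrite addSn => /= e;
      have := leq_addl s (size b); rewrite e.
  split=> //; exists (lead_coef a)%:P; first exact: Vlead.
  have bE := size1_polyC sb.
  have lb : lead_coef b = b`_0 by rewrite {1}bE lead_coefC.
  rewrite {1}bE -polyCM; have := monicP minpoly_monic.
  rewrite pE lead_coefM lb mulrC => ->.
  by rewrite polyC1.
split=> //; first exact: minpoly_integral.
  move=> [_ [b _ pb]]; have sp1 : (size p <= 1)%N.
    have nb : b != 0.
      by apply: contraTneq isT => b0; have /eqP := pb; rewrite b0 mulr0 eq_sym oner_eq0.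
    have := congr1 (fun q : {poly K} => size q) pb; rewrite size_mul // size_poly1.
    move: nb; rewrite -size_poly_gt0; case: (size b) => // s _; rewrite addnS => /= e.
    by have := leq_addr s (size p); rewrite e.
  have := minpoly_root; rewrite (size1_polyC sp1) map_polyC /= rootC fmorph_eq0.
  by move=> /eqP p0; move: nz_p; rewrite (size1_polyC sp1) p0 eqxx.
move=> a b Va Vb pE; have := minpoly_root; rewrite pE rmorphM rootM.
case/orP => [ra|rb]; [right; exact: (fac a b) | left; apply: (fac b a) => //].
by rewrite mulrC.
Qed.
End Element.
End Homogeneous.

(** * Integral homogeneous elements *)

Section Scaling.
Variables (K : fieldType) (E : closedFieldType) (f : {rmorphism K -> E}).
Implicit Types (b : K) (p q : {poly K}) (x : E).

Lemma minpoly_ex x : algover (range f) x -> exists p, is_minpoly f p x.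
Proof.
have fK : subfield (range f).
  by apply: subfield_image; split.
move=> /(min_polynomial fK)[rs [xrs Srs rsq]].
have [p _ pE] := polyS_image Srs (Logic.I : setT 0).
exists p; split.
  by rewrite -(map_monic f) pE monic_prod_XsubC.
move=> q; apply/idP/idP.
  move=> qx; rewrite -(dvdp_map f) pE; apply: rsq => // i.
  by rewrite coef_map; exists q`_i.
by case/dvdpP => q1 ->; rewrite rmorphM /= rootM pE root_prod_XsubC xrs orbT.
Qed.

(** The polynomial whose roots are those of [p] multiplied by [b]. *)
Definition scale_poly (b : K) (p : {poly K}) : {poly K} :=
  b ^+ (size p).-1 *: (p \Po (b^-1 *: 'X)).

Lemma size_scaleX (b : K) : b != 0 -> size (b *: 'X : {poly K}) = 2%N.
Proof. by move=> nb; rewrite size_scale // size_polyX. Qed.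

Lemma size_scale_poly b p : b != 0 -> size (scale_poly b p) = size p.
Proof.
move=> nb; rewrite size_scale ?expf_neq0 // size_comp_poly2 //.
by rewrite size_scaleX ?invr_neq0.
Qed.

Lemma coef_scale_poly b p j : b != 0 -> (j < size p)%N ->
  (scale_poly b p)`_((size p).-1 - j) = b ^+ j * p`_((size p).-1 - j).
Proof.
move=> nb jp; rewrite coefZ coef_comp_scale mulrA; congr (_ * _).
have le : (j <= (size p).-1)%N by rewrite -ltnS prednK // (leq_ltn_trans _ jp).
by rewrite exprVn -{1}(subnK le) exprD mulrAC mulfV ?mul1r // expf_neq0.
Qed.

Lemma comp_scaleK (b : K) (q : {poly K}) : b != 0 ->
  (q \Po (b *: 'X)) \Po (b^-1 *: 'X) = q.
Proof.
move=> nb; apply/polyP => k; rewrite !coef_comp_scale mulrA -exprMn.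
by rewrite mulVf // expr1n mul1r.
Qed.

Lemma minpoly_scale b p x : b != 0 -> is_minpoly f p x ->
  is_minpoly f (scale_poly b p) (f b * x).
Proof.
move=> nb [pm hp]; split.
  have := coef_scale_poly nb (j := 0%N) (p := p); rewrite size_poly_gt0 monic_neq0 //.
  rewrite subn0 expr0 mul1r => /(_ isT) e.
  by rewrite monicE lead_coefE size_scale_poly // e -lead_coefE (monicP pm).
move=> q; have -> : root (map_poly f q) (f b * x) = root (map_poly f (q \Po (b *: 'X))) x.
  rewrite map_comp_poly /root horner_comp map_polyZ map_polyX hornerZ hornerX.
  by [].
rewrite hp /scale_poly dvdpZl ?expf_neq0 //; apply/idP/idP => h.
  by rewrite -(comp_scaleK q nb); apply: dvdp_comp_poly.
have := dvdp_comp_poly (b *: 'X) h; rewrite -{1}[b]invrK comp_scaleK ?invr_neq0 //.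
Qed.
End Scaling.

Lemma val_powB (R : realType) (K : fieldType) (v : valuation R K) x y n :
  (v x < v (x - y)%R)%E -> (0 < n)%N -> (v (x ^+ n)%R < v (x ^+ n - y ^+ n)%R)%E.
Proof.
move=> lt n0; have nx := val_ltoo lt; have [a va] := val_ex v nx.
have vy : v y = a%:E by rewrite -va; apply: val_close; rewrite valB.
rewrite (valX n va); case: n n0 => // n _; elim: n => [|n ih]; first by rewrite !expr1 -va.
have -> : x ^+ n.+2 - y ^+ n.+2 = x * (x ^+ n.+1 - y ^+ n.+1) + (x - y) * y ^+ n.+1.
  by rewrite !exprS; ring.
rewrite mulrS EFinD; apply: val_lt_add; rewrite vfunM.
  by rewrite va; apply: lee_ltD.
by rewrite (valX n.+1 vy); apply: lte_leD => //; rewrite -va.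
Qed.

Section Integral.
Variables (R : realType) (K : fieldType) (v : valuation R K).
Variables (G : R -> set K) (hG : graded v G).
Variables (E : closedFieldType) (f : {rmorphism K -> E}) (w : valuation R E).
Hypothesis wf : forall x, w (f x) = v x.
Variable A : set K.
Hypotheses (A0 : A 0) (A1 : A 1) (AM : forall x y, A x -> A y -> A (x * y)).
Hypothesis Apos : exists x r, [/\ A x, 0 < r & v x = r%:E].
Hypothesis Aappr : forall y, y != 0 ->
  exists a b, [/\ A a, A b, b != 0 & (v y < v (y - a / b)%R)%E].

Lemma AX x n : A x -> A (x ^+ n).
Proof. by move=> Ax; elim: n => [|n ih]; rewrite ?expr0 ?exprS //; apply: AM. Qed.

Lemma common_denominator (s : nat -> K) m : exists b, [/\ A b, b != 0 &
  forall k, (k < m)%N -> s k != 0 -> exists2 x, A x & (v (b * s k)%R < v (b * s k - x)%R)%E].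
Proof.
elim: m => [|m [b [Ab nb hb]]]; first by exists 1; rewrite oner_neq0.
have mulP (c y x : K) : c != 0 -> (v y < v (y - x)%R)%E ->
    (v (c * y)%R < v (c * y - c * x)%R)%E.
  by move=> nc; rewrite -mulrBr !vfunM; have [e ->] := val_ex v nc; rewrite lteD2lE.
have [sm0|nsm] := eqVneq (s m) 0.
  exists b; split=> // k; rewrite ltnS leq_eqVlt => /orP[/eqP->|/hb//].
  by rewrite sm0 eqxx.
have [a [c [Aa Ac nc lt]]] := Aappr nsm.
exists (c * b); rewrite mulf_neq0 //; split=> //; first exact: AM.
move=> k; rewrite ltnS leq_eqVlt => /orP[/eqP-> _|/hb h /h[x Ax hx]].
  exists (b * a); first exact: AM.
  have -> : b * a = c * b * (a / c) by field.
  by apply: mulP => //; rewrite mulf_neq0.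
exists (c * x); first exact: AM.
by rewrite -mulrA; apply: mulP.
Qed.

Lemma rhom_algover_range gam : rhom G f gam -> algover (range f) gam.
Proof.
move=> [m [i [g [l [m0 Gg ng [Ll nl] e]]]]].
have fK : subfield (range f) by apply: subfield_image; split.
have Fc : algover (range f) (gam ^+ m).
  rewrite e; apply: (algoverM fK).
    by apply: algoverS Ll => _ [x _ <-]; exists x.
  by apply: (algover_id fK); exists g.
apply: (algover_root fK (p := 'X^m - (gam ^+ m)%:P)).
- by rewrite -size_poly_eq0 size_XnsubC.
- move=> j; rewrite coefB coefXn coefC; apply: (algoverB fK).
    by apply: (algover_id fK); exact: sf_nat.
  by case: ifP => // _; apply: (algover_id fK); exact: sf0.
by rewrite rootE !hornerE subrr.
Qed.

(** Multiplying [gam] by [b] multiplies the coefficient of degree [j] of its minimal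
polynomial by [b ^+ j]. It suffices that [b] is the leading term of a common
denominator [b1] of approximations of these coefficients, of large value so that
[b * gam] has nonnegative value. *)
Lemma rhom_integral gam : rhom G f gam -> exists b i, [/\ G i b, b != 0 &
  exists d p, homogeneous_poly v G f d p (f b * gam) /\
    forall j, (0 < j < size p)%N -> exists2 x, A x &
      ((d *+ j)%:E <= v x)%E /\ ((d *+ j)%:E < v (p`_((size p).-1 - j) - x)%R)%E].
Proof.
move=> rg; have ng := rhom_neq0 rg; have [d0 wg] := val_ex w ng.
have [p hp] := minpoly_ex (rhom_algover_range rg).
have [b0 [Ab0 nb0 hb0]] := common_denominator (fun k => p`_k) (size p).
have [x [r [Ax r0 vx]]] := Apos.
have [e0 ve0] := val_ex v nb0.
have [n /andP[ltn _]] := lt_mulrn_arch (- (d0 + e0)) r0.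
pose b1 := x ^+ n * b0.
have vb1 : v b1 = (r *+ n + e0)%:E by exact: valM (valX n vx) ve0.
have nb1 := val_fin_neq0 vb1.
have Ab1 : A b1 by apply: AM => //; exact: AX.
have hb1 k : p`_k != 0 -> exists2 y, A y & (v (b1 * p`_k)%R < v (b1 * p`_k - y)%R)%E.
  move=> nz; have [|y Ay hy] := hb0 k _ nz.
    by rewrite ltnNge; apply: contra nz => le; rewrite nth_default.
  exists (x ^+ n * y); first by apply: AM => //; exact: AX.
  rewrite /b1 -mulrA -mulrBr !vfunM (valX n vx) lteD2lE // -vfunM.
  exact: hy.
have [i [b [Gb vi lt]]] := gr_lead hG nb1.
have [vb nb] := gr_lead_neq0 vi lt.
have iE : i = r *+ n + e0 by move: vi; rewrite vb1 => -[].
exists b, i; split=> //; exists (i + d0), (scale_poly b p).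
have wbg : w (f b * gam) = (i + d0)%:E by apply: valM => //; rewrite wf.
have d_ge0 : 0 <= i + d0 by rewrite iE; move: ltn; lra.
have rbg : rhom G f (f b * gam).
  by apply: (rhomM hG) => //; apply: (rhom_hom hG f Gb).
have hp' := minpoly_scale nb hp.
split.
  split=> //; first exact: (minpoly_irreducible hG wf rbg wbg hp').
  exact: (minpoly_homogeneous hG wf rbg wbg hp').
move=> j hj; have Gp := minpoly_homogeneous hG wf rbg wbg hp' hj.
move: hj Gp; rewrite size_scale_poly // => /andP[j0 jp].
rewrite coef_scale_poly //; set k := ((size p).-1 - j)%N.
have [->|nz] := eqVneq p`_k 0.
  by exists 0; rewrite // mulr0 subrr vfun0 leey ltry.
move=> Gp; have nz' : b ^+ j * p`_k != 0 by rewrite mulf_neq0 ?expf_neq0.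
have vp := gr_val hG Gp nz'.
suff [y Ay lty] : exists2 y, A y & (v (b ^+ j * p`_k)%R < v (b ^+ j * p`_k - y)%R)%E.
  rewrite vp in lty; exists y => //; split=> //.
  by rewrite -vp; have <- : v y = v (b ^+ j * p`_k) by apply: val_close; rewrite valB vp.
have [y Ay hy] := hb1 k nz.
exists (b1 ^+ j.-1 * y); first by apply: AM => //; exact: AX.
have -> : b ^+ j * p`_k - b1 ^+ j.-1 * y =
    (b ^+ j - b1 ^+ j) * p`_k + b1 ^+ j.-1 * (b1 * p`_k - y).
  by have -> : b1 ^+ j = b1 * b1 ^+ j.-1; [rewrite -exprS prednK | ring].
have [c vc] := val_ex v nz.
rewrite (valM (valX j vb) vc); apply: val_lt_add.
  rewrite vfunM vc EFinD lteD2rE // -(valX j vb); apply: val_powB => //.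
  by rewrite valB vb.
rewrite vfunM (valX j.-1 vi).
have vbp := valM vi vc; rewrite vbp in hy.
have -> : i *+ j + c = i *+ j.-1 + (i + c) by rewrite -{1}(prednK j0) mulrSr addrA.
by rewrite EFinD lteD2lE.
Qed.
End Integral.

(** * Finitely many generalized homogeneous elements *)

Section Generators.
Variables (R : realType) (K : fieldType) (v : valuation R K).
Variables (G : R -> set K) (hG : graded v G).
Variables (E : closedFieldType) (f : {rmorphism K -> E}) (w : valuation R E).
Hypothesis wf : forall x, w (f x) = v x.
Hypothesis cE : [pchar E] =i pred0.
Variables (F : set E) (GF : forall i g, G i g -> F (f g)).
Variables (N : nat) (j0 : 'I_N) (z : 'I_N -> K) (gv : 'I_N -> R).
Hypotheses (Gz : forall j, G (gv j) (z j)) (nz : forall j, z j != 0).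
Hypothesis basis : forall i g, G i g -> g != 0 ->
  exists m (c : 'I_N -> int), (0 < m)%N /\ i *+ m = \sum_j gv j *~ c j.
Local Notation L := (coef_field G f).
Local Notation rhom := (rhom G f).

Let hL := subfield_L hG f.

Lemma rhomV h : rhom h -> rhom h^-1.
Proof.
move=> [m [i [g [l [m0 Gg ng [Ll nl] e]]]]].
exists m, (- i), g^-1, l^-1; rewrite !invr_neq0 //; split=> //.
- exact: (grV hG).
- by split=> //; exact: (algoverV hL).
by rewrite exprVn e invfM fmorphV.
Qed.

Lemma rhom_one : rhom 1.
Proof. by apply: (rhom_alg hG); [exact: (algover_id hL (sf1 hL)) | exact: oner_neq0]. Qed.

Lemma rhom_exprz h (k : int) : rhom h -> rhom (h ^ k).
Proof.
have pos n : rhom h -> rhom (h ^+ n).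
  move=> hh; elim: n => [|n ih]; first exact: rhom_one.
  by rewrite exprS; exact: (rhomM hG).
by case: k => n hh; [exact: pos | apply: rhomV; exact: pos].
Qed.

Lemma rhom_prod I (r : seq I) (h : I -> E) :
  (forall i, rhom (h i)) -> rhom (\prod_(i <- r) h i).
Proof. by move=> hh; elim/big_ind: _ => //; [exact: rhom_one | exact: (rhomM hG)]. Qed.

Lemma rhom_algL h : rhom h -> w h = 0%E -> algover L h.
Proof.
move=> [m [i [g [l [m0 Gg ng [Ll nl] e]]]]] wh.
apply: (algL_root hG m0); rewrite e; apply: (algoverM hL) => //.
apply: (algL_hom hG); suff -> : 0 = i by [].
have := valX m wh; rewrite mul0rn e vfunM wf (algL_val hG wf Ll nl) add0e.
by rewrite (gr_val hG Gg ng) => -[].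
Qed.

Lemma val_exprz h e (k : int) : w h = e%:E -> w (h ^ k) = (e *~ k)%:E.
Proof. by move=> wh; case: k => n; [exact: valX | apply: valV; exact: valX]. Qed.

Lemma common_exponent (hs : seq E) : (forall h, h \in hs -> rhom h) ->
  exists m, (0 < m)%N /\ forall h e, h \in hs -> w h = e%:E ->
    exists c : 'I_N -> int, e *+ m = \sum_j gv j *~ c j.
Proof.
elim: hs => [|h hs ih] rhs; first by exists 1%N.
have [|m [m0 hm]] := ih; first by move=> h' hh'; apply: rhs; rewrite inE hh' orbT.
have [m1 [i [g [l [m10 Gg ng [Ll nl] e]]]]] := rhs h (mem_head _ _).
have [m2 [c [m20 cE2]]] := basis Gg ng.
have mulc (a : R) (k : nat) (d : 'I_N -> int) : a = \sum_j gv j *~ d j ->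
    a *+ k = \sum_j gv j *~ (d j *+ k).
  move=> ->; rewrite -sumrMnl; apply: eq_bigr => j _.
  by rewrite -[d j *+ k]mulr_natr natz mulrzA -pmulrn.
exists (m1 * m2 * m)%N; rewrite !muln_gt0 m10 m20 m0; split=> // h' e'.
rewrite inE => /orP[/eqP-> wh|hh' wh'].
  have iE : e' *+ m1 = i.
    have := valX m1 wh; rewrite e vfunM wf (algL_val hG wf Ll nl) add0e.
    by rewrite (gr_val hG Gg ng) => -[].
  by exists (fun j => c j *+ m); rewrite !mulrnA iE; apply: mulc.
have [d dE] := hm h' e' hh' wh'.
by exists (fun j => d j *+ (m1 * m2)); rewrite mulnC mulrnA; apply: mulc.
Qed.
(** Let [M] be a common exponent for the elements of [hs], and [u_j] an [M]-th
root of [z_j]: the [h] in [hs] are products of powers of the [u_j] by elements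
algebraic over [L]. These are generated by the [M]-th power of some [t], which is
recovered from the [M]-th power of [t * u_0]. *)
Lemma rhom_generators (hs : seq E) : (forall h, h \in hs -> rhom h) ->
  exists gam : 'I_N -> E, (forall j, rhom (gam j)) /\
    forall b : 'I_N -> K, (forall j, b j != 0 /\ exists i, G i (b j)) ->
    forall T, subfield T -> F `<=` T -> (forall j, T (f (b j) * gam j)) ->
    forall h, h \in hs -> T h.
Proof.
move=> rhs; have [m [m0 hm]] := common_exponent rhs.
have [u uE] : exists u : 'I_N -> E, forall j, u j ^+ m = f (z j).
  exists (fun j => projT1 (cid (ex_root (f (z j)) m0))) => j.
  by case: cid.
have ru j : rhom (u j).
  exists m, (gv j), (z j), 1; rewrite mul1r oner_neq0 uE; split=> //.
  by split=> //; exact: (algover_id hL (sf1 hL)).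
have wu j : exists2 a, w (u j) = a%:E & a *+ m = gv j.
  have [a wa] := val_ex w (rhom_neq0 (ru j)); exists a => //.
  by have := valX m wa; rewrite uE wf (gr_val hG (Gz j) (nz j)) => -[].
have hlam h : h \in hs -> exists c : 'I_N -> int, algover L (h / \prod_j u j ^ c j).
  move=> hh; have [e we] := val_ex w (rhom_neq0 (rhs h hh)).
  have [c ec] := hm h e hh we; exists c; apply: rhom_algL.
    apply: (rhomM hG); first exact: rhs.
    by apply: rhomV; apply: rhom_prod => j; exact: rhom_exprz.
  pose a j := s2val (cid2 (wu j)).
  have wa j : w (u j) = (a j)%:E by rewrite /a; case: cid2.
  have am j : a j *+ m = gv j by rewrite /a; case: cid2.
  have wp : w (\prod_j u j ^ c j) = (\sum_j a j *~ c j)%:E.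
    by apply: val_prod => j _; apply: val_exprz; exact: wa.
  rewrite (valM we (valV wp)); congr EFin.
  have : (e - \sum_j a j *~ c j) *+ m = 0.
    apply/eqP; rewrite mulrnBl ec -sumrMnl subr_eq0; apply/eqP/eq_bigr => j _.
    by rewrite -am !pmulrn -!mulrzA mulrC.
  by move/eqP; rewrite mulrn_eq0 eqn0Ngt m0 /= => /eqP.
pose c h := if pselect (h \in hs) is left hh then projT1 (cid (hlam h hh)) else fun=> 0.
pose lam h := h / \prod_j u j ^ c h j.
have Llam h : h \in hs -> algover L (lam h).
  by move=> hh; rewrite /lam /c; case: pselect => // hh'; case: cid.
have [|t [Lt nt tt tlam]] := @power_generator _ _ [seq lam h | h <- hs] _ hL cE m0.
  by move=> _ /mapP[h hh ->]; exact: Llam.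
exists (fun j => if j == j0 then t * u j else u j); split.
  move=> j; case: eqP => // _; apply: (rhomM hG) => //; exact: (rhom_alg hG).
move=> b hb T hT FT hgam h hh.
have Tf i g : G i g -> T (f g) by move=> Gg; apply: FT; exact: GF Gg.
have Tb j : T (f (b j)) by have [_ [i Gb]] := hb j; exact: Tf Gb.
have nb j : f (b j) != 0 by rewrite fmorph_eq0; have [] := hb j.
have Ttm : T (t ^+ m).
  have := sfX hT m (hgam j0); rewrite eqxx !exprMn uE => Tm.
  have -> : t ^+ m = f (b j0) ^+ m * (t ^+ m * f (z j0)) / (f (b j0) ^+ m * f (z j0)).
    have nzf : f (z j0) != 0 by rewrite fmorph_eq0.
    by rewrite mulrCA mulfK // mulf_neq0 ?expf_neq0.
  by apply: (sfdiv hT) => //; apply: (sfM hT); [exact: sfX | exact: Tf (Gz j0)].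
have LT : L `<=` T by move=> _ [g Gg <-]; exact: Tf Gg.
have Tadj y : adjoin L (t ^+ m) y -> T y.
  by move=> [p Lp ->]; apply: (polyS_horner hT) => // i; exact: LT.
have Tu j : T (u j).
  have := sfM hT (hgam j) (sfV hT (Tb j)); rewrite mulrC mulKf //.
  case: eqP => // -> h1; rewrite -[u j0](mulKf nt) mulrC.
  by apply: (sfdiv hT) => //; exact: Tadj.
have -> : h = lam h * \prod_j u j ^ c h j.
  rewrite /lam divfK // prodf_seq_neq0; apply/allP => j _.
  by apply: expfz_neq0; exact: rhom_neq0 (ru j).
apply: (sfM hT); first by apply: Tadj; apply: tlam; exact: map_f.
apply: (sf_prod hT) => j _; case: (c h j) => n; first exact: (sfX hT).
by apply: (sfV hT); exact: (sfX hT).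
Qed.
End Generators.

(** * The monomial and the uniformized gradings *)

Lemma val_div_close (R : realType) (K : fieldType) (v : valuation R K) p q p' q' :
  (v p < v (p - p')%R)%E -> (v q < v (q - q')%R)%E ->
  (v (p / q)%R < v (p / q - p' / q')%R)%E.
Proof.
move=> hp hq; have [np nq] := (val_ltoo hp, val_ltoo hq).
have [[a va] [b vb]] := (val_ex v np, val_ex v nq).
have vq' : v q' = b%:E by rewrite -vb; apply: val_close; rewrite valB.
have vp' : v p' = a%:E by rewrite -va; apply: val_close; rewrite valB.
have nq' := val_fin_neq0 vq'.
have -> : p / q - p' / q' = (p - p') / q - p' * ((q - q') / (q * q')) by field; rewrite ?nq ?nq'.
rewrite (valM va (valV vb)); apply: val_lt_sub.
  by rewrite vfunM (valV vb) EFinD lteD2rE // -va.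
rewrite vfunM vp' EFinD lteD2lE // vfunM (valV (valM vb vq')).
apply: (@le_lt_trans _ _ (b%:E + (- (b + b))%:E)%E).
  by rewrite -EFinD lee_fin; lra.
by rewrite lteD2rE // -vb.
Qed.

(** The elements of negative value are approximated by inverting approximations of
their inverses. *)
Lemma vcompletion_approx (R : realType) (K Kh : fieldType) (v : valuation R K)
    (vh : valuation R Kh) (i : {rmorphism K -> Kh}) y :
  vcompletion v vh i -> y != 0 -> exists2 x, x != 0 & (vh y < vh (y - i x)%R)%E.
Proof.
move=> hc; have [ext dense _] := hc.
have pos u : u != 0 -> (0 <= vh u)%E -> exists2 x, x != 0 & (vh u < vh (u - i x)%R)%E.
  move=> nu u0; have [a va] := val_ex vh nu.
  have [x _ xu] := dense u (a + 1) u0.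
  have lt : (vh u < vh (u - i x)%R)%E.
    by apply: lt_le_trans xu; rewrite va lte_fin ltrDl.
  exists x => //; apply: contraTneq lt => ->.
  by rewrite rmorph0 subr0 ltxx.
move=> ny; have [a va] := val_ex vh ny; have [a0|a0] := leP 0 a.
  by apply: pos; rewrite // va lee_fin.
have [||x nx lt] := pos y^-1; first by rewrite invr_eq0.
  by rewrite (valV va) lee_fin oppr_ge0 ltW.
exists x^-1; first by rewrite invr_neq0.
have nix : i x != 0 by rewrite fmorph_eq0.
have vx : vh (i x) = (- a)%:E by rewrite -(valV va); apply: val_close; rewrite valB.
have -> : y - i x^-1 = y * (i x)^-1 * - (y^-1 - i x).
  by rewrite fmorphV; field; rewrite ?ny ?nix.
rewrite vfunM vfunN (valM va (valV vx)) opprK.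
apply: (@le_lt_trans _ _ ((a + a)%:E + (- a)%:E)%E).
  by rewrite va -EFinD addrK.
by rewrite lteD2lE // -(valV va).
Qed.

Section MonomialGrading.
Variables (R : realType) (k : fieldType) (n : nat).
Variables (nu : valuation R {mps k[n]}) (Kh : fieldType).
Variables (vh : valuation R Kh) (iK : {rmorphism {fraction {mps k[n]}} -> Kh}).
Hypothesis hKh : vcompletion (frac_val nu) vh iK.
Variables (alpha : 'I_n -> R) (hal : monomial_valuation alpha nu).

Lemma weightD m m' : weight alpha (m + m')%MM = weight alpha m + weight alpha m'.
Proof. by rewrite -big_split; apply: eq_bigr => j _; rewrite mnmDE mulrnDr. Qed.

Lemma whom1 : weighted_homogeneous alpha 0 (1 : {mpoly k[n]}).
Proof.
move=> m; rewrite msupp1 inE => /eqP ->.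
by rewrite /weight big1 // => j _; rewrite mnm0E.
Qed.

Lemma whomM s t (a b : {mpoly k[n]}) : weighted_homogeneous alpha s a ->
  weighted_homogeneous alpha t b -> weighted_homogeneous alpha (s + t) (a * b).
Proof.
move=> ha hb m /msuppM_le /allpairsP[[m1 m2] /= [/ha e1 /hb e2 ->]].
by rewrite weightD e1 e2.
Qed.

Lemma whomB s (a b : {mpoly k[n]}) : weighted_homogeneous alpha s a ->
  weighted_homogeneous alpha s b -> weighted_homogeneous alpha s (a - b).
Proof.
move=> ha hb m /msuppB_le; rewrite mem_cat => /orP[/ha|/hb] //.
Qed.

Lemma mps_of_mpoly_eq0 (a : {mpoly k[n]}) : (mps_of_mpoly a == 0) = (a == 0).
Proof.
apply/eqP/eqP => [e|->]; last by rewrite rmorph0.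
by apply/mpolyP => m; have := congr1 (fun s => mps_coef s m) e; rewrite mcoeff0.
Qed.

Lemma whom_val s (a : {mpoly k[n]}) : weighted_homogeneous alpha s a -> a != 0 ->
  nu (mps_of_mpoly a) = s%:E.
Proof.
move=> ha na; have [_ /(_ (mps_of_mpoly a))[[/eqP]|[m [nm -> _]]]] := hal.
  by rewrite mps_of_mpoly_eq0 (negbTE na).
by rewrite (ha m) // mcoeff_msupp.
Qed.

Lemma iK_val (p q : {mps k[n]}) : q != 0 -> vh (iK (p%:F / q%:F)) = (nu p - nu q)%E.
Proof. by move=> nq; rewrite (vcompl_ext hKh) /= frac_val_div. Qed.

(** The terms of smallest weight are finitely many, since the weights of the
variables are bounded below by a positive [e]. *)
Lemma initial_form (p : {mps k[n]}) : p != 0 -> exists (a : {mpoly k[n]}) s,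
  [/\ weighted_homogeneous alpha s a, a != 0 & (nu p < nu (p - mps_of_mpoly a)%R)%E].
Proof.
move=> np; have [al0 hmono] := hal.
have [[p0]|[m [nm vm mmin]]] := hmono p; first by rewrite p0 eqxx in np.
set s := weight alpha m in vm mmin.
have [b hb] : exists b, forall m', weight alpha m' = s -> (mdeg m' < b)%N.
  have [e e0 he] : exists2 e : R, 0 < e & forall j, e <= alpha j.
    have h (l : seq 'I_n) : exists2 e : R, 0 < e & forall j, j \in l -> e <= alpha j.
      elim: l => [|j l [e e0 he]]; first by exists 1.
      exists (Num.min e (alpha j)); first by rewrite lt_min e0 al0.
      move=> j'; rewrite inE ge_min => /orP[/eqP->|/he ->//].
      by rewrite lexx orbT.
    by have [e e0 he] := h (enum 'I_n); exists e => // j; rewrite he ?mem_enum.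
  have [b /andP[sb _]] := lt_mulrn_arch s e0.
  exists b => m' ws; rewrite ltnNge; apply/negP => le.
  move: sb; rewrite ltNge => /negP; apply; rewrite -ws /weight.
  apply: (@le_trans _ _ (e *+ mdeg m')); first by rewrite ler_wpMn2l ?ltW.
  by rewrite mdegE -sumrMnr; apply: ler_sum => j _; rewrite lerMn2r he orbT.
pose q := Mps (fun m' => if weight alpha m' == s then mps_coef p m' else 0).
pose a := mps_trunc b q.
have aE m' : a@_m' = mps_coef q m'.
  have [lt|le] := ltnP (mdeg m') b; first exact: mps_truncE.
  rewrite /= ifN; last by apply: contraL le => /eqP/hb; rewrite ltnNge.
  rewrite /a /mps_trunc raddf_sum /= big1 // => i _.
  rewrite mcoeffZ mcoeffX; have [e|_] := eqVneq (bmnm i) m'; last by rewrite mulr0.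
  by have := bmdeg i; rewrite e ltnNge le.
exists a, s; split.
- move=> m'; rewrite mcoeff_msupp aE /=.
  by have [//|_] := eqVneq (weight alpha m') s; rewrite eqxx.
- apply: contraNneq nm => a0; have := aE m; rewrite a0 mcoeff0 /= eqxx => <-.
  by rewrite eqxx.
rewrite vm; have [[-> ->]|[m' [nm' -> _]]] := hmono (p - mps_of_mpoly a).
  by rewrite ltry.
have e : mps_coef (p - mps_of_mpoly a) m' = mps_coef p m' - a@_m' by [].
move: nm'; rewrite e aE /= lte_fin; have [_|ne] := eqVneq (weight alpha m') s.
  by rewrite subrr eqxx.
by rewrite subr0 => /mmin; rewrite le_eqVlt eq_sym (negbTE ne).
Qed.

Lemma monomial_graded : graded vh (monomial_piece iK alpha).
Proof.
have iE (a b : {mpoly k[n]}) : iK ((mps_of_mpoly a)%:F / (mps_of_mpoly b)%:F) =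
    iK (mps_of_mpoly a)%:F / iK (mps_of_mpoly b)%:F by rewrite fmorph_div.
have nF (b : {mpoly k[n]}) : b != 0 -> iK (mps_of_mpoly b)%:F != 0.
  by move=> nb; rewrite fmorph_eq0 tofrac_eq0 mps_of_mpoly_eq0.
split.
- by move=> i; left.
- right; exists 1, 1, 0, 0; rewrite oner_neq0 subr0; split=> //; try exact: whom1.
  by rewrite iE divff // nF // oner_neq0.
- have N i x : monomial_piece iK alpha i x -> monomial_piece iK alpha i (- x).
    case=> [->|[a [b [s [t [[na nb] ha hb st ->]]]]]]; first by left; rewrite oppr0.
    right; exists (- a), b, s, t; rewrite oppr_eq0; split=> //.
      by rewrite -sub0r; apply: whomB => // m; rewrite msupp0.
    by rewrite !iE raddfN tofracN rmorphN mulNr.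
  move=> i x y [->|[a [b [s [t [[na nb] ha hb st xE]]]]]]; first by rewrite sub0r; exact: N.
  case=> [->|[c [d [s' [t' [[nc nd] hc hd st' yE]]]]]].
    by rewrite subr0; right; exists a, b, s, t.
  have [e|ne] := eqVneq (a * d - c * b) 0.
    left; apply/eqP; rewrite subr_eq0 xE yE !iE eqr_div ?nF //.
    by move/eqP: e; rewrite subr_eq0 -!rmorphM => /eqP ->.
  right; exists (a * d - c * b), (b * d), (s + t'), (t + t'); rewrite mulf_neq0 //.
  split=> //.
  + apply: whomB; first exact: whomM.
    have -> : s + t' = s' + t by lra.
    exact: whomM.
  + exact: whomM.
  + lra.
  by rewrite xE yE !iE !rmorphB !rmorphM /=; field; rewrite !nF.
- move=> i j x y [->|[a [b [s [t [[na nb] ha hb st ->]]]]]]; first by left; rewrite mul0r.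
  case=> [->|[c [d [s' [t' [[nc nd] hc hd st' ->]]]]]]; first by left; rewrite mulr0.
  right; exists (a * c), (b * d), (s + s'), (t + t'); rewrite !mulf_neq0 //; split=> //.
  + exact: whomM.
  + exact: whomM.
  + lra.
  by rewrite !iE !rmorphM /=; field; rewrite !nF.
- move=> i x [->|[a [b [s [t [[na nb] ha hb st ->]]]]]]; first by left; rewrite invr0.
  right; exists b, a, t, s; split=> //; first lra.
  by rewrite !iE invf_div.
- move=> i x [->|[a [b [s [t [[na nb] ha hb st ->]]]]] _]; first by rewrite eqxx.
  by rewrite iK_val ?mps_of_mpoly_eq0 // (whom_val ha na) (whom_val hb nb) -st EFinB.
move=> y ny; have [x nx lt] := vcompletion_approx hKh ny.
have [p [q [nq xE]]] := fracP x.
have np : p != 0 by apply: contraNneq nx => p0; rewrite xE p0 tofrac0 mul0r.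
have [a [s [ha na hpa]]] := initial_form np.
have [b [t [hb nb hqb]]] := initial_form nq.
have vF (u : {mps k[n]}) : vh (iK u%:F) = nu u.
  have := iK_val u (oner_neq0 _); rewrite tofrac1 divr1 vfun1 => ->.
  by rewrite sube0.
have hx : (vh (iK x) < vh (iK x - iK ((mps_of_mpoly a)%:F / (mps_of_mpoly b)%:F))%R)%E.
  rewrite xE iE fmorph_div; apply: val_div_close.
    by rewrite -rmorphB -tofracB !vF.
  by rewrite -rmorphB -tofracB !vF.
have vyx : vh y = vh (iK x) by apply: esym; apply: val_close; rewrite valB.
exists (s - t), (iK ((mps_of_mpoly a)%:F / (mps_of_mpoly b)%:F)).
have vy : vh y = (s - t)%:E.
  have <- : vh (iK ((mps_of_mpoly a)%:F / (mps_of_mpoly b)%:F)) = vh y.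
    by rewrite vyx; apply: val_close; rewrite valB.
  by rewrite iK_val ?mps_of_mpoly_eq0 // (whom_val ha na) (whom_val hb nb) EFinB.
split=> //; first by right; exists a, b, s, t.
rewrite -vy; set g := iK (_ / _); have -> : y - g = (y - iK x) + (iK x - g) by ring.
by apply: val_lt_add => //; rewrite vyx.
Qed.
End MonomialGrading.

Section UniformGrading.
Variables (R : realType) (k : fieldType) (n : nat).
Variables (nu : valuation R {mps k[n]}) (Kh : fieldType).
Variables (vh : valuation R Kh) (iK : {rmorphism {fraction {mps k[n]}} -> Kh}).
Hypothesis hKh : vcompletion (frac_val nu) vh iK.
Variable U : uniformization nu vh iK.

Local Notation r := (un_r U).
Local Notation wt := (@un_w _ _ _ _ _ _ _ U).
Local Notation e := (un_e U).
Let zeta (j : 'I_r) : Kh := iK (un_incl U (un_z j)%:F).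
Let cst (l : un_L U) : Kh := e (mps_of_mpoly l%:MP).
Let mon (b : 'I_r -> int) : Kh := \prod_j zeta j ^ b j.
Let deg (b : 'I_r -> int) : R := \sum_j wt j *~ b j.

Let zeta_val j : vh (zeta j) = (wt j)%:E.
Proof. by rewrite (vcompl_ext hKh) un_wE. Qed.

Let zeta_neq0 j : zeta j != 0. Proof. exact: val_fin_neq0 (zeta_val j). Qed.

Let mon_val b : vh (mon b) = (deg b)%:E.
Proof.
apply: val_prod => j _; have := zeta_val j.
by case: (b j) => m h; [exact: valX | apply: valV; exact: valX].
Qed.

Let mon_neq0 b : mon b != 0. Proof. exact: val_fin_neq0 (mon_val b). Qed.

Let monD b c : mon (fun j => b j + c j) = mon b * mon c.
Proof. by rewrite /mon -big_split; apply: eq_bigr => j _; rewrite expfzDr. Qed.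

Let monN b : mon (fun j => - b j) = (mon b)^-1.
Proof. by rewrite /mon -prodfV; apply: eq_bigr => j _; rewrite invr_expz. Qed.

Let degD b c : deg (fun j => b j + c j) = deg b + deg c.
Proof. by rewrite /deg -big_split; apply: eq_bigr => j _; rewrite mulrzDr. Qed.

Let degN b : deg (fun j => - b j) = - deg b.
Proof. by rewrite /deg -sumrN; apply: eq_bigr => j _; rewrite mulrNz. Qed.

Let deg_inj b c : deg b = deg c -> b = c.
Proof.
move=> bc.
have vg : value_group (frac_val nu) (deg b).
  exists (\prod_j un_incl U (un_z j)%:F ^ b j).
    apply/prodf_neq0 => j _; apply: expfz_neq0.
    by have := zeta_neq0 j; rewrite fmorph_eq0.
  rewrite -(vcompl_ext hKh) rmorph_prod -mon_val; congr (vh _).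
  by apply: eq_bigr => j _; rewrite fmorphXz.
have [d [_ dU]] := un_w_free U vg.
have eb : d = finfun b by apply: dU; apply: eq_bigr => j _; rewrite ffunE.
have ec : d = finfun c by apply: dU; rewrite bc; apply: eq_bigr => j _; rewrite ffunE.
by apply: funext => j; have := congr1 (fun h : {ffun 'I_r -> int} => h j) eb;
  rewrite ec !ffunE.
Qed.

Let cst0 : cst 0 = 0. Proof. by rewrite /cst mpolyC0 !rmorph0. Qed.
Let cst1 : cst 1 = 1. Proof. by rewrite /cst mpolyC1 !rmorph1. Qed.
Let cstM l l' : cst (l * l') = cst l * cst l'.
Proof. by rewrite /cst mpolyCM !rmorphM. Qed.
Let cstB l l' : cst (l - l') = cst l - cst l'.
Proof. by rewrite /cst mpolyCB !rmorphB. Qed.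
Let cstV l : cst l^-1 = (cst l)^-1.
Proof.
have [->|nl] := eqVneq l 0; first by rewrite invr0 cst0 invr0.
have h : cst l^-1 * cst l = 1 by rewrite -cstM mulVf // cst1.
have ncl : cst l != 0.
  by apply: contraTneq isT => c0; have /eqP := h; rewrite c0 mulr0 eq_sym oner_eq0.
by apply: (mulIf ncl); rewrite h mulVf.
Qed.

Let cst_val l : l != 0 -> vh (cst l) = 0%E.
Proof.
move=> nl; have [[/eqP]|[m [nm -> _]]] := un_e_mono (mps_of_mpoly l%:MP).
  move=> e0; exfalso; have /eqP := congr1 (fun s => mps_coef s 0%MM) (eqP e0).
  by rewrite /= mcoeffC eqxx mulr1 (negbTE nl).
move: nm; rewrite /= mcoeffC; have [-> _|_] := eqVneq m 0%MM; last by rewrite mulr0 eqxx.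
by rewrite /weight big1 // => j _; rewrite mnm0E.
Qed.

Let pieceE b l : uniform_piece U (deg b) (cst l * mon b).
Proof. by right; exists l, b. Qed.

Let pieceP i y : uniform_piece U i y -> y = 0 \/
  exists l b, [/\ l != 0, deg b = i & y = cst l * mon b].
Proof.
case=> [->|[l [b [<- ->]]]]; first by left.
have [->|nl] := eqVneq l 0; last by right; exists l, b.
by left; rewrite -/(cst 0) cst0 mul0r.
Qed.

Let e_mon (m : 'X_{1..r}) (l : un_L U) :
  e (mps_of_mpoly (l *: 'X_[m])) = cst l * mon (fun j => (m j)%:Z).
Proof.
rewrite -mul_mpolyC !rmorphM; congr (_ * _).
rewrite mpolyXE_id !rmorph_prod; apply: eq_bigr => j _.
by rewrite !rmorphXn /= -un_c_z un_eE.
Qed.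

(** As the weights of the parameters are independent, a single monomial of the power
series expansion of [a] has the smallest weight. *)
Let initial_term (a : un_A U) : a != 0 -> exists l b, [/\ l != 0 &
  (vh (iK (un_incl U a%:F)) < vh (iK (un_incl U a%:F) - cst l * mon b)%R)%E].
Proof.
move=> na; rewrite -un_eE; set s := un_c U a.
have nes : e s != 0 by rewrite /s un_eE !fmorph_eq0 tofrac_eq0.
have [[s0 _]|[m [nm vm mmin]]] := un_e_mono s.
  by move: nes; rewrite s0 rmorph0 eqxx.
exists (mps_coef s m), (fun j => (m j)%:Z); split=> //.
rewrite -e_mon -rmorphB vm.
have [[-> ->]|[m' [nm' -> _]]] := un_e_mono (s - mps_of_mpoly (mps_coef s m *: 'X_[m])).
  by rewrite ltry.
have sE : mps_coef (s - mps_of_mpoly (mps_coef s m *: 'X_[m])) m' =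
  mps_coef s m' - mps_coef s m * (m == m')%:R by rewrite /= mcoeffZ mcoeffX.
move: nm'; rewrite sE lte_fin; have [<-|ne] := eqVneq m m'.
  by rewrite mulr1 subrr eqxx.
rewrite mulr0 subr0 => /mmin; rewrite le_eqVlt => /orP[/eqP h|//].
case/eqP: ne; apply/mnmP => j.
have /(congr1 (fun g => g j)) /= [] := @deg_inj (fun j => (m j)%:Z) (fun j => (m' j)%:Z) h.
by [].
Qed.

Lemma uniform_graded : graded vh (uniform_piece U).
Proof.
split.
- by move=> i; left.
- have := pieceE (fun=> 0) 1; rewrite cst1 mul1r /deg big1 // /mon big1 //.
- move=> i x y; case/pieceP => [->|[l [b [nl <- ->]]]]; case/pieceP => [->|[l' [b' [nl' e' ->]]]].
  + by rewrite subrr; left.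
  + by rewrite sub0r -mulNr -[- cst l']sub0r -cst0 -cstB -e'; exact: pieceE.
  + by rewrite subr0; exact: pieceE.
  by rewrite (deg_inj e') -mulrBl -cstB; exact: pieceE.
- move=> i j x y; case/pieceP => [->|[l [b [nl <- ->]]]].
    by move=> _; rewrite mul0r; left.
  case/pieceP => [->|[l' [b' [nl' <- ->]]]]; first by rewrite mulr0; left.
  by rewrite mulrACA -cstM -monD -degD; exact: pieceE.
- move=> i x /pieceP[->|[l [b [nl <- ->]]]]; first by rewrite invr0; left.
  by rewrite invfM -cstV -monN -degN; exact: pieceE.
- move=> i x /pieceP[->|[l [b [nl <- ->]]] _]; first by rewrite eqxx.
  by rewrite vfunM cst_val // mon_val add0e.
move=> y ny; have [x nx lt] := vcompletion_approx (un_compl U) ny.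
have [p [q [nq xE]]] := fracP x.
have np : p != 0 by apply: contraNneq nx => p0; rewrite xE p0 tofrac0 mul0r.
have [l [b [nl hp]]] := initial_term np.
have [l' [b' [nl' hq]]] := initial_term nq.
set u := iK (un_incl U x) in lt.
have uE : u = iK (un_incl U p%:F) / iK (un_incl U q%:F).
  by rewrite /u xE !fmorph_div.
pose g := cst (l / l') * mon (fun j => b j + - b' j).
have gE : g = cst l * mon b / (cst l' * mon b').
  by rewrite /g cstM cstV monD monN invfM mulrACA.
have hu : (vh u < vh (u - g)%R)%E by rewrite uE gE; exact: val_div_close hp hq.
have vyu : vh y = vh u by apply: esym; apply: val_close; rewrite valB.
have vg : vh g = vh y by rewrite vyu; apply: val_close; rewrite valB.
exists (deg (fun j => b j + - b' j)), g; split; first exact: pieceE.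
  by rewrite -vg vfunM cst_val ?mulf_neq0 ?invr_neq0 // mon_val add0e.
have <- : vh y = (deg (fun j => b j + - b' j))%:E.
  by rewrite -vg vfunM cst_val ?mulf_neq0 ?invr_neq0 // mon_val add0e.
have -> : y - g = (y - u) + (u - g) by ring.
by apply: val_lt_add => //; rewrite vyu.
Qed.
End UniformGrading.

Lemma grading_graded (R : realType) (k : fieldType) (n : nat)
    (nu : valuation R {mps k[n]}) (Kh : fieldType) (vh : valuation R Kh)
    (iK : {rmorphism {fraction {mps k[n]}} -> Kh}) (G : R -> set Kh) :
  vcompletion (frac_val nu) vh iK -> grading nu vh iK G -> graded vh G.
Proof.
move=> hKh [[alpha hal ->]|[_ [U ->]]]; first exact: (monomial_graded hKh hal).
exact: (uniform_graded hKh U).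
Qed.

(** * Polynomials in several homogeneous elements *)

Section PolynomialRing.
Variables (K E : fieldType) (f : {rmorphism K -> E}) (D : set K).
Hypothesis hD : subfield D.
Variables (s : nat) (gam : 'I_s -> E).

(** The ring [D[gam]]. *)
Definition mpoly_values : set E :=
  [set y | exists2 p : {mpoly K[s]}, (forall m, D p@_m) & y = mmap f gam p].

Let coefP (p : {mpoly K[s]}) : (forall m, D p@_m) <-> p \is a mpolyOver s (sfpred hD).
Proof.
split=> [h|/mpolyOverP h m]; last by apply/(sfpredP hD).
by apply/mpolyOverP => m; apply/(sfpredP hD).
Qed.

Lemma mpoly_values_const x : D x -> mpoly_values (f x).
Proof.
move=> Dx; exists x%:MP; last by rewrite mmapC.
by apply/coefP; rewrite mpolyOverC; apply/(sfpredP hD).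
Qed.

Lemma mpoly_values_gen j : mpoly_values (gam j).
Proof. by exists 'X_j; [apply/coefP; exact: mpolyOverX | rewrite mmapX mmap1U]. Qed.

Lemma mpoly_valuesB x y : mpoly_values x -> mpoly_values y -> mpoly_values (x - y).
Proof.
move=> [p /coefP hp ->] [q /coefP hq ->].
by exists (p - q); [apply/coefP; exact: rpredB | rewrite mmapB].
Qed.

Lemma mpoly_valuesM x y : mpoly_values x -> mpoly_values y -> mpoly_values (x * y).
Proof.
move=> [p /coefP hp ->] [q /coefP hq ->].
by exists (p * q); [apply/coefP; exact: rpredM | rewrite rmorphM].
Qed.

Lemma mpoly_values_alg x : (forall j, algover (f @` D) (gam j)) ->
  mpoly_values x -> algover (f @` D) x.
Proof.
have hfD := subfield_image f hD; have hA := subfield_algover hfD.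
move=> hgam [p Dp ->]; rewrite /mmap; apply: (sf_sum hA) => m _.
apply: (sfM hA); first by apply: (algover_id hfD); exists p@_m.
by apply: (sf_prod hA) => j _; exact: (sfX hA).
Qed.

Lemma subfield_mpoly_values : (forall j, algover (f @` D) (gam j)) ->
  subfield mpoly_values.
Proof.
move=> hgam; apply: (subfield_alg_ring (subfield_image f hD)).
- by move=> _ [x Dx <-]; exact: mpoly_values_const.
- exact: mpoly_valuesB.
- exact: mpoly_valuesM.
by move=> x; exact: mpoly_values_alg.
Qed.
End PolynomialRing.

Lemma rhom_span_list (R : realType) (K : fieldType) (G : R -> set K)
    (E : closedFieldType) (f : {rmorphism K -> E}) (F : set E) x :
  rhom_span G f F x -> exists hs : seq E, (forall h, h \in hs -> rhom G f h) /\
    forall T, subfield T -> F `<=` T -> (forall h, h \in hs -> T h) -> T x.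
Proof.
elim=> [|a h y Fa rh _ [hs [rhs hT]]].
  by exists [::]; split=> // T hT _ _; exact: sf0 hT.
exists (h :: hs); split=> [h'|T hTs FT Ths].
  by rewrite inE => /orP[/eqP->|/rhs].
apply: (sfD hTs).
  by apply: (sfM hTs); [exact: FT | apply: Ths; exact: mem_head].
by apply: hT => // h' hh'; apply: Ths; rewrite inE hh' orbT.
Qed.

Lemma rhom_span_seq (R : realType) (K : fieldType) (G : R -> set K)
    (E : closedFieldType) (f : {rmorphism K -> E}) (F : set E) (xs : seq E) :
  (forall x, x \in xs -> rhom_span G f F x) ->
  exists hs : seq E, (forall h, h \in hs -> rhom G f h) /\
    forall T, subfield T -> F `<=` T -> (forall h, h \in hs -> T h) ->
    forall x, x \in xs -> T x.
Proof.
elim: xs => [|x xs ih] hxs; first by exists [::].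
have [|hs [rhs hT]] := ih; first by move=> y yxs; apply: hxs; rewrite inE yxs orbT.
have [hs' [rhs' hT']] := rhom_span_list (hxs x (mem_head _ _)).
exists (hs' ++ hs); split=> [h|T hTs FT Ths y].
  by rewrite mem_cat => /orP[/rhs'|/rhs].
rewrite inE => /orP[/eqP->|].
  by apply: hT' => // h hh; apply: Ths; rewrite mem_cat hh.
by apply: hT => // h hh; apply: Ths; rewrite mem_cat hh orbT.
Qed.

(** * Values of power series *)

Section PowerSeriesValues.
Variables (R : realType) (k : fieldType) (n : nat).
Variables (nu : valuation R {mps k[n]}) (hnu : centered nu).

Lemma centered_const c : c != 0 -> nu (mps_of_mpoly c%:MP) = 0%E.
Proof.
move=> nc; have [ge0 _] := hnu; apply/eqP; rewrite eq_le ge0 andbT.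
have <- : nu (mps_of_mpoly c%:MP * mps_of_mpoly c^-1%:MP) = 0%E.
  by rewrite -rmorphM -mpolyCM mulfV // rmorph1 vfun1.
by rewrite vfunM leeDl.
Qed.

Lemma centered_nat m : [pchar k] =i pred0 -> (0 < m)%N -> nu m%:R = 0%E.
Proof.
move=> /pcharf0P c0 m0; rewrite -(rmorph_nat (@mps_of_mpoly n k)).
rewrite -(rmorph_nat (@mpolyC n k)); apply: centered_const.
by rewrite c0 -lt0n.
Qed.

Lemma centered_variable (j : 'I_n) : exists2 r, 0 < r & nu (mps_of_mpoly 'X_j) = r%:E.
Proof.
have [_ max] := hnu; pose x : {mps k[n]} := mps_of_mpoly 'X_j.
have x0 : mps_coef x 0%MM = 0.
  rewrite /= mcoeffX; case: eqP => // /(congr1 (fun m : 'X_{1..n} => m j)).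
  by rewrite mnm1E eqxx mnm0E.
have nz : x != 0.
  apply/eqP => /(congr1 (fun g => mps_coef g U_(j)%MM)) /=.
  by rewrite mcoeffX eqxx; apply/eqP; exact: oner_neq0.
have : max_ideal {mps k[n]} x.
  rewrite /max_ideal /=; apply/negP => /unitrP[y [yx _]].
  have := congr1 (fun g => mps_coef g 0%MM) yx; rewrite mps_coefM.
  rewrite big1 => [/= /eqP|[k1 k2] /eqP e].
    by rewrite mcoeff1 eqxx eq_sym oner_eq0.
  have k20 : bmnm k2 = 0%MM.
    by apply/mnmP => i; have := congr1 (fun m : 'X_{1..n} => m i) e;
      rewrite mnmDE !mnm0E => /esym/eqP; rewrite addn_eq0 => /andP[_ /eqP].
  by rewrite [X in mps_coef x X]k20 x0 mulr0.
move=> /max; have := vfun_fin nu nz; rewrite -/x; case: (nu x) => // r _.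
by rewrite lte_fin => r0; exists r.
Qed.
End PowerSeriesValues.

(** * Roots over the valuation rings generated by homogeneous elements *)

(** Clear the denominators of a basis of the divisible hull, then those of the
coordinates of [i]. *)
Lemma rational_basis (R : realType) (A : set R) N : dimQ (tensorQ A) N ->
  exists g : 'I_N -> R, (forall j, A (g j)) /\ forall i, A i ->
    exists m (c : 'I_N -> int), (0 < m)%N /\ i *+ m = \sum_j g j *~ c j.
Proof.
move=> [b [bA bspan]].
pose m j := s2val (cid2 (bA j)).
have m0 j : (0 < m j)%N by rewrite /m; case: cid2.
have mA j : A (b j *+ m j) by rewrite /m; case: cid2.
exists (fun j => b j *+ m j); split=> // i Ai.
have [|q [iE _]] := bspan i; first by exists 1%N.
pose d j := (`|denq (q j)| * m j)%N.
have d0 j : (0 < d j)%N by rewrite muln_gt0 m0 absz_gt0 denq_neq0.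
pose D' j := (\prod_(l < N | l != j) d l)%N.
exists (\prod_j d j)%N, (fun j => numq (q j) * (D' j)%:Z); split.
  by rewrite prodn_gt0.
rewrite iE -sumrMnl; apply: eq_bigr => j _.
have qden : ratr (q j) *+ `|denq (q j)| = (numq (q j))%:~R :> R.
  rewrite -mulr_natr pmulrn gez0_abs ?(ltW (denq_gt0 _)) // divfK //.
  by rewrite intr_eq0 denq_neq0.
rewrite (bigD1 j) //= -/(D' j) mulrnA mulrzA -pmulrn; congr (_ *+ _).
rewrite /d mulrnA -mulrnAl qden mulrzl.
by rewrite !pmulrn -!mulrzA mulrC.
Qed.

Theorem theorem4p2 (R : realType) (k : fieldType) (n : nat)
    (hk : [pchar k] =i pred0) (hn : (2 <= n)%N)
    (nu : valuation R {mps k[n]}) (hnu : centered nu) (habh : abhyankar nu)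
    (N : nat) (hN : dimQ (tensorQ (value_group (frac_val nu))) N)
    (Kh : fieldType) (vh : valuation R Kh)
    (iK : {rmorphism {fraction {mps k[n]}} -> Kh})
    (hKh : vcompletion (frac_val nu) vh iK)
    (G : R -> set Kh) (hG : grading nu vh iK G)
    (Omega : closedFieldType) (iO : {rmorphism Kh -> Omega})
    (hO : forall y, algebraicOver iO y)
    (vO : valuation R Omega) (hvO : forall y, vO (iO y) = vh y)
    (B : set Kh) (hB : B = Vfg vh G \/ B = Vhat vh)
    (gamma : 'I_N -> Omega) (hgamma : forall j, homogeneous vh G iO (gamma j))
    (d : nat) (P : {poly Omega}) (hPmonic : P \is monic)
    (hPdeg : size P = d.+1)
    (hP : forall i, vadjoin iO vO B gamma P`_i) :
  exists gamma' : 'I_N -> Omega,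
    (forall j, integral_homogeneous nu vh iK G iO (gamma' j)) /\
    (forall z, root P z -> vadjoin iO vO B gamma' z).
Proof.
have hgr := grading_graded hKh hG.
have [hD GD henD] := base_field hgr (vcompl_complete hKh) hB.
set D := frac_set B in hD GD henD.
pose F := iO @` D; have hF : subfield F by exact: subfield_image.
have henF : henselian vO F by apply: henselian_image henD => //; exact: sf0 hD.
have GF i g : G i g -> F (iO g) by move=> Gg; exists g => //; exact: GD Gg.
have FK : F `<=` range iO by move=> _ [x _ <-]; exists x.
have vK (p : {mps k[n]}) : vh (iK p%:F) = nu p.
  have := frac_val_div nu p (oner_neq0 _); rewrite tofrac1 divr1 vfun1 sube0.
  by rewrite (vcompl_ext hKh).
have v_nat m : (0 < m)%N -> vO m%:R = 0%E.
  move=> m0; have <- : iO (iK (m%:R : {mps k[n]})%:F) = m%:R by rewrite !rmorph_nat.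
  by rewrite hvO vK; exact: centered_nat.
have [x [r [r0 nux]]] : exists (x : {mps k[n]}) r, 0 < r /\ nu x = r%:E.
  have [r r0 vr] := centered_variable hnu (Ordinal (ltnW hn)).
  by exists (mps_of_mpoly 'X_(Ordinal (ltnW hn))), r.
have nzx : x != 0 by apply/eqP => x0; rewrite x0 vfun0 in nux.
(* The image of the power series, from which integral coefficients are taken. *)
pose A : set Kh := [set iK p%:F | p in setT].
have Apos : exists y s, [/\ A y, 0 < s & vh y = s%:E].
  by exists (iK x%:F), r; split=> //; [exists x | rewrite vK].
have AM y y' : A y -> A y' -> A (y * y').
  by move=> [p _ <-] [p' _ <-]; exists (p * p'); rewrite // tofracM rmorphM.
have A0 : A 0 by exists 0; rewrite // tofrac0 rmorph0.
have A1 : A 1 by exists 1; rewrite // tofrac1 rmorph1.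
have Aappr y : y != 0 -> exists a b, [/\ A a, A b, b != 0 & (vh y < vh (y - a / b)%R)%E].
  move=> ny; have [u nu' lt] := vcompletion_approx hKh ny.
  have [a [b [nb uE]]] := fracP u.
  exists (iK a%:F), (iK b%:F); split; [by exists a|by exists b| |].
    by rewrite fmorph_eq0 tofrac_eq0.
  by move: lt; rewrite uE fmorph_div.
have Gpos : exists i g, [/\ 0 < i, G i g & g != 0].
  have nzK : iK x%:F != 0 by rewrite fmorph_eq0 tofrac_eq0.
  have [i [g [Gg vi lt]]] := gr_lead hgr nzK; exists i, g; split=> //.
    by move: vi; rewrite vK nux => -[<-].
  by have [] := gr_lead_neq0 vi lt.
(* A rational basis of the value group, and homogeneous elements [z] of these
degrees. *)
have [gv [gvA gvspan]] := rational_basis hN.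
have vgroup i g : G i g -> g != 0 -> value_group (frac_val nu) i.
  move=> Gg ng; have [u nzu lt] := vcompletion_approx hKh ng.
  exists u => //; rewrite -(vcompl_ext hKh) -(gr_val hgr Gg ng).
  by apply: val_close; rewrite valB.
have zex j : exists z, G (gv j) z /\ z != 0.
  have [u nzu vu] := gvA j.
  have nzK : iK u != 0 by rewrite fmorph_eq0.
  have [i [g [Gg vi lt]]] := gr_lead hgr nzK; exists g; split.
    by move: vi Gg; rewrite (vcompl_ext hKh) vu => -[->].
  by have [] := gr_lead_neq0 vi lt.
pose z j := projT1 (cid (zex j)).
have Gz j : G (gv j) (z j) by rewrite /z; case: cid => ? [].
have nz j : z j != 0 by rewrite /z; case: cid => ? [].
have j0 : 'I_N.
  case: (N) gv gvspan {gvA zex z Gz nz hN gamma hgamma hP} => [|N'] gv gvspan; last exact: ord0.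
  exfalso; have [|m [c [m0]]] := gvspan r.
    exists x%:F; first by rewrite tofrac_eq0.
    by rewrite -(vcompl_ext hKh) vK.
  rewrite big_ord0 => /eqP; rewrite mulrn_eq0 eqn0Ngt m0 /= => /eqP e.
  by move: r0; rewrite e ltxx.
have Fgamma j : algover F (gamma j).
  have [e [p [_ [pm hp] _ hGp]]] := hgamma j.
  exists (map_poly iO p); split.
  - by rewrite map_poly_eq0 monic_neq0.
  - move=> i; rewrite coef_map; exists p`_i => //.
    have [lt|le] := ltnP i (size p); last by rewrite nth_default //; exact: sf0 hD.
    have sp : (0 < size p)%N by apply: leq_ltn_trans lt.
    have [->|ne] := eqVneq i (size p).-1.
      by rewrite -lead_coefE (monicP pm); exact: sf1 hD.
    have lt' : (i < (size p).-1)%N by rewrite ltn_neqAle ne -ltnS prednK.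
    rewrite -[i](subKn (ltnW lt')).
    apply: GD; apply: hGp; rewrite subn_gt0 lt' /=.
    by rewrite (leq_ltn_trans (leq_subr _ _)) // prednK.
  by rewrite hp.
have FP i : algover F P`_i by have [_ /(mpoly_values_alg hD)] := hP i; apply.
have [rs PE] := closed_field_poly_normal P.
have nzP : P != 0 by exact: monic_neq0.
have rsP y : (y \in rs) = root P y.
  by rewrite PE rootZ ?lead_coef_eq0 // root_prod_XsubC.
have spanrs y : y \in rs -> rhom_span G iO F y.
  rewrite rsP => Py; have Fy := algover_root hF nzP FP Py.
  exact: (algover_rhom_span hgr hvO v_nat Gpos hF henF GF FK).
have [hs [rhs hsT]] := rhom_span_seq spanrs.
have [gam [rgam gamT]] := rhom_generators hgr hvO (val_nat_char v_nat) GF j0 Gz nz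
  (fun i g Gg ng => gvspan i (vgroup i g Gg ng)) rhs.
have bex j := rhom_integral hgr hvO A0 A1 AM Apos Aappr (rgam j).
pose b j := projT1 (cid (bex j)).
have bP j : exists i, [/\ G i (b j), b j != 0 &
    exists e p, homogeneous_poly vh G iO e p (iO (b j) * gam j) /\
    forall l, (0 < l < size p)%N -> exists2 y, A y &
      ((e *+ l)%:E <= vh y)%E /\ ((e *+ l)%:E < vh (p`_((size p).-1 - l) - y)%R)%E].
  by rewrite /b; case: cid.
exists (fun j => iO (b j) * gam j); split.
  move=> j; have [i [_ _ [e [p [hp hA]]]]] := bP j; exists e, p; split=> // l hl.
  by have [_ [q _ <-] [ge lt]] := hA l hl; exists q; rewrite -?vK.
move=> y Py; split.
  by apply: (val_root_ge0 hPmonic _ Py) => i; have [] := hP i.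
pose T := mpoly_values iO D (fun j => iO (b j) * gam j).
have hT : subfield T.
  apply: (subfield_mpoly_values hD) => j; apply: (rhom_algover hF GF).
  apply: (rhomM hgr) => //; have [i [Gb nb _]] := bP j; exact: (rhom_hom hgr iO Gb).
apply: (hsT T hT); last by rewrite rsP.
  by move=> _ [u Du <-]; exact: (mpoly_values_const iO hD).
apply: (gamT b _ T hT).
- by move=> j; have [i [Gb nb _]] := bP j; split=> //; exists i.
- by move=> _ [u Du <-]; exact: (mpoly_values_const iO hD).
by move=> j; exact: (mpoly_values_gen iO hD (fun j => iO (b j) * gam j)).
Qed.
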